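(* Let $N\ge2$ and $t(z)=\mathrm{Tr}\big(L^+(q^{c/2}z)L^-(z)^{-1}\big)$ in $\mathcal A_{q,p}(\widehat{sl}(N)_c)$. The elements $t(z)$ form a closed algebra under the natural Poisson bracket (defined in the context) on the center of $\mathcal A_{q,p}(\widehat{sl}(N)_c)$ at $c=-N$, given by, with $x=w/z$, $$\{t(z),t(w)\}=-\ln q\left(x\frac{d}{dx}\ln\tau_N(q^{1/2}x)-x^{-1}\frac{d}{dx^{-1}}\ln\tau_N(q^{1/2}x^{-1})\right)t(z)\,t(w).$$
   Context: Parameters: $z=e^{i\pi\xi}$, $q=e^{i\pi\zeta}$, $p=e^{2i\pi\tau}$ with $|q|<1$, $|p|<1$; $z^a=e^{i\pi a\xi}$, $q^a=e^{i\pi a\zeta}$, $p^a=e^{2i\pi a\tau}$, $\ln q=i\pi\zeta$. $\omega=e^{2i\pi/N}$. Matrix indices lie in $\mathbb Z_N=\mathbb Z/N\mathbb Z$. Theta functions: $\vartheta\left[{\gamma_1\atop\gamma_2}\right](\xi,\tau)=\sum_{m\in\mathbb Z}\exp\big(i\pi(m+\gamma_1)^2\tau+2i\pi(m+\gamma_1)(\xi+\gamma_2)\big)$; $(z;p_1,\dots,p_m)_\infty=\prod_{n_i\ge0}(1-zp_1^{n_1}\cdots p_m^{n_m})$; $\Theta_p(z)=(z;p)_\infty(pz^{-1};p)_\infty(p;p)_\infty$. $R$-matrix: $g_{ij}=\omega^i\delta_{ij}$, $h_{ij}=\delta_{i+1,j}$, $g^{1/2}=\mathrm{diag}(\omega^{i/2})_{0\le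 i\le N-1}$, $I_{(\alpha_1,\alpha_2)}=g^{\alpha_2}h^{\alpha_1}$, $$W_{(\alpha_1,\alpha_2)}(\xi,\zeta,\tau)=\frac{\vartheta\left[{1/2+\alpha_1/N\atop 1/2+\alpha_2/N}\right](\xi+\zeta/N,\tau)}{N\,\vartheta\left[{1/2+\alpha_1/N\atop 1/2+\alpha_2/N}\right](\zeta/N,\tau)},$$ $$\frac1{\kappa(z^2)}=\frac{(q^{2N}z^{-2};p,q^{2N})_\infty(q^2z^2;p,q^{2N})_\infty(pz^{-2};p,q^{2N})_\infty(pq^{2N-2}z^2;p,q^{2N})_\infty}{(q^{2N}z^2;p,q^{2N})_\infty(q^2z^{-2};p,q^{2N})_\infty(pz^2;p,q^{2N})_\infty(pq^{2N-2}z^{-2};p,q^{2N})_\infty},$$ $$\widetilde R(z,q,p)=z^{2/N-2}\frac1{\kappa(z^2)}\frac{\vartheta\left[{1/2\atop1/2}\right](\zeta,\tau)}{\vartheta\left[{1/2\atop1/2}\right](\xi+\zeta,\tau)}\sum_{(\alpha_1,\alpha_2)\in\mathbb Z_N^2}W_{(\alpha_1,\alpha_2)}(\xi,\zeta,\tau)\,I_{(\alpha_1,\alpha_2)}\otimes I_{(\alpha_1,\alpha_2)}^{-1},$$ $$R(z,q,p)=(g^{1/2}\otimes g^{1/2})\widetilde R(z,q,p)(g^{-1/2}\otimes g^{-1/2}),\quad \tau_N(z)=z^{2/N-2}\frac{\Theta_{q^{2N}}(qz^2)}{\Theta_{q^{2N}}(qz^{-2})},\quad \widehat R_{12}(z,q,p)=\tau_N(q^{1/2}z^{-1})R_{12}(z,q,p).$$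 $R_{21}=PR_{12}P$ with $P$ the flip; $t_2$ is transposition in the second tensor factor. Algebra: $\mathcal A_{q,p}(\widehat{gl}(N)_c)$ is the algebra of operators $L_{ij}(z)=\sum_{n\in\mathbb Z}L_{ij}(n)z^n$, gathered in the matrix $L(z)=(L_{ij}(z))$, subject to $\widehat R_{12}(z/w)L_1(z)L_2(w)=L_2(w)L_1(z)\widehat R^*_{12}(z/w)$, with $L_1(z)=L(z)\otimes1$, $L_2(z)=1\otimes L(z)$, $\widehat R^*_{12}(z,q,p)=\widehat R_{12}(z,q,pq^{-2c})$. The $q$-determinant $q\text{-}\det L(z)=\sum_{\sigma\in\mathfrak S_N}\varepsilon(\sigma)\prod_{i=1}^NL_{i,\sigma(i)}(zq^{i-N-1})$ is central and $\mathcal A_{q,p}(\widehat{sl}(N)_c)=\mathcal A_{q,p}(\widehat{gl}(N)_c)/\langle q\text{-}\det L-q^{c/2}\rangle$. Further $L^+(z)=L(q^{c/2}z)$ and $L^-(z)=(g^{1/2}hg^{1/2})L(-p^{1/2}z)(g^{1/2}hg^{1/2})^{-1}$. Natural Poisson bracket: put $\mathcal L(z)=L^+(q^{c/2}z)L^-(z)^{-1}$, so $t(z)=\mathrm{Tr}\,\mathcal L(z)$. For general $c$ one has (summation over repeated indices) $$t(z)t(w)=\mathcal Y(w/z)^{i_1i_2}_{j_1j_2}\,\mathcal L(w)^{j_2}_{i_2}\,\mathcal L(z)^{j_1}_{i_1},\qquad \mathcal Y(w/z)=T(w/z)\,\mathcal M(w/z),$$ $$\mathcal M(w/z)=\Big(\big(R_{21}(w/z)\,R_{21}(q^{c+N}w/z)^{-1}\,R_{12}(z/w)^{-1}\big)^{t_2}\,R_{12}(q^cz/w)^{t_2}\Big)^{t_2},\quad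 T(w/z)=\frac{\tau_N(q^{1/2}z/w)\,\tau_N(q^{1/2-c}w/z)}{\tau_N(q^{1/2}w/z)\,\tau_N(q^{1/2-c}z/w)},$$ and $\mathcal Y$ is the identity at $c=-N$, so that $t(z)t(w)=t(w)t(z)$ there. The natural Poisson bracket is defined, with $q,p$ fixed, by $$\{t(z),t(w)\}=\Big(\frac{d\mathcal Y}{dc}(w/z)\Big)^{i_1i_2}_{j_1j_2}\,\mathcal L(w)^{j_2}_{i_2}\,\mathcal L(z)^{j_1}_{i_1}\Big|_{c=-N}.$$ The notation $x^{-1}\frac{d}{dx^{-1}}\ln\tau_N(q^{1/2}x^{-1})$ means $y\frac{d}{dy}\ln\tau_N(q^{1/2}y)$ evaluated at $y=x^{-1}$. *)

(* Defs.v *)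
From HB Require Import structures.
From mathcomp Require Import all_boot all_order all_algebra all_fingroup.
From mathcomp Require Import all_classical all_reals all_analysis.
From mathcomp Require Import complex mxtens.

Set Implicit Arguments.
Unset Strict Implicit.
Unset Printing Implicit Defensive.

Import Order.TTheory GRing.Theory Num.Theory.
Import numFieldNormedType.Exports.

Local Open Scope classical_set_scope.
Local Open Scope ring_scope.

(* Multiplicative variables are handled through their logarithms:
     z = e^(i pi xi),  q = e^(i pi zeta),  p = e^(2 i pi tau),
   so that q^a p^b z is  a zeta + 2 b tau + xi,  z^-1 is
   - xi  and  - z  is  xi + 1.  A "function of z" is a function of xi; this
   fixes the branch of the fractional powers of z in R and tau_N, which are
   not functions of z alone.  The topology and the derivative on the complex
   numbers are those of R[i]^o, i.e. of R[i] as a normed module over itself. *)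

Section ComplexFunctions.
Variable R : realType.
Local Notation C := R[i].

Definition clim (u : nat -> C) : C := lim ((u : nat -> C^o) @ \oo).

Definition cderive (f : C -> C) (x : C) : C := derive1 (f : C^o -> C^o) x.

Definition cderivable (f : C -> C) (x : C) : Prop :=
  derivable (f : C^o -> C^o) x 1.

Definition cexp (x : C) : C :=
  Complex (expR (complex.Re x) * cos (complex.Im x))
          (expR (complex.Re x) * sin (complex.Im x)).

Definition ipi : C := Complex 0 (pi : R).

Definition epi (x : C) : C := cexp (ipi * x).

(* z d/dz ln f,  as a function of xi: with z = e^(i pi xi), z d/dz is
   (i pi)^-1 d/dxi. *)
Definition dlog (f : C -> C) (xi : C) : C := cderive f xi / (ipi * f xi).

(* (z; p_1, ..., p_m)_oo, as an iterated infinite product *)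
Fixpoint qpoch (z : C) (ps : seq C) : C :=
  if ps is p :: ps' then clim (fun n => \prod_(k < n) qpoch (z * p ^+ k) ps')
  else 1 - z.

Definition Theta (p z : C) : C :=
  qpoch z [:: p] * qpoch (p / z) [:: p] * qpoch p [:: p].

(* The sum over m in Z is the limit of the sums over - n <= m <= n. *)
Definition theta (g1 g2 xi tau : C) : C :=
  clim (fun n => \sum_(k < n.*2.+1)
    let m : C := k%:R - n%:R in
    cexp (ipi * (m + g1) ^+ 2 * tau + 2 * ipi * (m + g1) * (xi + g2))).

(* (e^(i pi xi))^2 is not in p^Z q^(2Z) *)
Definition generic (zeta tau xi : C) : Prop :=
  forall a b : int,
    epi (2 * xi) != epi (2 * (a%:~R * tau)) * epi (2 * (b%:~R * zeta)).

(* q^2 is not in p^Z, i.e. no denominator of the W_alpha(xi, zeta, tau)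
   vanishes *)
Definition q_regular (zeta tau : C) : Prop :=
  forall a : int, epi (2 * zeta) != epi (2 * (a%:~R * tau)).

End ComplexFunctions.

Section RMatrix.
Variables (R : realType) (N : nat).
Local Notation C := R[i].
Implicit Types xi zeta tau c : C.

Definition gmx : 'M[C]_N := \matrix_(i, j) (epi (2 / N%:R) ^+ i *+ (i == j)).

Definition gmx_half : 'M[C]_N := \matrix_(i, j) (epi (i%:R / N%:R) *+ (i == j)).

Definition hmx : 'M[C]_N := \matrix_(i, j) ((i.+1 %% N == j)%N)%:R.

(* Z_N is represented by {0, ..., N-1}: both I_alpha and W_alpha only depend
   on alpha modulo N. *)
Definition Imx (a1 a2 : 'I_N) : 'M[C]_N := gmx ^+ a2 *m hmx ^+ a1.

Definition W (a1 a2 : 'I_N) xi zeta tau : C :=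
  let g1 := 1 / 2 + a1%:R / N%:R in
  let g2 := 1 / 2 + a2%:R / N%:R in
  theta g1 g2 (xi + zeta / N%:R) tau
    / (N%:R * theta g1 g2 (zeta / N%:R) tau).

(* 1 / kappa(z^2) *)
Definition kappaV xi zeta tau : C :=
  let u := epi (2 * xi) in
  let p := epi (2 * tau) in
  let q := epi zeta in
  let ps := [:: p; q ^+ (2 * N)] in
  (qpoch (q ^+ (2 * N) / u) ps * qpoch (q ^+ 2 * u) ps
    * qpoch (p / u) ps * qpoch (p * q ^+ (2 * N - 2) * u) ps)
  / (qpoch (q ^+ (2 * N) * u) ps * qpoch (q ^+ 2 / u) ps
    * qpoch (p * u) ps * qpoch (p * q ^+ (2 * N - 2) / u) ps).

Definition Rtilde xi zeta tau : 'M[C]_(N * N) :=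
  (epi ((2 / N%:R - 2) * xi) * kappaV xi zeta tau
    * (theta (1 / 2) (1 / 2) zeta tau / theta (1 / 2) (1 / 2) (xi + zeta) tau))
  *: \sum_(a1 < N) \sum_(a2 < N)
       W a1 a2 xi zeta tau *: (Imx a1 a2 *t invmx (Imx a1 a2)).

Definition Rmx xi zeta tau : 'M[C]_(N * N) :=
  (gmx_half *t gmx_half) *m Rtilde xi zeta tau
    *m (invmx gmx_half *t invmx gmx_half).

Definition tauN xi zeta : C :=
  let u := epi (2 * xi) in
  let q := epi zeta in
  epi ((2 / N%:R - 2) * xi)
    * (Theta (q ^+ (2 * N)) (q * u) / Theta (q ^+ (2 * N)) (q / u)).

Definition Rhat xi zeta tau : 'M[C]_(N * N) :=
  tauN (zeta / 2 - xi) zeta *: Rmx xi zeta tau.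

Definition flip : 'M[C]_(N * N) :=
  \matrix_(i, j) (mxtens_unindex j == ((mxtens_unindex i).2, (mxtens_unindex i).1))%:R.

Definition R21 xi zeta tau : 'M[C]_(N * N) := flip *m Rmx xi zeta tau *m flip.

(* transposition in the second tensor factor *)
Definition tr2 (M : 'M[C]_(N * N)) : 'M[C]_(N * N) :=
  \matrix_(i, j) M (mxtens_index ((mxtens_unindex i).1, (mxtens_unindex j).2))
                   (mxtens_index ((mxtens_unindex j).1, (mxtens_unindex i).2)).

(* In the next three definitions  xi  stands for w/z. *)
Definition Mmx zeta tau xi c : 'M[C]_(N * N) :=
  tr2 (tr2 (R21 xi zeta tau
              *m invmx (R21 ((c + N%:R) * zeta + xi) zeta tau)
              *m invmx (Rmx (- xi) zeta tau))
         *m tr2 (Rmx (c * zeta - xi) zeta tau)).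

Definition Tfactor zeta xi c : C :=
  (tauN (zeta / 2 - xi) zeta * tauN ((1 / 2 - c) * zeta + xi) zeta)
  / (tauN (zeta / 2 + xi) zeta * tauN ((1 / 2 - c) * zeta - xi) zeta).

Definition Ymx zeta tau xi c : 'M[C]_(N * N) :=
  Tfactor zeta xi c *: Mmx zeta tau xi c.

End RMatrix.

Section EllipticAlgebra.
Variables (R : realType) (N : nat) (A : algType R[i]).
Local Notation C := R[i].
Implicit Types (c zeta tau xi : C) (L : C -> 'M[A]_N).

(* tau* with p* = p q^(-2c) *)
Definition tau_star c zeta tau : C := tau - c * zeta.

(* An algebra A with a family L(z) of matrices of elements of A satisfying the
   defining relations below is a realization of the algebra presented by these
   relations; universally quantified statements over (A, L) are statements
   about the presented algebra.  The exchange relation is an identity of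
   meromorphic functions of z/w, imposed off the set containing the
   singularities of R and R*. *)
Definition Aqp_gl c zeta tau L : Prop :=
  forall xi1 xi2 : C,
    generic zeta tau (xi1 - xi2) ->
    generic zeta (tau_star c zeta tau) (xi1 - xi2) ->
    map_mx (in_alg A) (Rhat N (xi1 - xi2) zeta tau)
      *m (L xi1 *t (1%:M : 'M[A]_N)) *m ((1%:M : 'M[A]_N) *t L xi2)
    = ((1%:M : 'M[A]_N) *t L xi2) *m (L xi1 *t (1%:M : 'M[A]_N))
      *m map_mx (in_alg A) (Rhat N (xi1 - xi2) zeta (tau_star c zeta tau)).

(* Rows are numbered from 0, whence z q^(i - N); the products are ordered. *)
Definition qdet zeta L xi : A :=
  \sum_(s : 'S_N) (-1) ^+ s *
    \prod_(i < N) L (xi + (i%:R - N%:R) * zeta) i (s i).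

Definition Aqp_sl c zeta tau L : Prop :=
  Aqp_gl c zeta tau L /\ forall xi, qdet zeta L xi = (epi (c / 2 * zeta))%:A.

Definition Lplus c zeta L xi : 'M[A]_N := L (xi + c / 2 * zeta).

Definition twist : 'M[C]_N := gmx_half R N *m hmx R N *m gmx_half R N.

(* - p^(1/2) z  is  xi + tau + 1 *)
Definition Lminus tau L xi : 'M[A]_N :=
  map_mx (in_alg A) twist *m L (xi + tau + 1)
    *m map_mx (in_alg A) (invmx twist).

Definition is_inverse (X Y : 'M[A]_N) : Prop := X *m Y = 1%:M /\ Y *m X = 1%:M.

(* K stands for  z |-> L^-(z)^-1 *)
Definition calL c zeta L (K : C -> 'M[A]_N) xi : 'M[A]_N :=
  Lplus c zeta L (xi + c / 2 * zeta) *m K xi.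

Definition tgen c zeta L (K : C -> 'M[A]_N) xi : A := \tr (calL c zeta L K xi).

(* The natural Poisson bracket {t(z), t(w)} at c = - N: the derivative is taken
   in the parameter c of Y, with q and p fixed. *)
Definition natural_bracket zeta tau L (K : C -> 'M[A]_N) xiz xiw : A :=
  \sum_(i1 < N) \sum_(i2 < N) \sum_(j1 < N) \sum_(j2 < N)
    cderive (fun c => Ymx N zeta tau (xiw - xiz) c
                        (mxtens_index (i1, i2)) (mxtens_index (j1, j2)))
            (- N%:R)
    *: (calL (- N%:R) zeta L K xiw j2 i2 * calL (- N%:R) zeta L K xiz j1 i1).

End EllipticAlgebra.

(* Main.v *)
Require Import Defs.
From HB Require Import structures.
From mathcomp Require Import all_boot all_order all_algebra all_fingroup.
From mathcomp Require Import all_classical all_reals all_analysis.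
From mathcomp Require Import complex mxtens.
From mathcomp Require Import ring lra zify.

Set Implicit Arguments.
Unset Strict Implicit.
Unset Printing Implicit Defensive.

Import Order.TTheory GRing.Theory Num.Theory.
Import numFieldNormedType.Exports.

Local Open Scope ring_scope.

(** Write p* for p q^(- 2 c), and G for the twist that enters L^-.  The
    theorem rests on three identities for the matrix R: unitarity ([R_unit]), crossing
    ([R_cross]: R_12(u) and R_21(q^(- N) u^-1) become inverse to each other once the second
    factor is transposed in both), and quasi-periodicity ([R_tau]: multiplying u by
    - p^(1/2) conjugates R by G and multiplies the rescaled matrix by a value of tau_N).
    Moreover f(u) = tau_N(q^(1/2) u) is invariant under u -> q^N u ([ftau_periodic]).

    Centrality.  At c = - N, quasi-periodicity for the nomes p and p* turns the exchange
    relation of L into one between L^-(z) and L(w).  Its right-hand matrix is that of the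
    relation between L(q^c z) and L(w), so that it drops out of the relation for the
    quotient: calL_1(z) R_21(w/z) L_2(w) = R_21(q^N w/z) L_2(w) calL_1(z) ([exch_calL]).  By
    unitarity and crossing, the inverse of the partial transpose of R_21(w/z) is also the
    partial transpose of the inverse of R_21(q^N w/z); multiplying by it and taking the
    trace over the first factor leaves t(z) L(w) = L(w) t(z) ([trace_commute]).

    The bracket.  Near c = - N, unitarity and crossing express all the inverses in M, and
    the contributions of its two factors to the derivative at c = - N cancel
    ([cancelling_derivative]).  Hence Y' = T' Id, and T' is the difference of logarithmic
    derivatives of the statement, because T is a product of values of f and f is
    periodic ([Tfactor_derivative]).  The bracket is then T' t(w) t(z), and t(z) and t(w)
    commute.  Since the generic points do not form an open set, unitarity and crossing are
    stated where a certain differentiable function [reg] does not vanish.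

    The three identities.  R is a sum over the torsion points alpha of W_alpha times
    I_alpha (x) I_alpha^-1.  Products of such sums are convolutions of the coefficients,
    twisted by a character or, after partial transposition, untwisted; so that unitarity
    and crossing amount to identities for the coefficients ([unit_coef], [cross_coef]).
    These follow from one fact: up to a scalar, the family W is its own finite Fourier
    transform, with the two variables exchanged ([duality]).  The proofs compare theta
    functions: analytic functions on the punctured plane with F(p X) = c F(X) / X^n are
    determined by n of their Laurent coefficients ([coefs_rec], [rec_eq0]), and here
    analytic means being a uniform limit of Laurent polynomials on every annulus.  The
    infinite products in kappa supply the scalars that make the three identities exact
    ([cR_unit], [cR_cross], [cR_tau]). *)

(** * Complex sequences *)

Section ComplexNorm.
Variable R : realType.
Local Notation C := R[i].
Local Notation Re := complex.Re.
Local Notation Im := complex.Im.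
Local Open Scope complex_scope.

(** The norm of R[i] takes its values in R[i]; all estimates are made on this real
    number instead. *)
Definition nrm (x : C) : R := Re `|x|.

Lemma normE (x : C) : `|x| = (nrm x)%:C.
Proof. by rewrite /nrm normc_def. Qed.

Lemma nrmE (x : C) : nrm x = Num.sqrt (Re x ^+ 2 + Im x ^+ 2).
Proof. by rewrite /nrm normc_def. Qed.

Lemma nrm_ge0 x : 0 <= nrm x.
Proof. by rewrite nrmE sqrtr_ge0. Qed.

Lemma nrmM x y : nrm (x * y) = nrm x * nrm y.
Proof. by apply: complexI; rewrite rmorphM /= -!normE normrM. Qed.

Lemma nrmD x y : nrm (x + y) <= nrm x + nrm y.
Proof. by rewrite -lecR rmorphD /= -!normE ler_normD. Qed.

Lemma nrmN x : nrm (- x) = nrm x.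
Proof. by rewrite /nrm normrN. Qed.

Lemma nrmB x y : nrm (x - y) <= nrm x + nrm y.
Proof. by rewrite -(nrmN y) nrmD. Qed.

Lemma nrmC x y : nrm (x - y) = nrm (y - x).
Proof. by rewrite -nrmN opprB. Qed.

Lemma nrm0 : nrm 0 = 0.
Proof. by rewrite /nrm normr0. Qed.

Lemma nrm1 : nrm 1 = 1.
Proof. by rewrite /nrm normr1. Qed.

Lemma nrm_eq0 x : (nrm x == 0) = (x == 0).
Proof. by rewrite -(inj_eq (@complexI R)) -normE normr_eq0. Qed.

Lemma nrm_gt0 x : (0 < nrm x) = (x != 0).
Proof. by rewrite lt_def nrm_ge0 andbT nrm_eq0. Qed.

Lemma nrmX x n : nrm (x ^+ n) = nrm x ^+ n.
Proof. by elim: n => [|n IH]; rewrite ?expr0 ?nrm1 // !exprS nrmM IH. Qed.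

Lemma nrmV x : nrm x^-1 = (nrm x)^-1.
Proof.
have [->|x0] := eqVneq x 0; first by rewrite !invr0 nrm0 invr0.
apply: (@mulIf _ (nrm x)); first by rewrite nrm_eq0.
by rewrite -nrmM !mulVf ?nrm1 ?nrm_eq0.
Qed.

Lemma nrm_nat n : nrm n%:R = n%:R.
Proof. by apply: complexI; rewrite -normE normr_nat rmorph_nat. Qed.

Lemma nrm_prod (I : Type) (r : seq I) (P : pred I) (F : I -> C) :
  nrm (\prod_(i <- r | P i) F i) = \prod_(i <- r | P i) nrm (F i).
Proof. exact: (big_morph nrm nrmM nrm1). Qed.

Lemma nrm_sum (I : Type) (r : seq I) (P : pred I) (F : I -> C) :
  nrm (\sum_(i <- r | P i) F i) <= \sum_(i <- r | P i) nrm (F i).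
Proof.
elim/big_rec2: _ => [|i y1 y2 _ le]; first by rewrite nrm0.
by apply: (le_trans (nrmD _ _)); rewrite lerD2l.
Qed.

Lemma nrm_triangle y x z : nrm (x - z) <= nrm (x - y) + nrm (y - z).
Proof. by apply: le_trans (nrmD _ _); rewrite addrA subrK. Qed.

Lemma nrm_real (x : R) : nrm (x%:C) = `|x|.
Proof. by rewrite nrmE /= expr0n addr0 sqrtr_sqr. Qed.

Lemma Re_le_nrm x : `|Re x| <= nrm x.
Proof. by rewrite -lecR -normE normc_ge_Re. Qed.

Lemma Im_le_nrm x : `|Im x| <= nrm x.
Proof.
by rewrite nrmE -sqrtr_sqr ler_wsqrtr // lerDr sqr_ge0.
Qed.

Lemma nrm_le_ReIm x : nrm x <= `|Re x| + `|Im x|.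
Proof.
rewrite nrmE -[leRHS]ger0_norm ?addr_ge0 // -sqrtr_sqr ler_wsqrtr //.
by rewrite -(real_normK (num_real (Re x))) -(real_normK (num_real (Im x)))
  sqrrD lerD2r lerDl mulrn_wge0 // mulr_ge0.
Qed.

Definition tends (u : nat -> C) (l : C) :=
  forall e : R, 0 < e -> exists n0, forall n, (n0 <= n)%N -> nrm (u n - l) < e.

Lemma tends_cvg u l : tends u l -> ((u : nat -> C^o) @ \oo --> (l : C^o))%classic.
Proof.
move=> ul; apply/cvgrPdist_lt => -[e e'] /=; rewrite ltcE /= => /andP[/eqP -> e0].
have [n0 Hn] := ul e e0; near=> n; rewrite distrC.
rewrite [`|_|](normE (u n - l)) ltcE /= eqxx /=.
by apply: Hn; near: n; exact: nbhs_infty_ge.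
Unshelve. all: by end_near. Qed.

Lemma clim_eq u l : tends u l -> clim u = l.
Proof. by move=> /tends_cvg ul; exact: (cvg_lim (@norm_hausdorff C C^o) ul). Qed.

Lemma tends_uniq u l m : tends u l -> tends u m -> l = m.
Proof. by move=> /clim_eq <- /clim_eq <-. Qed.

Lemma eq_tends u v l : u =1 v -> tends u l -> tends v l.
Proof. by move=> uv ul e /ul[n H]; exists n => k /H; rewrite uv. Qed.

Lemma tends_cst l : tends (fun=> l) l.
Proof. by move=> e e0; exists 0%N => n _; rewrite subrr nrm0. Qed.

Lemma tends_shift u l : tends u l -> tends (fun n => u n.+1) l.
Proof. by move=> ul e /ul[n H]; exists n => k nk; apply: H; apply: leqW. Qed.

Lemma tends_bounded u l : tends u l -> exists2 B, 0 < B & forall n, nrm (u n) <= B.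
Proof.
move=> ul; have [n0 Hn] := ul 1 ltr01.
exists (\sum_(k < n0) nrm (u k) + (nrm l + 1)).
  by rewrite ltr_wpDl ?sumr_ge0 ?ltr_wpDl ?nrm_ge0 // => i _; exact: nrm_ge0.
move=> n; have [lt|ge] := ltnP n n0.
  rewrite (bigD1 (Ordinal lt)) //= -addrA lerDl addr_ge0 ?sumr_ge0 //.
    by move=> i _; exact: nrm_ge0.
  by rewrite addr_ge0 ?nrm_ge0.
have /ltW := Hn n ge; rewrite -(lerD2r (nrm l)) => H.
rewrite (le_trans _ (le_trans H _)) //.
  by apply: le_trans (nrmD _ _); rewrite subrK.
by rewrite addrC lerDr sumr_ge0 // => i _; exact: nrm_ge0.
Qed.

Lemma tendsM u v l m : tends u l -> tends v m -> tends (fun n => u n * v n) (l * m).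
Proof.
move=> ul vm e e0; have [B B0 HB] := tends_bounded vm.
have e1 : 0 < e / 2 / B by rewrite !divr_gt0.
have l0 : 0 < nrm l + 1 by rewrite ltr_wpDl ?nrm_ge0.
have e2 : 0 < e / 2 / (nrm l + 1) by rewrite !divr_gt0.
have [n1 H1] := ul _ e1; have [n2 H2] := vm _ e2.
exists (maxn n1 n2) => n; rewrite geq_max => /andP[/H1 h1 /H2 h2].
have -> : u n * v n - l * m = (u n - l) * v n + l * (v n - m) by ring.
rewrite (le_lt_trans (nrmD _ _)) // [e]splitr !nrmM ltrD //.
  rewrite ltr_pdivlMr // in h1; apply: le_lt_trans h1.
  by rewrite ler_wpM2l ?nrm_ge0.
rewrite ltr_pdivlMr // mulrC in h2; apply: le_lt_trans h2.
by rewrite ler_wpM2r ?nrm_ge0 // lerDl.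
Qed.

Lemma tends_cstM c u l : tends u l -> tends (fun n => c * u n) (c * l).
Proof. exact: tendsM (tends_cst c). Qed.

Lemma tends_le u l (a : C) B : tends u l -> (forall n, nrm (u n - a) <= B) ->
  nrm (l - a) <= B.
Proof.
move=> ul H; apply/ler_addgt0Pr => e e0; have [n Hn] := ul _ e0.
rewrite [leRHS]addrC (le_trans (nrm_triangle (u n) _ _)) // lerD //.
by rewrite nrmC ltW // Hn.
Qed.

(** The geometric Cauchy criterion: completeness of the reals is used on real
    and imaginary parts. *)
Lemma geom_lim (u : nat -> C) (B r : R) : 0 <= r < 1 ->
  (forall n, nrm (u n.+1 - u n) <= B * r ^+ n) ->
  exists l, tends u l /\ forall n, nrm (u n - l) <= B * r ^+ n / (1 - r).
Proof.
move=> /andP[r0 r1] H.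
have B0 : 0 <= B by have := H 0%N; rewrite expr0 mulr1; apply: le_trans (nrm_ge0 _).
have r1' : 0 < 1 - r by rewrite subr_gt0.
have cau n k : nrm (u (n + k)%N - u n) <= B * r ^+ n / (1 - r).
  have -> : B * r ^+ n / (1 - r) = (B * r ^+ n * r ^+ k / (1 - r))
     + (\sum_(i < k) B * r ^+ n * r ^+ i).
    rewrite -mulr_sumr.
    have E : (1 - r) * \sum_(i < k) r ^+ i = 1 - r ^+ k.
      by rewrite -[in RHS](expr1n _ k) subrXX; congr (_ * _);
        apply: eq_bigr => i _; rewrite expr1n mul1r.
    have -> : r ^+ k = 1 - (1 - r) * \sum_(i < k) r ^+ i by rewrite E; ring.
    by field; rewrite gt_eqF.
  apply: le_trans (_ : \sum_(i < k) B * r ^+ n * r ^+ i <= _); last first.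
    by rewrite lerDr !mulr_ge0 ?exprn_ge0 // invr_ge0 ltW.
  elim: k => [|k IH]; first by rewrite addn0 subrr nrm0 big_ord0.
  rewrite big_ord_recr /= [leRHS]addrC (le_trans (nrm_triangle (u (n + k)%N) _ _)) //.
  by rewrite lerD // addnS (le_trans (H _)) // exprD mulrA.
have cvgR (f : C -> R) : (forall x y, f (x - y) = f x - f y) ->
    (forall x, `|f x| <= nrm x) ->
    exists a, forall n, `|f (u n) - a| <= B * r ^+ n / (1 - r).
  move=> fB fle.
  have small (e : R) : 0 < e -> exists n, B * r ^+ n / (1 - r) < e.
    move=> e0.
    have : ((fun n => B / (1 - r) * r ^+ n) @ \oo --> B / (1 - r) * 0)%classic.
      by apply: cvgMr => //; apply: cvg_expr; rewrite ger0_norm.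
    rewrite mulr0 => /cvgrPdist_lt /(_ e e0) [n _ /(_ n (leqnn n))] /=.
    rewrite sub0r normrN ger0_norm; last first.
      by rewrite !mulr_ge0 ?exprn_ge0 // invr_ge0 ltW.
    by move=> lt; exists n; rewrite mulrAC.
  have /cvg_ex[/= a fa] : (cvg ((fun n => f (u n)) @ \oo))%classic.
    apply/cauchy_cvgP/cauchy_exP => e /small [n Hn].
    exists (f (u n)); exists n => //= k nk.
    rewrite -ball_normE /= distrC -fB (le_lt_trans (fle _)) //.
    by rewrite (le_lt_trans _ Hn) // -(subnKC nk) cau.
  exists a => n; apply/ler_addgt0Pr => e e0.
  move/cvgrPdist_lt : fa => /(_ e e0) [m _ Hm].
  have := Hm (n + m)%N (leq_addl _ _); rewrite /= => h1.
  have -> : f (u n) - a = (f (u n) - f (u (n + m)%N)) - (a - f (u (n + m)%N)) by ring.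
  rewrite (le_trans (ler_normB _ _)) // lerD ?(ltW h1) //.
  by rewrite -fB (le_trans (fle _)) // nrmC cau.
have [a Ha] := cvgR _ (@raddfB _ _ (@complex.Re R : {additive Rcomplex R -> R})) Re_le_nrm.
have [b Hb] := cvgR _ (@raddfB _ _ (@complex.Im R : {additive Rcomplex R -> R})) Im_le_nrm.
have rn : forall e : R, 0 < e -> exists n0, forall n, (n0 <= n)%N -> B * r ^+ n / (1 - r) < e.
  move=> e e0.
  have : ((fun n => B / (1 - r) * r ^+ n) @ \oo --> B / (1 - r) * 0)%classic.
    by apply: cvgMr => //; apply: cvg_expr; rewrite ger0_norm.
  rewrite mulr0 => /cvgrPdist_lt /(_ e e0) [n _ Hn]; exists n => k nk.
  have := Hn k nk; rewrite /= sub0r normrN ger0_norm; last first.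
    by rewrite !mulr_ge0 ?exprn_ge0 // invr_ge0 ltW.
  by rewrite mulrAC.
have ul : tends u (a +i* b).
  move=> e e0; have [n0 Hn0] := rn _ (divr_gt0 e0 (ltr0Sn _ 1)).
  exists n0 => n /Hn0 lt; rewrite (le_lt_trans (nrm_le_ReIm _)) //.
  rewrite [e]splitr; move: (Ha n) (Hb n); case: (u n) => x y /= h1 h2.
  by rewrite ltrD // (le_lt_trans _ lt).
exists (a +i* b); split => // n; rewrite nrmC.
apply: (tends_le (u := fun k => u (n + k)%N)) => //.
move=> e /ul[m Hm]; exists m => k mk; apply: Hm; exact: (leq_trans mk (leq_addl _ _)).
Qed.
End ComplexNorm.

(** * Complex derivatives *)

Section ComplexDerivative.
Variable R : realType.
Local Notation C := R[i].
Local Notation Re := complex.Re.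
Local Notation Im := complex.Im.
Local Open Scope complex_scope.
Implicit Types (f g phi : C -> C) (x D : C).

(** Continuity at 0 suffices: difference quotients are functions of the increment. *)
Definition cts0 phi := forall e : R, 0 < e ->
  exists2 d : R, 0 < d & forall h, nrm h < d -> nrm (phi h - phi 0) < e.

Lemma near0P (P : C -> Prop) : (\forall h \near (0 : C^o), P h)%classic <->
  exists2 d : R, 0 < d & forall h, nrm h < d -> P h.
Proof.
split=> [/nbhs_ballP[[d d'] /=]|[d d0 H]].
  rewrite ltcE /= => /andP[/eqP -> d0] H; exists d => // h hd; apply: H.
  by rewrite -ball_normE /= sub0r normrN [`|_|](normE h) ltcE /= eqxx.
apply/nbhs_ballP; exists (d%:C); first by rewrite /= ltcE /= eqxx.
move=> h; rewrite -ball_normE /= sub0r normrN [`|_|](normE h) ltcE /=.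
by move=> /andP[_ /H].
Qed.

Lemma cts0P phi : cts0 phi <-> {for (0 : C^o), continuous (phi : C^o -> C^o)}%classic.
Proof.
have E := @cvgrPdist_lt C C^o C^o (nbhs (0 : C^o)) (nbhs_filter _) phi (phi 0).
split=> [H|/(proj1 E) H].
  apply: (proj2 E) => -[e e'] /=; rewrite ltcE /= => /andP[/eqP -> e0].
  apply/near0P; have [d d0 Hd] := H e e0; exists d => // h /Hd.
  by rewrite distrC [`|_|](normE (_ - _)) ltcE /= eqxx.
move=> e e0; have := H (e%:C).
rewrite ltcE /= eqxx => /(_ e0) /near0P[d d0 Hd]; exists d => // h /Hd.
by rewrite distrC [`|_|](normE (_ - _)) ltcE /= eqxx.
Qed.

Lemma cts0_cst c : cts0 (fun=> c).
Proof. by move=> e e0; exists 1 => // h _; rewrite subrr nrm0. Qed.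

Lemma cts0_id : cts0 id.
Proof. by move=> e e0; exists e => // h; rewrite subr0. Qed.

Lemma cts0D f g : cts0 f -> cts0 g -> cts0 (fun h => f h + g h).
Proof. by move=> /cts0P F /cts0P G; apply/cts0P; exact: (cvgD F G). Qed.

Lemma cts0M f g : cts0 f -> cts0 g -> cts0 (fun h => f h * g h).
Proof. by move=> /cts0P F /cts0P G; apply/cts0P; exact: (cvgM F G). Qed.

Lemma cts0V f : f 0 != 0 -> cts0 f -> cts0 (fun h => (f h)^-1).
Proof. by move=> f0 /cts0P F; apply/cts0P; exact: (cvgV f0 F). Qed.

Lemma cts0_comp f g : f 0 = 0 -> cts0 f -> cts0 g -> cts0 (fun h => g (f h)).
Proof.
move=> f0 F G e /G[d d0 Hd]; have [d' d'0 Hd'] := F d d0; exists d' => // h /Hd'.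
by rewrite f0 subr0 => /Hd.
Qed.

(** Caratheodory's form of complex differentiability: the difference quotient
    extends continuously to h = 0.  The rules of calculus reduce to those for
    continuous functions. *)
Definition hasD f x D := exists phi,
  [/\ phi 0 = D, cts0 phi & forall h, f (x + h) = f x + phi h * h].

Lemma hasD_cts f x D : hasD f x D -> cts0 (fun h => f (x + h)).
Proof.
case=> phi [_ c E].
have := cts0D (cts0_cst (f x)) (cts0M c cts0_id).
by move=> H e /H[d d0 Hd]; exists d => // h /Hd; rewrite mulr0 addr0 E E mulr0 addr0.
Qed.

Lemma hasD_local f g x D : (exists2 d : R, 0 < d & forall h, nrm h < d -> g (x + h) = f (x + h)) ->
  hasD f x D -> hasD g x D.
Proof.
case=> r r0 fg [phi [p0 c E]].
have gx : g x = f x by have := fg 0; rewrite nrm0 addr0 => /(_ r0).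
exists (fun h => if h == 0 then D else (g (x + h) - g x) / h); split; first by rewrite eqxx.
  move=> e /c[d d0 Hd]; exists (Num.min r d); first by rewrite lt_min r0.
  move=> h; rewrite lt_min eqxx => /andP[hr hd].
  have [h0|h0] := eqVneq h 0; first by rewrite subrr nrm0 -(nrm0 R) -(subrr (phi 0)) Hd ?nrm0.
  by rewrite fg // gx E addrAC subrr add0r mulfK // -p0 Hd.
move=> h; have [->|h0] := eqVneq h 0; first by rewrite mulr0 !addr0.
by rewrite divfK //; ring.
Qed.

Lemma eq_hasD f g x D : f =1 g -> hasD f x D -> hasD g x D.
Proof. by move=> fg; apply: hasD_local; exists 1. Qed.

(** The form in which the derivative of a uniform limit is found: the constant B
    can be common to all approximating functions. *)
Lemma hasD_quad f x D (d B : R) : 0 < d ->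
  (forall h, nrm h < d -> nrm (f (x + h) - f x - D * h) <= B * nrm h ^+ 2) ->
  hasD f x D.
Proof.
move=> d0 H; exists (fun h => if h == 0 then D else (f (x + h) - f x) / h); split.
- by rewrite eqxx.
- move=> e e0.
  have B1 : 0 < `|B| + 1 by rewrite ltr_wpDl.
  exists (Num.min d (e / (`|B| + 1))); first by rewrite lt_min d0 divr_gt0.
  move=> h; rewrite lt_min ltr_pdivlMr // eqxx => /andP[hd he].
  have [h0|h0] := eqVneq h 0; first by rewrite subrr nrm0.
  have nh : 0 < nrm h by rewrite nrm_gt0.
  have -> : (f (x + h) - f x) / h - D = (f (x + h) - f x - D * h) / h by field.
  rewrite nrmM nrmV ltr_pdivrMr // (le_lt_trans (H _ hd)) //.
  rewrite expr2 mulrA ltr_pM2r // (le_lt_trans _ he) // mulrC ler_pM2l //.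
  by rewrite (le_trans (ler_norm _)) // lerDl.
- move=> h; have [->|h0] := eqVneq h 0; first by rewrite mulr0 !addr0.
  by rewrite divfK //; ring.
Qed.

Lemma hasD_cst c x : hasD (fun=> c) x 0.
Proof. by exists (fun=> 0); split => // [|h]; [exact: cts0_cst|rewrite mul0r addr0]. Qed.

Lemma hasD_id x : hasD id x 1.
Proof. by exists (fun=> 1); split => // [|h]; [exact: cts0_cst|rewrite mul1r]. Qed.

Lemma hasD_add f g x D E : hasD f x D -> hasD g x E -> hasD (fun y => f y + g y) x (D + E).
Proof.
case=> p [p0 pc pE] [q [q0 qc qE]]; exists (fun h => p h + q h); split.
- by rewrite p0 q0.
- exact: cts0D.
- by move=> h; rewrite pE qE; ring.
Qed.

Lemma hasD_mul f g x D E : hasD f x D -> hasD g x E ->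
  hasD (fun y => f y * g y) x (D * g x + f x * E).
Proof.
move=> [p [p0 pc pE]] Hg; have gc := hasD_cts Hg; case: Hg => q [q0 qc qE].
exists (fun h => p h * g (x + h) + f x * q h); split.
- by rewrite p0 q0 addr0.
- exact: cts0D (cts0M _ _) (cts0M (cts0_cst _) _).
- by move=> h; rewrite pE qE; ring.
Qed.

Lemma hasD_scale c f x D : hasD f x D -> hasD (fun y => c * f y) x (c * D).
Proof. by move=> H; have := hasD_mul (hasD_cst c x) H; rewrite mul0r add0r. Qed.

Lemma hasD_inv f x D : f x != 0 -> hasD f x D -> hasD (fun y => (f y)^-1) x (- D / f x ^+ 2).
Proof.
move=> f0 H; have fc := hasD_cts H; case: H => p [p0 pc pE].
have [d d0 Hd] : exists2 d : R, 0 < d & forall h, nrm h < d -> f (x + h) != 0.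
  have [|d d0 Hd] := fc (nrm (f x)); first by rewrite nrm_gt0.
  exists d => // h /Hd; rewrite addr0; apply: contraTneq => ->.
  by rewrite sub0r nrmN ltxx.
pose g h := - p h * (f (x + h))^-1 / f x.
have gc : cts0 g.
  apply: cts0M (cts0_cst _); apply: cts0M; last by apply: cts0V fc; rewrite addr0.
  have := cts0M (cts0_cst (-1)) pc.
  by move=> c e /c[r r0 Hr]; exists r => // h /Hr; rewrite !mulN1r.
apply: (@hasD_local (fun y => if nrm (y - x) < d then (f y)^-1 else (f x)^-1 + g (y - x) * (y - x))).
  exists d => // h hd; have -> : x + h - x = h by ring.
  by rewrite hd.
exists g; split => //; first by rewrite /g p0 addr0 expr2 invfM mulrA.
move=> h; have -> : x + h - x = h by ring.
rewrite subrr nrm0 d0; case: ifP => // /Hd fh.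
have Gh : p h * h = f (x + h) - f x by rewrite pE; ring.
have -> : g h * h = - (p h * h) / f (x + h) / f x by rewrite /g; ring.
by rewrite {}Gh; move: fh f0; move: (f (x + h)) (f x) => G F fh f0; field; rewrite f0 fh.
Qed.

Lemma hasD_comp f g x D E : hasD f x D -> hasD g (f x) E -> hasD (fun y => g (f y)) x (E * D).
Proof.
move=> H [q [q0 qc qE]]; have fc := hasD_cts H; case: H => p [p0 pc pE].
have c1 : cts0 (fun h => p h * h) by apply: cts0M => //; exact: cts0_id.
exists (fun h => q (p h * h) * p h); split.
- by rewrite mulr0 q0 p0.
- exact: cts0M (@cts0_comp (fun h => p h * h) q (mulr0 _) c1 qc) pc.
- by move=> h; rewrite pE qE mulrA.
Qed.

Lemma hasD_cvg f x D : hasD f x D ->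
  ((fun h : C^o => h^-1 *: (f (h + x) - f x) : C^o) @ (0 : C^o)^' --> (D : C^o))%classic.
Proof.
case=> p [<- /cts0P pc pE]; move/continuous_withinNx : pc => pc.
apply: cvg_trans pc; apply: near_eq_cvg; near=> h.
have h0 : h != 0 by near: h; exact: nbhs_dnbhs_neq.
by rewrite [h + x]addrC pE addrAC subrr add0r scalerAl -[h^-1 *: p h]/(h^-1 * p h) mulrAC mulVf ?mul1r.
Unshelve. all: by end_near. Qed.

Lemma hasD_derivable f x D : hasD f x D -> cderivable f x.
Proof.
move=> /hasD_cvg H; apply/cvg_ex; exists D; apply: cvg_trans H.
by apply: near_eq_cvg; near=> h; rewrite /= -[h *: 1]/(h * 1) mulr1.
Unshelve. all: by end_near. Qed.

Lemma hasD_cderive f x D : hasD f x D -> cderive f x = D.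
Proof. by move=> /hasD_cvg; exact: (cvg_lim (@norm_hausdorff C C^o)). Qed.

Lemma hasD_uniq f x D E : hasD f x D -> hasD f x E -> D = E.
Proof. by move=> /hasD_cderive <- /hasD_cderive <-. Qed.

Lemma hasD_sum (I : Type) (r : seq I) (F : I -> C -> C) (D : I -> C) x :
  (forall i, hasD (F i) x (D i)) ->
  hasD (fun y => \sum_(i <- r) F i y) x (\sum_(i <- r) D i).
Proof.
move=> H; elim: r => [|i r IH].
  rewrite big_nil; apply: eq_hasD (hasD_cst 0 x) => y; by rewrite big_nil.
rewrite big_cons; apply: eq_hasD (hasD_add (H i) IH) => y; by rewrite big_cons.
Qed.

(** Identities valid where certain functions do not vanish hold in a neighbourhood
    of each such point, hence can be differentiated there. *)
Lemma hasD_neq0 f x D : hasD f x D -> f x != 0 ->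
  exists2 d : R, 0 < d & forall h, nrm h < d -> f (x + h) != 0.
Proof.
move=> /hasD_cts fc f0; have [|d d0 Hd] := fc (nrm (f x)); first by rewrite nrm_gt0.
exists d => // h /Hd; rewrite addr0; apply: contraTneq => ->.
by rewrite sub0r nrmN ltxx.
Qed.

End ComplexDerivative.

(** * The exponential function *)

Section Exponential.
Variable R : realType.
Local Notation C := R[i].
Local Notation Re := complex.Re.
Local Notation Im := complex.Im.
Local Open Scope complex_scope.
Implicit Types x y : C.

Lemma cexpD x y : cexp (x + y) = cexp x * cexp y.
Proof.
case: x y => a b [c d]; rewrite /cexp /= expRD sinD cosD; apply/eqP.
by rewrite eq_complex /=; apply/andP; split; apply/eqP; ring.
Qed.

Lemma cexp0 : cexp 0 = 1 :> C.
Proof. by rewrite /cexp /= expR0 sin0 cos0 mulr0 mulr1. Qed.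

Lemma nrm_cexp x : nrm (cexp x) = expR (Re x).
Proof.
rewrite nrmE /= !exprMn -mulrDr cos2Dsin2 mulr1 sqrtr_sqr ger0_norm //.
Qed.

Lemma cexp_neq0 x : cexp x != 0.
Proof. by rewrite -nrm_eq0 nrm_cexp gt_eqF // expR_gt0. Qed.

Lemma MVT_abs (f df : R -> R) (B b : R) : 
  (forall y : R, is_derive y 1 f (df y)) -> (forall y : R, `|y| <= `|b| -> `|df y| <= B) ->
  `|f b - f 0| <= B * `|b|.
Proof.
move=> Hf HB.
have fc (y : R) : {for y, continuous f}%classic.
  by apply: differentiable_continuous; apply/derivable1_diffP; case: (Hf y).
have [b0|b0] := leP 0 b.
  have [|c] := @MVT_segment R f df 0 b b0 (fun (y : R) _ => Hf y).
    exact: continuous_subspaceT.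
  rewrite in_itv /= => /andP[c0 cb] ->.
  by rewrite subr0 normrM ler_wpM2r // HB // !ger0_norm.
have [|c] := @MVT_segment R f df b 0 (ltW b0) (fun (y : R) _ => Hf y).
  exact: continuous_subspaceT.
rewrite in_itv /= => /andP[c0 cb] E.
rewrite distrC E sub0r normrM normrN ler_wpM2r // HB //.
by rewrite !ler0_norm ?lerN2 // ltW.
Qed.

Lemma abs_sin (b : R) : `|sin b| <= `|b|.
Proof.
have := @MVT_abs sin cos 1 b _ _; rewrite sin0 subr0 mul1r; apply.
by move=> y _; exact: cos_max.
Qed.

Lemma abs_cos1 (b : R) : `|cos b - 1| <= b ^+ 2.
Proof.
have := @MVT_abs cos (fun (y : R) => - sin y) `|b| b _ _.
rewrite cos0 -normrM -expr2 [`|b ^+ 2|]ger0_norm ?sqr_ge0 //; apply.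
by move=> y yb; rewrite normrN (le_trans (abs_sin _)).
Qed.

Lemma abs_sinB (b : R) : `|sin b - b| <= b ^+ 2 * `|b|.
Proof.
have := @MVT_abs (fun (y : R) => sin y - y) (fun (y : R) => cos y - 1) (b ^+ 2) b _ _.
rewrite sin0 !subr0; apply.
move=> y yb; rewrite (le_trans (abs_cos1 _)) // -(real_normK (num_real y)) -(real_normK (num_real b)).
by rewrite ler_sqr ?nnegrE.
Qed.

Lemma abs_expR1 (a : R) : `|a| <= 1 / 2 -> `|expR a - 1 - a| <= 2 * a ^+ 2.
Proof.
move=> ha; have := expR_ge1Dx a; have := expR_ge1Dx (- a).
rewrite expRN => h1 h2; have e0 := expR_gt0 a.
have {h1}: expR a * (1 - a) <= 1 by rewrite mulrC -ler_pdivlMr // div1r.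
move: ha; rewrite ler_norml => /andP[a1 a2] h1.
rewrite ger0_norm; last by lra.
have : (expR a - (1 + a + 2 * a ^+ 2)) * (1 - a) <= 0 by nra.
by rewrite pmulr_lle0; lra.
Qed.

(** Taylor estimates of order 2 for exp, cos and sin on the reals, combined. *)
Lemma cexp_quad x : nrm x <= 1 / 2 -> nrm (cexp x - 1 - x) <= 9 * nrm x ^+ 2.
Proof.
move=> hx; apply: le_trans (nrm_le_ReIm _) _.
have := le_trans (Re_le_nrm x) hx; have := le_trans (Im_le_nrm x) hx.
have -> : nrm x ^+ 2 = Re x ^+ 2 + Im x ^+ 2.
  by rewrite nrmE sqr_sqrtr // addr_ge0 ?sqr_ge0.
case: x {hx} => a b /= hb ha; rewrite subr0.
have h1 := abs_expR1 ha; have h2 := abs_cos1 b; have h3 := abs_sinB b; have h4 := abs_sin b.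
have h5 := cos_max b.
have -> : expR a * cos b - 1 - a = (expR a - 1 - a) * cos b + (1 + a) * (cos b - 1) by ring.
have -> : expR a * sin b - b = (expR a - 1 - a) * sin b + a * sin b + (sin b - b) by ring.
have a2 : a ^+ 2 = `|a| ^+ 2 by rewrite real_normK // num_real.
have b2 : b ^+ 2 = `|b| ^+ 2 by rewrite real_normK // num_real.
have H1 : `|(expR a - 1 - a) * cos b| <= 2 * a ^+ 2 * 1 by rewrite normrM ler_pM.
have H2 : `|(1 + a) * (cos b - 1)| <= 2 * b ^+ 2.
  rewrite normrM ler_pM // (le_trans (ler_normD _ _)) // normr1; lra.
have H3 : `|(expR a - 1 - a) * sin b| <= 2 * a ^+ 2 * `|b| by rewrite normrM ler_pM.
have H4 : `|a * sin b| <= `|a| * `|b| by rewrite normrM ler_pM.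
have := ler_normD ((expR a - 1 - a) * cos b) ((1 + a) * (cos b - 1)).
have := ler_normD ((expR a - 1 - a) * sin b + a * sin b) (sin b - b).
have := ler_normD ((expR a - 1 - a) * sin b) (a * sin b).
move: H1 H2 H3 H4 h3; rewrite a2 b2 => H1 H2 H3 H4 h3 T1 T2 T3.
have := normr_ge0 a; have := normr_ge0 b.
move: T1 T2 T3 H1 H2 H3 H4 h3 ha hb.
move: `|a| `|b| => A B; do 8!move: (`| _ |).
move=> ? ? ? ? ? ? ? ? T1 T2 T3 H1 H2 H3 H4 h3 ha hb B0 A0.
have := sqr_ge0 (A - B); have : A ^+ 2 * B <= A ^+ 2 by nra.
have : B ^+ 2 * B <= B ^+ 2 by nra.
nra.
Qed.

Lemma hasD_cexp x : hasD (@cexp R) x (cexp x).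
Proof.
apply: (@hasD_quad _ _ _ _ (1 / 2) (nrm (cexp x) * 9)) => // h hh.
have -> : cexp (x + h) - cexp x - cexp x * h = cexp x * (cexp h - 1 - h).
  by rewrite cexpD; ring.
by rewrite nrmM -mulrA ler_wpM2l ?nrm_ge0 // cexp_quad // ltW.
Qed.

Lemma epiD x y : epi (x + y) = epi x * epi y.
Proof. by rewrite /epi mulrDr cexpD. Qed.

Lemma epi0 : epi 0 = 1 :> C.
Proof. by rewrite /epi mulr0 cexp0. Qed.

Lemma epi_neq0 x : epi x != 0.
Proof. exact: cexp_neq0. Qed.

Lemma epiN x : epi (- x) = (epi x)^-1.
Proof.
by apply: (mulfI (epi_neq0 x)); rewrite -epiD subrr epi0 divff // epi_neq0.
Qed.

Lemma epiB x y : epi (x - y) = epi x / epi y.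
Proof. by rewrite epiD epiN. Qed.

Lemma epiX x n : epi (x *+ n) = epi x ^+ n.
Proof. by elim: n => [|n IH]; rewrite ?mulr0n ?epi0 // mulrS epiD IH exprS. Qed.

Lemma epi_real (r : R) : epi (r%:C) = Complex (cos (pi * r)) (sin (pi * r)) :> C.
Proof.
rewrite /epi /cexp /ipi /= !(mul0r, mulr0, subrr, oppr0, expR0, mul1r, add0r, addr0).
by [].
Qed.

Lemma epi1 : epi 1 = - 1 :> C.
Proof. by rewrite (epi_real 1) mulr1 cospi sinpi; apply/eqP; rewrite eq_complex /= oppr0 !eqxx. Qed.

Lemma epi2 : epi 2 = 1 :> C.
Proof. by rewrite -[2]/(1 + 1) epiD epi1 mulN1r opprK. Qed.

Lemma epi2_int (m : int) : epi (2 * m%:~R) = 1 :> C.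
Proof.
case: m => n; first by rewrite -pmulrn mulr_natr epiX epi2 expr1n.
by rewrite NegzE mulrNz mulrN epiN -pmulrn mulr_natr epiX epi2 expr1n invr1.
Qed.

Lemma nrm_epi x : nrm (epi x) = expR (- (pi * Im x)).
Proof. by rewrite /epi nrm_cexp; case: x => a b /=; rewrite mul0r sub0r. Qed.

Lemma nrm_epi_real (r : R) : nrm (epi (r%:C)) = 1.
Proof. by rewrite nrm_epi /= mulr0 oppr0 expR0. Qed.

Lemma hasD_epi x : hasD (@epi R) x (ipi R * epi x).
Proof.
have := hasD_comp (hasD_scale (ipi R) (hasD_id x)) (hasD_cexp (ipi R * x)).
by rewrite mulr1 mulrC.
Qed.

Lemma ipi_neq0 : ipi R != 0.
Proof. by rewrite eq_complex /= eqxx gt_eqF // pi_gt0. Qed.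

(** A nontrivial M-th root of unity in the parametrization by logarithms. *)
Lemma epi_frac_neq1 (j M : nat) : (0 < j < M)%N -> epi (2 * j%:R / M%:R) != 1 :> C.
Proof.
move=> /andP[j0 jM]; have M0 : (0 < M)%N by apply: leq_trans jM.
have E : j%:R / M%:R = (j%:R / M%:R : R)%:C :> C.
  by rewrite rmorphM fmorphV !rmorph_nat.
rewrite -mulrA E mulr_natl epiX -[X in _ != X](expr1n C 2) eqf_sqr negb_or !epi_real.
have s0 : 0 < sin (pi * (j%:R / M%:R)) :> R.
  apply: sin_gt0_pi; rewrite mulr_gt0 ?pi_gt0 ?divr_gt0 ?ltr0n //=.
  by rewrite gtr_pMr ?pi_gt0 // ltr_pdivrMr ?ltr0n // mul1r ltr_nat.
by apply/andP; split; rewrite eq_complex /= ?oppr0 [_ == 0]gt_eqF ?andbF.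
Qed.

End Exponential.

(** * Differentiable functions *)

Section Differentiability.
Variable R : realType.
Local Notation C := R[i].
Implicit Types f g : C -> C.

Definition dif f x := exists D, hasD f x D.

Lemma eq_dif f g x : f =1 g -> dif f x -> dif g x.
Proof. by move=> E [D H]; exists D; apply: eq_hasD H. Qed.

Lemma dif_cst c x : dif (fun=> c) x.
Proof. by exists 0; exact: hasD_cst. Qed.

Lemma dif_id x : dif id x.
Proof. by exists 1; exact: hasD_id. Qed.

Lemma dif_add f g x : dif f x -> dif g x -> dif (fun y => f y + g y) x.
Proof. by move=> [D H] [E K]; exists (D + E); exact: hasD_add. Qed.

Lemma dif_mul f g x : dif f x -> dif g x -> dif (fun y => f y * g y) x.
Proof. by move=> [D H] [E K]; eexists; exact: hasD_mul H K. Qed.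

Lemma dif_inv f x : f x != 0 -> dif f x -> dif (fun y => (f y)^-1) x.
Proof. by move=> f0 [D H]; eexists; exact: (@hasD_inv R f x _ f0 H). Qed.

Lemma dif_comp f g x : dif f x -> dif g (f x) -> dif (fun y => g (f y)) x.
Proof. by move=> [D H] [E K]; eexists; exact: hasD_comp H K. Qed.

Lemma dif_aff a b x : dif (fun y => a + b * y) x.
Proof. by apply: dif_add (dif_cst a x) _; apply: dif_mul; [exact: dif_cst|exact: dif_id]. Qed.

Lemma dif_epi x : dif (@epi R) x.
Proof. by eexists; exact: hasD_epi. Qed.

Lemma dif_comp_aff f a b x : (forall y, dif f y) -> dif (fun y => f (a + b * y)) x.
Proof. by move=> Hf; apply: dif_comp (Hf _); exact: dif_aff. Qed.

Lemma dif_sum (I : Type) (r : seq I) (F : I -> C -> C) x :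
  (forall i, dif (F i) x) -> dif (fun y => \sum_(i <- r) F i y) x.
Proof.
move=> H; elim: r => [|i r IH].
  by apply: eq_dif (dif_cst 0 x) => y; rewrite big_nil.
by apply: eq_dif (dif_add (H i) IH) => y; rewrite big_cons.
Qed.

Lemma dif_hasD (f : C -> C) x : dif f x -> hasD f x (cderive f x).
Proof. by move=> [D H]; rewrite (hasD_cderive H). Qed.

Lemma near_neq0 (f : C -> C) x : dif f x -> f x != 0 ->
  exists2 d : R, 0 < d & forall h, nrm h < d -> f (x + h) != 0.
Proof. by move=> [D H]; exact: hasD_neq0 H. Qed.

End Differentiability.

(** * Analytic functions on the punctured plane *)

Section LaurentClass.
Variable R : realType.
Local Notation C := R[i].
Local Open Scope complex_scope.
Implicit Types (F G : C -> C) (p q : {poly C}) (a b : int -> C) (s rho e B : R).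

Lemma geo_half_le n : \sum_(i < n) (1 / 2 : R) ^+ i <= 2.
Proof.
have -> : \sum_(i < n) (1 / 2 : R) ^+ i = 2 - 2 * (1 / 2) ^+ n.
  by elim: n => [|n IH]; rewrite ?big_ord0 ?expr0 ?big_ord_recr /= ?IH ?exprS; field.
by rewrite gerBl mulr_ge0 // exprn_ge0 // divr_ge0.
Qed.

Lemma half_small (e : R) n0 : 0 < e -> exists2 n, (n0 <= n)%N & (1 / 2 : R) ^+ n <= e.
Proof.
move=> e0; have h1 : `|1 / 2 : R| < 1 by rewrite ger0_norm; lra.
have /cvgrPdist_lt /(_ e e0) [n _ Hn] := cvg_expr h1.
exists (maxn n n0); first exact: leq_maxr.
have := Hn (maxn n n0) (leq_maxl _ _).
by rewrite /= sub0r normrN ger0_norm ?exprn_ge0 ?divr_ge0 // => /ltW.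
Qed.

Lemma sum_root_eq0 (x : C) M : x ^+ M = 1 -> x != 1 -> \sum_(k < M) x ^+ k = 0.
Proof.
move=> xM x1; have /eqP := subrX1 x M.
by rewrite xM subrr eq_sym mulf_eq0 subr_eq0 (negPf x1) => /eqP.
Qed.

(** Cauchy's estimate for polynomials, the contour integral being replaced by an
    average over roots of unity. *)
Lemma cauchy_estimate q s B : 0 < s -> (forall z, nrm z = s -> nrm q.[z] <= B) ->
  forall j, nrm q`_j * s ^+ j <= B.
Proof.
move=> s0 H j; pose M := (size q + j).+1; pose w : C := epi (2 * 1%:R / M%:R).
have wX k : w ^+ k = epi (2 * k%:R / M%:R).
  by rewrite -epiX; congr epi; rewrite -mulr_natr; ring.
have M0 : M%:R != 0 :> C by rewrite pnatr_eq0.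
have wM : w ^+ M = 1 by rewrite wX mulfK // epi2.
have w1 k : (0 < k < M)%N -> w ^+ k != 1 by rewrite wX; exact: epi_frac_neq1.
have nw k : nrm (w ^+ k) = 1.
  apply/eqP; rewrite -(@pexpr_eq1 _ _ M) ?nrm_ge0 //.
  by rewrite -nrmX -exprM mulnC exprM wM expr1n nrm1.
(* Averaging q(s w^k) w^(- j k) over k isolates the j-th coefficient, as M exceeds
   j and the degree of q. *)
have key : \sum_(k < M) q.[s%:C * w ^+ k] * w ^+ (k * (M - j)) = M%:R * (q`_j * s%:C ^+ j).
  have qM : (size q <= M)%N by rewrite /M ltnW // ltnS leq_addr.
  under eq_bigr => k _ do rewrite (horner_coef_wide _ qM) mulr_suml.
  rewrite exchange_big /=.
  have jM : (j < M)%N by rewrite /M ltnS leq_addl.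
  have T i : \sum_(k < M) q`_i * (s%:C * w ^+ k) ^+ i * w ^+ (k * (M - j)) =
      q`_i * s%:C ^+ i * \sum_(k < M) (w ^+ (i + (M - j))) ^+ k.
    rewrite mulr_sumr; apply: eq_bigr => k _.
    by rewrite exprMn -!exprM mulnDl [(i * k)%N]mulnC [((M - j) * k)%N]mulnC exprD; ring.
  under eq_bigr => i _ do rewrite T.
  rewrite (bigD1 (Ordinal jM)) //= [X in _ + X]big1 ?addr0 => [|i ij].
    rewrite subnKC ?(ltnW jM) // wM (eq_bigr (fun=> 1)) => [|k _]; last by rewrite expr1n.
    by rewrite sumr_const card_ord mulrC.
  have ij' : (i : nat) != j by apply: contra ij => /eqP ij; apply/eqP/val_inj.
  rewrite sum_root_eq0 ?mulr0 //.
    by rewrite -exprM mulnC exprM wM expr1n.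
  case: (ltngtP i j) ij' => // ltij _; first by apply: w1; lia.
  have -> : (i + (M - j) = M + (i - j))%N by lia.
  by rewrite exprD wM mul1r w1 // subn_gt0 ltij /= (leq_ltn_trans (leq_subr _ _)).
have : nrm (M%:R * (q`_j * s%:C ^+ j)) <= M%:R * B.
  rewrite -key (le_trans (nrm_sum _ _ _)) //.
  rewrite (le_trans (ler_sum _ (G := fun=> B) _)) ?sumr_const ?card_ord ?mulr_natl //.
  move=> k _; rewrite nrmM nw mulr1 H // nrmM nw mulr1 nrm_real ger0_norm ?ltW //.
by rewrite nrmM nrm_nat ler_pM2l ?ltr0n // nrmM nrmX nrm_real (ger0_norm (ltW s0)).
Qed.

(** Laurent polynomials p(z) / z^n and their coefficients. *)
Definition lp n p (z : C) := p.[z] / z ^+ n.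
Definition lcoef n p (k : int) : C :=
  if k + n%:Z is Posz i then p`_i else 0.

Lemma lcoef_mulX n m p k : lcoef (n + m) (p * 'X^m) k = lcoef n p k.
Proof.
rewrite /lcoef PoszD addrA; case: (k + n%:Z) => i.
  by rewrite -PoszD coefMXn ltnNge leq_addl /= addnK.
case E : (_ + m%:Z) => [j|//]; rewrite coefMXn; case: ltnP => // mj.
by move: E; rewrite NegzE => E; exfalso; lia.
Qed.

Lemma lcoefB n p q k : lcoef n (p - q) k = lcoef n p k - lcoef n q k.
Proof. by rewrite /lcoef; case: (k + _) => i; rewrite ?coefB ?subr0. Qed.

Lemma lcoefZ n c p k : lcoef n (c *: p) k = c * lcoef n p k.
Proof. by rewrite /lcoef; case: (k + _) => i; rewrite ?coefZ ?mulr0. Qed.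

Lemma lp_mulX n m p z : z != 0 -> lp (n + m) (p * 'X^m) z = lp n p z.
Proof.
by move=> z0; rewrite /lp hornerM hornerXn exprD; field; rewrite !expf_neq0.
Qed.

Lemma lpB n p q z : lp n (p - q) z = lp n p z - lp n q z.
Proof. by rewrite /lp hornerD hornerN mulrBl. Qed.

Lemma lp_estimate n p s B : 0 < s -> (forall z, nrm z = s -> nrm (lp n p z) <= B) ->
  forall k, nrm (lcoef n p k) * s ^ k <= B.
Proof.
move=> s0 H k.
have B0 : 0 <= B.
  by apply: le_trans (H s%:C _); rewrite ?nrm_ge0 // nrm_real ger0_norm // ltW.
rewrite /lcoef; case E: (k + n%:Z) => [i|i]; last by rewrite nrm0 mul0r.
have -> : s ^ k = s ^+ i / s ^+ n.
  have -> : k = i%:Z - n%:Z by rewrite -E addrK.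
  by rewrite expfzDr ?gt_eqF // exprnN.
rewrite mulrA ler_pdivrMr ?exprn_gt0 //; apply: cauchy_estimate => // z zs.
have := H z zs; rewrite /lp nrmM nrmV nrmX zs ler_pdivrMr ?exprn_gt0 //.
Qed.

(** Functions on the punctured plane that are, on every annulus, uniform limits
    of Laurent polynomials: the analytic functions on it. *)
Definition laurent F := forall rho e, 1 <= rho -> 0 < e -> exists n p,
  forall z, rho^-1 <= nrm z <= rho -> nrm (F z - lp n p z) <= e.

(** [a] is the sequence of Laurent coefficients of [F]: a Laurent polynomial that
    is close to [F] on a circle has coefficients close to those of [F]. *)
Definition coefs F a := forall s e n p k, 0 < s ->
  (forall z, nrm z = s -> nrm (F z - lp n p z) <= e) ->
  nrm (a k - lcoef n p k) * s ^ k <= e.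

Lemma lp_sub n p m q z : z != 0 ->
  lp (n + m) (p * 'X^m - q * 'X^n) z = lp n p z - lp m q z.
Proof. by move=> z0; rewrite lpB lp_mulX // addnC lp_mulX. Qed.

Lemma lcoef_sub n p m q k :
  lcoef (n + m) (p * 'X^m - q * 'X^n) k = lcoef n p k - lcoef m q k.
Proof. by rewrite lcoefB lcoef_mulX addnC lcoef_mulX. Qed.

Lemma nrm_neq0 z s : 0 < s -> nrm z = s -> z != 0.
Proof. by move=> s0 zs; rewrite -nrm_gt0 zs. Qed.

Lemma lp_close F n p m q s e e' k : 0 < s ->
  (forall z, nrm z = s -> nrm (F z - lp n p z) <= e) ->
  (forall z, nrm z = s -> nrm (F z - lp m q z) <= e') ->
  nrm (lcoef n p k - lcoef m q k) * s ^ k <= e + e'.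
Proof.
move=> s0 H1 H2; rewrite -lcoef_sub; apply: lp_estimate => // z zs.
rewrite lp_sub ?(nrm_neq0 s0 zs) // (le_trans (nrm_triangle (F z) _ _)) //.
by rewrite lerD ?H2 // nrmC H1.
Qed.

Lemma laurent_coefs F : laurent F -> exists a, coefs F a.
Proof.
move=> HF.
have [P HP] : {P : nat -> nat * {poly C} & forall m z,
    (m%:R + 2)^-1 <= nrm z <= m%:R + 2 ->
    nrm (F z - lp (P m).1 (P m).2 z) <= (1 / 2) ^+ m}.
  apply: (@boolp.choice _ _ (fun m P => forall z, (m%:R + 2)^-1 <= nrm z <= m%:R + 2 ->
    nrm (F z - lp P.1 P.2 z) <= (1 / 2) ^+ m)) => m.
  have [||n [p Hp]] := HF (m%:R + 2) ((1 / 2) ^+ m).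
  - by have := ler0n R m; lra.
  - by rewrite exprn_gt0 // divr_gt0.
  - by exists (n, p).
have circ m (z : C) : nrm z = 1 -> (m%:R + 2)^-1 <= nrm z <= m%:R + 2.
  move=> ->; have m0 := ler0n R m; rewrite invf_le1; lra.
have [a Ha] : {a : int -> C & forall k m,
    nrm (lcoef (P m).1 (P m).2 k - a k) <= 4 * (1 / 2) ^+ m}.
  apply: (@boolp.choice _ _ (fun (k : int) (a : C) => forall m : nat, nrm (lcoef (P m).1 (P m).2 k - a) <= 4 * (1 / 2) ^+ m)) => k.
  have [||l [_ Hl]] := @geom_lim R (fun m => lcoef (P m).1 (P m).2 k) 2 (1 / 2).
  - by lra.
  - move=> m; have := @lp_close F (P m.+1).1 (P m.+1).2 (P m).1 (P m).2 1 _ _ k ltr01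
      (fun z zs => HP _ z (circ _ z zs)) (fun z zs => HP _ z (circ _ z zs)).
    rewrite exp1rz mulr1 => /le_trans -> //; rewrite exprS.
    by have := exprn_ge0 m (_ : 0 <= 1 / 2 :> R); lra.
  - exists l => m; rewrite (le_trans (Hl m)) //.
    have -> : (1 - 1 / 2 : R)^-1 = 2 by field.
    by lra.
exists a => s e n p k s0 H; apply/ler_addgt0Pr => d d0.
have sk : 0 < s ^ k by rewrite exprz_gt0.
have D0 : 0 < 1 + 4 * s ^ k by lra.
have [m0 Hm0] : exists m0 : nat, s + s^-1 <= m0%:R.
  by exists (Num.trunc (s + s^-1)).+1; rewrite ltW // truncnS_gt.
have [m mm0 Hm] := half_small m0 (divr_gt0 d0 D0).
have mR : s + s^-1 <= m%:R by rewrite (le_trans Hm0) // ler_nat.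
have Hs z : nrm z = s -> (m%:R + 2)^-1 <= nrm z <= m%:R + 2.
  move=> ->; have s10 : 0 < s^-1 by rewrite invr_gt0.
  apply/andP; split; last lra.
  by rewrite -[s]invrK lef_pV2 ?posrE; lra.
have H1 := @lp_close F _ _ n p s _ _ k s0 (fun z zs => HP m z (Hs z zs)) H.
have H2 : nrm (a k - lcoef (P m).1 (P m).2 k) * s ^ k <= 4 * (1 / 2) ^+ m * s ^ k.
  by rewrite ler_pM2r // nrmC.
apply: le_trans (_ : nrm (a k - lcoef (P m).1 (P m).2 k) * s ^ k +
   nrm (lcoef (P m).1 (P m).2 k - lcoef n p k) * s ^ k <= _).
  by rewrite -mulrDl ler_pM2r // nrm_triangle.
move: Hm; rewrite ler_pdivlMr //; lra.
Qed.

(** Both sequences are close to the coefficients of one approximating Laurent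
    polynomial. *)
Lemma coefs_uniq F a b : laurent F -> coefs F a -> coefs F b -> a =1 b.
Proof.
move=> HF Ha Hb k; apply/eqP; rewrite -subr_eq0 -nrm_eq0 eq_le nrm_ge0 andbT.
apply/ler_addgt0Pr => e e0; rewrite add0r.
have [n [p Hp]] := HF 1 (e / 2) (lexx _) (divr_gt0 e0 (ltr0Sn _ 1)).
have Hc z : nrm z = 1 -> nrm (F z - lp n p z) <= e / 2.
  by move=> z1; apply: Hp; rewrite z1 invr1 lexx.
have := Ha 1 _ n p k ltr01 Hc; have := Hb 1 _ n p k ltr01 Hc.
rewrite exp1rz !mulr1 => h1 h2.
rewrite (le_trans (nrm_triangle (lcoef n p k) _ _)) // [nrm (_ - b k)]nrmC; lra.
Qed.

Lemma coefs_dil F a c : c != 0 -> coefs F a -> coefs (fun z => F (c * z)) (fun k => c ^ k * a k).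
Proof.
move=> c0 Ha s e n p k s0 H.
pose q := c ^+ n *: \poly_(i < size p) (p`_i * c ^- i).
have nc : 0 < nrm c by rewrite nrm_gt0.
have E z : z != 0 -> lp n q (c * z) = lp n p z.
  move=> z0; rewrite /lp /q hornerZ horner_poly horner_coef exprMn.
  have -> : \sum_(i < size p) p`_i * c ^- i * (c * z) ^+ i = \sum_(i < size p) p`_i * z ^+ i.
    by apply: eq_bigr => i _; rewrite exprMn; field; rewrite expf_neq0.
  by field; rewrite !expf_neq0.
have Eq : lcoef n q k = c ^ (- k) * lcoef n p k.
  rewrite lcoefZ /lcoef; case E' : (k + n%:Z) => [i|i]; last by rewrite !mulr0.
  rewrite coef_poly; case: ltnP => [_|/(nth_default 0) ->]; last by rewrite !mulr0.
  have -> : c ^ (- k) = c ^+ n * c ^- i.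
    have -> : - k = n%:Z - i%:Z by rewrite -E'; ring.
    by rewrite expfzDr // exprnN.
  by ring.
have := Ha (nrm c * s) e n q k (mulr_gt0 nc s0); rewrite Eq.
have -> : a k - c ^ (- k) * lcoef n p k = c ^ (- k) * (c ^ k * a k - lcoef n p k).
  by rewrite mulrBr mulrA -expfzDr // addNr expr0z mul1r.
rewrite nrmM exprzMl; last 2 first.
- by rewrite unitfE gt_eqF.
- by rewrite unitfE gt_eqF.
have nX : nrm (c ^ (- k)) * nrm c ^ k = 1.
  have nz (m : int) : nrm (c ^ m) = nrm c ^ m.
    by case: m => m; rewrite ?NegzE -?exprnN ?nrmV nrmX.
  by rewrite nz -expfzDr ?gt_eqF // addNr expr0z.
have -> : nrm (c ^ (- k)) * nrm (c ^ k * a k - lcoef n p k) * (nrm c ^ k * s ^ k) =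
  (nrm (c ^ (- k)) * nrm c ^ k) * (nrm (c ^ k * a k - lcoef n p k) * s ^ k) by ring.
rewrite nX mul1r; apply => z zs.
have z0 : z != 0 by rewrite -nrm_gt0 zs mulr_gt0.
have zE : z = c * (z / c) by rewrite mulrCA divff // mulr1.
have zc : z / c != 0 by rewrite mulf_neq0 ?invr_eq0.
rewrite [in lp _ _ _]zE E // [in F _]zE; apply: H.
by rewrite nrmM nrmV zs mulrAC divff ?mul1r ?gt_eqF.
Qed.

Lemma coefs_shift F a m : coefs F a -> coefs (fun z => F z / z ^+ m) (fun k => a (k + m%:Z)).
Proof.
move=> Ha s e n p k s0 H.
have := Ha s (e * s ^+ m) n (p * 'X^m) (k + m%:Z) s0.
have -> : lcoef n (p * 'X^m) (k + m%:Z) = lcoef n p k.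
  rewrite -[RHS](lcoef_mulX n m) /lcoef.
  by have -> : k + (n + m)%N%:Z = k + m%:Z + n%:Z by rewrite PoszD; ring.
rewrite expfzDr ?gt_eqF // -exprnP mulrA ler_pM2r ?exprn_gt0 //; apply => z zs.
have z0 := nrm_neq0 s0 zs.
have -> : F z - lp n (p * 'X^m) z = (F z / z ^+ m - lp n p z) * z ^+ m.
  by rewrite /lp hornerM hornerXn; field; rewrite !expf_neq0.
by rewrite nrmM nrmX zs ler_pM2r ?exprn_gt0 // H.
Qed.

Lemma laurent_cst c : laurent (fun=> c).
Proof.
move=> rho e _ e0; exists 0%N, c%:P => z _.
by rewrite /lp hornerC expr0 divr1 subrr nrm0 ltW.
Qed.

Lemma laurentD F G : laurent F -> laurent G -> laurent (fun z => F z + G z).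
Proof.
move=> HF HG rho e r1 e0; have e2 : 0 < e / 2 by rewrite divr_gt0.
have [n [p Hp]] := HF _ _ r1 e2; have [m [q Hq]] := HG _ _ r1 e2.
exists (n + m)%N, (p * 'X^m - (- q) * 'X^n) => z zr.
have z0 : z != 0.
  by case/andP: zr => h _; rewrite -nrm_gt0 (lt_le_trans _ h) // invr_gt0; lra.
rewrite lp_sub //; have -> : F z + G z - (lp n p z - lp m (- q) z) =
   (F z - lp n p z) + (G z - lp m q z) by rewrite /lp hornerN; ring.
by rewrite (le_trans (nrmD _ _)) // [e]splitr lerD ?Hp ?Hq.
Qed.

Lemma lp_bounded n p rho : 1 <= rho -> exists2 B, 0 < B & forall z, rho^-1 <= nrm z <= rho ->
  nrm (lp n p z) <= B.
Proof.
move=> r1; have r0 : 0 < rho by lra.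
exists ((\sum_(i < size p) nrm p`_i * rho ^+ i + 1) * rho ^+ n).
  rewrite mulr_gt0 ?exprn_gt0 // ltr_wpDl // sumr_ge0 // => i _.
  by rewrite mulr_ge0 ?nrm_ge0 // exprn_ge0 // ltW.
move=> z /andP[z1 z2]; have z0 : 0 < nrm z by rewrite (lt_le_trans _ z1) // invr_gt0.
rewrite /lp nrmM nrmV nrmX ler_pM ?nrm_ge0 ?invr_ge0 ?exprn_ge0 ?nrm_ge0 //.
  rewrite horner_coef (le_trans (nrm_sum _ _ _)) // ler_wpDr // ler_sum // => i _.
  by rewrite nrmM nrmX ler_wpM2l ?nrm_ge0 // lerXn2r // nnegrE ltW.
rewrite -[leRHS]invrK lef_pV2 ?posrE ?exprn_gt0 ?invr_gt0 ?exprn_gt0 //.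
by rewrite -exprVn lerXn2r // nnegrE ?ltW // invr_gt0.
Qed.

Lemma laurentM F G : laurent F -> laurent G -> laurent (fun z => F z * G z).
Proof.
move=> HF HG rho e r1 e0.
have [n1 [p1 H1]] := HF _ _ r1 ltr01; have [B B0 HB] := lp_bounded n1 p1 r1.
have d1 : 0 < e / 2 / (B + 1) by rewrite !divr_gt0 //; lra.
have [m [q Hq]] := HG _ _ r1 d1; have [B' B'0 HB'] := lp_bounded m q r1.
have d2 : 0 < e / 2 / B' by rewrite !divr_gt0 //; lra.
have [n [p Hp]] := HF _ _ r1 d2.
exists (n + m)%N, (p * q) => z zr.
have z0 : z != 0.
  by case/andP: zr => h _; rewrite -nrm_gt0 (lt_le_trans _ h) // invr_gt0; lra.
have -> : F z * G z - lp (n + m) (p * q) z =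
  F z * (G z - lp m q z) + (F z - lp n p z) * lp m q z.
  by rewrite /lp hornerM exprD; field; rewrite !expf_neq0.
rewrite (le_trans (nrmD _ _)) // [e]splitr nrmM (nrmM (F z - _)) lerD //.
  have FB : nrm (F z) <= B + 1.
    rewrite -[F z](subrK (lp n1 p1 z)) (le_trans (nrmD _ _)) // addrC lerD ?HB ?H1 //.
  have := Hq z zr; rewrite ler_pdivlMr; last lra.
  by apply: le_trans; rewrite mulrC ler_wpM2l ?nrm_ge0.
have := Hp z zr; rewrite ler_pdivlMr //.
by apply: le_trans; rewrite ler_wpM2l ?nrm_ge0 ?HB'.
Qed.

Lemma laurentZ c F : laurent F -> laurent (fun z => c * F z).
Proof. exact: laurentM (laurent_cst c). Qed.

Lemma eq_laurent F G : (forall z, z != 0 -> F z = G z) -> laurent F -> laurent G.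
Proof.
move=> FG HF rho e r1 e0; have [n [p Hp]] := HF rho e r1 e0; exists n, p => z zr.
rewrite -FG ?Hp // -nrm_gt0; case/andP: zr => h _.
by rewrite (lt_le_trans _ h) // invr_gt0; lra.
Qed.

Lemma laurent_prod (I : Type) (r : seq I) (P : pred I) (F : I -> C -> C) :
  (forall i, laurent (F i)) -> laurent (fun z => \prod_(i <- r | P i) F i z).
Proof.
move=> H; elim: r => [|i r IH].
  by apply: eq_laurent (laurent_cst 1) => z _; rewrite big_nil.
have [Pi|Pi] := boolP (P i).
  by apply: eq_laurent (laurentM (H i) IH) => z _; rewrite big_cons Pi.
by apply: eq_laurent IH => z _; rewrite big_cons (negPf Pi).
Qed.

Lemma laurent_sum (I : Type) (r : seq I) (P : pred I) (F : I -> C -> C) :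
  (forall i, laurent (F i)) -> laurent (fun z => \sum_(i <- r | P i) F i z).
Proof.
move=> H; elim: r => [|i r IH].
  by apply: eq_laurent (laurent_cst 0) => z _; rewrite big_nil.
have [Pi|Pi] := boolP (P i).
  by apply: eq_laurent (laurentD (H i) IH) => z _; rewrite big_cons Pi.
by apply: eq_laurent IH => z _; rewrite big_cons (negPf Pi).
Qed.

Lemma coefsD F G a b : laurent G -> coefs F a -> coefs G b ->
  coefs (fun z => F z + G z) (fun k => a k + b k).
Proof.
move=> HG Ha Hb s e n p k s0 H; apply/ler_addgt0Pr => d d0.
have d2 : 0 < d / 2 by rewrite divr_gt0.
have rho1 : 1 <= 1 + s + s^-1 by rewrite -addrA lerDl addr_ge0 ?invr_ge0 ?(ltW s0).
have [m [q Hq]] := HG _ _ rho1 d2.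
have Hq' z : nrm z = s -> nrm (G z - lp m q z) <= d / 2.
  move=> zs; apply: Hq; rewrite zs; have s1 : 0 < s^-1 by rewrite invr_gt0.
  apply/andP; split; last by lra.
  by rewrite -[leRHS]invrK lef_pV2 ?posrE; lra.
have h2 := Hb s _ m q k s0 Hq'.
have := Ha s (e + d / 2) (n + m)%N (p * 'X^m - q * 'X^n) k s0.
rewrite lcoef_sub => h1.
have {h1}h1 : nrm (a k - (lcoef n p k - lcoef m q k)) * s ^ k <= e + d / 2.
  apply: h1 => z zs; rewrite lp_sub ?(nrm_neq0 s0 zs) //.
  have -> : F z - (lp n p z - lp m q z) = (F z + G z - lp n p z) - (G z - lp m q z) by ring.
  by rewrite (le_trans (nrmB _ _)) // lerD ?H ?Hq'.
have -> : a k + b k - lcoef n p k = (a k - (lcoef n p k - lcoef m q k)) + (b k - lcoef m q k) by ring.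
have sk : 0 <= s ^ k by rewrite exprz_ge0 // ltW.
apply: le_trans (_ : (nrm (a k - (lcoef n p k - lcoef m q k)) + nrm (b k - lcoef m q k)) * s ^ k <= _).
  by rewrite ler_wpM2r // nrmD.
rewrite mulrDl; lra.
Qed.

Lemma coefsZ c F a : laurent F -> coefs F a -> coefs (fun z => c * F z) (fun k => c * a k).
Proof.
move=> HF Ha s e n p k s0 H; apply/ler_addgt0Pr => d d0.
have D0 : 0 < nrm c + nrm c + 1 by have := nrm_ge0 c; lra.
have dd : 0 < d / (nrm c + nrm c + 1) by rewrite divr_gt0.
have rho1 : 1 <= 1 + s + s^-1 by rewrite -addrA lerDl addr_ge0 ?invr_ge0 ?(ltW s0).
have [m [q Hq]] := HF _ _ rho1 dd.
have Hq' z : nrm z = s -> nrm (F z - lp m q z) <= d / (nrm c + nrm c + 1).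
  move=> zs; apply: Hq; rewrite zs; have s1 : 0 < s^-1 by rewrite invr_gt0.
  apply/andP; split; last by lra.
  by rewrite -[leRHS]invrK lef_pV2 ?posrE; lra.
have h2 := Ha s _ m q k s0 Hq'.
have Hq2 z : nrm z = s -> nrm (c * F z - lp m (c *: q) z) <= nrm c * (d / (nrm c + nrm c + 1)).
  move=> zs; have -> : c * F z - lp m (c *: q) z = c * (F z - lp m q z) by rewrite /lp hornerZ; ring.
  by rewrite nrmM ler_wpM2l ?nrm_ge0 ?Hq'.
have h1 := @lp_close (fun z => c * F z) _ _ _ _ s _ _ k s0 Hq2 H.
move: h1; rewrite lcoefZ => h1.
have -> : c * a k - lcoef n p k = c * (a k - lcoef m q k) + (c * lcoef m q k - lcoef n p k) by ring.
have sk : 0 <= s ^ k by rewrite exprz_ge0 // ltW.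
apply: le_trans (_ : (nrm (c * (a k - lcoef m q k)) + nrm (c * lcoef m q k - lcoef n p k)) * s ^ k <= _).
  by rewrite ler_wpM2r // nrmD.
rewrite mulrDl nrmM -mulrA.
have : nrm c * (nrm (a k - lcoef m q k) * s ^ k) <= nrm c * (d / (nrm c + nrm c + 1)).
  by rewrite ler_wpM2l ?nrm_ge0.
have : nrm c * (d / (nrm c + nrm c + 1)) + nrm c * (d / (nrm c + nrm c + 1)) <= d.
  rewrite mulrA -!mulrDl ler_pdivrMr // mulrC ler_pM2l //; lra.
lra.
Qed.

(** A Laurent polynomial whose coefficients are small in the sense of Cauchy's
    estimates on two circles is small between them. *)
Lemma lp_small n p rho B : 1 <= rho -> 0 <= B ->
  (forall k, nrm (lcoef n p k) * (2 * rho) ^ k <= B) ->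
  (forall k, nrm (lcoef n p k) * (2 * rho)^-1 ^ k <= B) ->
  forall z, rho^-1 <= nrm z <= rho -> nrm (lp n p z) <= 4 * B.
Proof.
move=> r1 B0 H1 H2 z /andP[z1 z2]; have r0 : 0 < rho by lra.
have z0 : 0 < nrm z by rewrite (lt_le_trans _ z1) // invr_gt0.
have zn0 : z != 0 by rewrite -nrm_gt0.
rewrite /lp (@horner_coef_wide _ (n + size p)) ?leq_addl // mulr_suml big_split_ord /=.
have h i : nrm (p`_(n + i) * z ^+ (n + i) / z ^+ n) <= B * (1 / 2) ^+ i.
  have -> : p`_(n + i) * z ^+ (n + i) / z ^+ n = lcoef n p i%:Z * z ^+ i.
    by rewrite /lcoef -PoszD addnC exprD; field; rewrite expf_neq0.
  have := H1 i%:Z; rewrite -exprnP nrmM nrmX exprMn.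
  have r2 : 0 < 2 ^+ i :> R by rewrite exprn_gt0.
  have -> : nrm (lcoef n p i) * (2 ^+ i * rho ^+ i) = nrm (lcoef n p i) * rho ^+ i * 2 ^+ i by ring.
  rewrite -ler_pdivlMr // => hb; apply: le_trans (le_trans _ hb) _.
    by rewrite ler_wpM2l ?nrm_ge0 // lerXn2r // nnegrE ltW.
  by rewrite expr_div_n expr1n mul1r.
have h' (i : 'I_n) : nrm (p`_i * z ^+ i / z ^+ n) <= B * (1 / 2) ^+ (n - i).
  have ni : (i < n)%N by [].
  have En : n = ((n - i) + i)%N by rewrite subnK // ltnW.
  have -> : p`_i * z ^+ i / z ^+ n = lcoef n p (i%:Z - n%:Z) * z ^- (n - i).
    have -> : z ^+ n = z ^+ (n - i) * z ^+ i by rewrite -exprD -En.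
    by rewrite /lcoef subrK; field; rewrite !expf_neq0.
  have := H2 (i%:Z - n%:Z); have -> : i%:Z - n%:Z = - (n - i)%:Z.
    by rewrite -opprB subzn // ltnW.
  rewrite exprz_inv opprK -exprnP nrmM nrmV nrmX exprMn.
  move: (n - i)%N => m.
  have r2 : 0 < 2 ^+ m :> R by rewrite exprn_gt0.
  have -> : nrm (lcoef n p (- m%:Z)) * (2 ^+ m * rho ^+ m) = nrm (lcoef n p (- m%:Z)) * rho ^+ m * 2 ^+ m by ring.
  rewrite -ler_pdivlMr // => hb; apply: le_trans (le_trans _ hb) _.
    rewrite ler_wpM2l ?nrm_ge0 // -exprVn lerXn2r // ?nnegrE ?invr_ge0 ?(ltW r0) ?(ltW z0) //.
    by rewrite -[leRHS]invrK lef_pV2 ?posrE ?invr_gt0.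
  by rewrite expr_div_n expr1n mul1r.
rewrite (le_trans (nrmD _ _)) //; have -> : 4 * B = B * 2 + B * 2 by ring.
rewrite lerD // (le_trans (nrm_sum _ _ _)) //.
  rewrite (le_trans (ler_sum _ (fun i _ => h' i))) // -mulr_sumr ler_wpM2l //.
  rewrite (reindex_inj rev_ord_inj) /=.
  apply: le_trans (geo_half_le n); apply: ler_sum => i _.
  have -> : (n - (n - i.+1) = i.+1)%N by rewrite subKn.
  rewrite exprS ler_piMl ?exprn_ge0 ?divr_ge0 //; lra.
rewrite (le_trans (ler_sum _ (fun (i : 'I__) _ => h i))) // -mulr_sumr ler_wpM2l //.
exact: geo_half_le.
Qed.

(** An approximating Laurent polynomial then has small coefficients, hence small
    values. *)
Lemma coefs0_eq0 F : laurent F -> coefs F (fun=> 0) -> forall z, z != 0 -> F z = 0.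
Proof.
move=> HF H0 z z0; apply/eqP; rewrite -nrm_eq0 eq_le nrm_ge0 andbT.
apply/ler_addgt0Pr => e e0; rewrite add0r.
have nz : 0 < nrm z by rewrite nrm_gt0.
pose rho := 1 + nrm z + (nrm z)^-1.
have nz1 : 0 < (nrm z)^-1 by rewrite invr_gt0.
have rho1 : 1 <= rho by rewrite /rho; lra.
have rho2 : 1 <= 2 * rho by lra.
have e5 : 0 < e / 5 by lra.
have [n [p Hp]] := HF _ _ rho2 e5.
have zr : rho^-1 <= nrm z <= rho.
  apply/andP; split; last by rewrite /rho; lra.
  by rewrite -[leRHS]invrK lef_pV2 ?posrE /rho; lra.
have := @lp_small n p rho (e / 5) rho1 (ltW e5) _ _ z zr.
have Hs s k : 0 < s -> (2 * rho)^-1 <= s <= 2 * rho -> nrm (lcoef n p k) * s ^ k <= e / 5.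
  move=> s0 sr; have := H0 s (e / 5) n p k s0; rewrite sub0r nrmN; apply => y ys.
  by apply: Hp; rewrite ys.
have ri : (2 * rho)^-1 <= 2 * rho by rewrite (le_trans _ rho2) // invf_le1; lra.
move=> /(_ (fun k => Hs _ k _ _) (fun k => Hs _ k _ _)) H.
have {}H : nrm (lp n p z) <= 4 * (e / 5).
  have r0 : 0 < 2 * rho by lra.
  by apply: H; rewrite ?lexx ?andbT ?ri ?invr_gt0.
have : nrm (F z - lp n p z) <= e / 5.
  apply: Hp; case/andP: zr => a1 a2; apply/andP; split; last by lra.
  by rewrite (le_trans _ a1) // lef_pV2 ?posrE; lra.
have := nrmD (F z - lp n p z) (lp n p z); rewrite subrK; lra.
Qed.

(** A functional equation F(p z) = c F(z) / z^N turns into a recursion of step N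
    for the Laurent coefficients, so that such functions form a space of
    dimension at most N. *)
Lemma coefs_rec F a (w c : C) N : w != 0 -> laurent F -> coefs F a ->
  (forall z, z != 0 -> F (w * z) = c * (F z / z ^+ N)) ->
  forall k, w ^ k * a k = c * a (k + N%:Z).
Proof.
move=> w0 HF Ha E.
have Hs : laurent (fun z => F z / z ^+ N).
  move=> rho e r1 e0; have e1 : 0 < e / rho ^+ N by rewrite divr_gt0 // exprn_gt0; lra.
  have [n [p Hp]] := HF _ _ r1 e1; exists (n + N)%N, p => z zr.
  have rz : (nrm z)^-1 <= rho.
    have r0 : 0 < rho^-1 by rewrite invr_gt0; lra.
    by case/andP: zr => zr _; rewrite -[rho]invrK lef_pV2 ?posrE ?(lt_le_trans r0 zr).
  have z0 : z != 0.
    by case/andP: zr => h _; rewrite -nrm_gt0 (lt_le_trans _ h) // invr_gt0; lra.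
  have -> : F z / z ^+ N - lp (n + N) p z = (F z - lp n p z) / z ^+ N.
    by rewrite /lp exprD; field; rewrite !expf_neq0.
  rewrite nrmM nrmV nrmX; have := Hp z zr.
  rewrite ler_pdivlMr ?exprn_gt0; last by lra.
  apply: le_trans; rewrite ler_wpM2l ?nrm_ge0 // -exprVn lerXn2r ?nnegrE ?invr_ge0 ?nrm_ge0 //.
    by lra.
  by [].
have H1 := coefs_dil w0 Ha.
have H2 := coefsZ (c := c) Hs (coefs_shift (m := N) Ha).
have HL := laurentZ c Hs.
apply: (coefs_uniq HL) => // s e n p k s0 H; apply: (H1 s e n p k s0) => z zs.
by rewrite E ?H // (nrm_neq0 s0 zs).
Qed.

Lemma rec_eq0 a (w c : C) N : w != 0 -> c != 0 -> (0 < N)%N ->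
  (forall k, w ^ k * a k = c * a (k + N%:Z)) ->
  (forall i, (i < N)%N -> a i%:Z = 0) -> forall k, a k = 0.
Proof.
move=> w0 c0 N0 E H0.
have up k : a k = 0 -> a (k + N%:Z) = 0.
  by move=> ak; have /eqP := E k; rewrite ak mulr0 eq_sym mulf_eq0 (negPf c0) => /eqP.
have dn k : a (k + N%:Z) = 0 -> a k = 0.
  move=> ak; have /eqP := E k; rewrite ak mulr0 mulf_eq0 => /orP[|/eqP//].
  by rewrite expfz_eq0 (negPf w0) andbF.
have pos m : a m%:Z = 0.
  elim/ltn_ind: m => m IH; have [/H0//|Nm] := ltnP m N.
  by rewrite -(subnK Nm) PoszD; apply: up; apply: IH; lia.
case=> m; first exact: pos.
rewrite NegzE; have : a (- m.+1%:Z + (m.+1 * N)%N%:Z) = 0.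
  have -> : - m.+1%:Z + (m.+1 * N)%N%:Z = (m.+1 * N - m.+1)%N%:Z.
    by rewrite -subzn ?leq_pmulr // addrC.
  exact: pos.
elim: m.+1 (- m.+1%:Z) => [|j IH] k; first by rewrite mul0n addr0.
rewrite mulSn PoszD addrA => /IH; exact: dn.
Qed.
End LaurentClass.

(** * Entire functions *)

Section EntireClass.
Variable R : realType.
Local Notation C := R[i].
Local Open Scope complex_scope.
Implicit Types (f g : C -> C) (p q : {poly C}) (s e B : R).

(** Functions that are uniform limits of polynomials on every disc: the entire
    functions. *)
Definition entire f := forall s e, 0 < s -> 0 < e -> exists q : {poly C},
  forall z, nrm z <= s -> nrm (f z - q.[z]) <= e.

Lemma entire_poly q : entire (fun z => q.[z]).
Proof. by move=> s e _ e0; exists q => z _; rewrite subrr nrm0 ltW. Qed.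

Lemma poly_bounded q s : 0 < s -> exists2 B, 0 < B & forall z, nrm z <= s -> nrm q.[z] <= B.
Proof.
move=> s0; exists (\sum_(i < size q) nrm q`_i * s ^+ i + 1).
  by rewrite ltr_wpDl // sumr_ge0 // => i _; rewrite mulr_ge0 ?nrm_ge0 // exprn_ge0 // ltW.
move=> z zs; rewrite horner_coef (le_trans (nrm_sum _ _ _)) // ler_wpDr // ler_sum // => i _.
by rewrite nrmM nrmX ler_wpM2l ?nrm_ge0 // lerXn2r // ?nnegrE ?nrm_ge0 // ltW.
Qed.

Lemma entire_bounded f s : entire f -> 0 < s ->
  exists2 B, 0 < B & forall z, nrm z <= s -> nrm (f z) <= B.
Proof.
move=> Hf s0; have [q Hq] := Hf s 1 s0 ltr01; have [B B0 HB] := poly_bounded q s0.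
exists (B + 1); first by lra.
move=> z zs; rewrite -[f z](subrK q.[z]) (le_trans (nrmD _ _)) // addrC lerD ?HB ?Hq //.
Qed.

Lemma eq_entire f g : f =1 g -> entire f -> entire g.
Proof.
by move=> fg Hf s e s0 e0; have [q Hq] := Hf s e s0 e0; exists q => z /Hq; rewrite fg.
Qed.

Lemma entireM f g : entire f -> entire g -> entire (fun z => f z * g z).
Proof.
move=> Hf Hg s e s0 e0; have [B B0 HB] := entire_bounded Hf s0.
have d1 : 0 < e / 2 / B by rewrite !divr_gt0.
have [q Hq] := Hg _ _ s0 d1; have [B' B'0 HB'] := poly_bounded q s0.
have d2 : 0 < e / 2 / B' by rewrite !divr_gt0.
have [p Hp] := Hf _ _ s0 d2; exists (p * q) => z zs.
have -> : f z * g z - (p * q).[z] = f z * (g z - q.[z]) + (f z - p.[z]) * q.[z].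
  by rewrite hornerM; ring.
rewrite (le_trans (nrmD _ _)) // [e]splitr !nrmM lerD //.
  have := Hq z zs; rewrite ler_pdivlMr //.
  by apply: le_trans; rewrite mulrC ler_wpM2l ?nrm_ge0 ?HB.
have := Hp z zs; rewrite ler_pdivlMr //.
by apply: le_trans; rewrite ler_wpM2l ?nrm_ge0 ?HB'.
Qed.

Lemma entire_prod (I : Type) (r : seq I) (F : I -> C -> C) :
  (forall i, entire (F i)) -> entire (fun z => \prod_(i <- r) F i z).
Proof.
move=> H; elim: r => [|i r IH].
  by apply: eq_entire (entire_poly 1%:P) => z; rewrite big_nil hornerC.
by apply: eq_entire (entireM (H i) IH) => z; rewrite big_cons.
Qed.

Lemma entire_comp f c m : entire f -> entire (fun z => f (c * z ^+ m)).
Proof.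
move=> Hf s e s0 e0; have S0 : 0 < nrm c * s ^+ m + 1.
  by rewrite ltr_wpDl // mulr_ge0 ?nrm_ge0 // exprn_ge0 // ltW.
have [q Hq] := Hf _ _ S0 e0; exists (q \Po (c *: 'X^m)) => z zs.
rewrite horner_comp hornerZ hornerXn; apply: Hq.
rewrite nrmM nrmX ler_wpDr // ler_wpM2l ?nrm_ge0 // lerXn2r // ?nnegrE ?nrm_ge0 //.
exact: ltW.
Qed.

Lemma entire_lim f : (forall s e, 0 < s -> 0 < e ->
   exists2 g, entire g & forall z, nrm z <= s -> nrm (f z - g z) <= e) -> entire f.
Proof.
move=> H s e s0 e0; have e2 : 0 < e / 2 by rewrite divr_gt0.
have [g Hg fg] := H _ _ s0 e2; have [q Hq] := Hg _ _ s0 e2; exists q => z zs.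
by rewrite (le_trans (nrm_triangle (g z) _ _)) // [e]splitr lerD ?fg ?Hq.
Qed.

Lemma entire_laurent f : entire f -> laurent f.
Proof.
move=> Hf rho e r1 e0; have [|q Hq] := Hf rho e _ e0; first by lra.
by exists 0%N, q => z /andP[_ zr]; rewrite /lp expr0 divr1 Hq.
Qed.

Lemma entire_laurentV f : entire f -> laurent (fun z => f z^-1).
Proof.
move=> Hf rho e r1 e0; have [|q Hq] := Hf rho e _ e0; first by lra.
exists (size q), (\poly_(i < (size q).+1) q`_(size q - i)) => z /andP[zr _].
have zp : 0 < nrm z by rewrite (lt_le_trans _ zr) // invr_gt0; lra.
have z0 : z != 0 by rewrite -nrm_gt0.
have -> : lp (size q) (\poly_(i < (size q).+1) q`_(size q - i)) z = q.[z^-1].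
  rewrite /lp horner_poly (@horner_coef_wide _ (size q).+1) // (reindex_inj rev_ord_inj) /= mulr_suml.
  apply: eq_bigr => i _; have iq : (i <= size q)%N by case: i => i /=; rewrite ltnS.
  rewrite subSS subKn // exprVn -mulrA; congr (_ * _).
  have -> : z ^+ size q = z ^+ (size q - i) * z ^+ i by rewrite -exprD subnK.
  by field; rewrite !expf_neq0.
apply: Hq; rewrite nrmV -[leRHS]invrK lef_pV2 ?posrE // invr_gt0; lra.
Qed.

(** The derivative of a polynomial, as a linear form in its coefficients. *)
Let dpoly n q (z : C) := \sum_(j < n) q`_j * (j%:R * z ^+ j.-1).

Let pow_quad (z h : C) (r : R) j : 1 <= r -> nrm z <= r -> nrm (z + h) <= r ->
  nrm ((z + h) ^+ j - z ^+ j - j%:R * z ^+ j.-1 * h) <= j%:R ^+ 2 * r ^+ j * nrm h ^+ 2.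
Proof.
move=> r1 zr zhr; elim: j => [|j IH].
  by rewrite !expr0 subrr mul0r mul0r subrr nrm0 expr0n !mul0r.
have -> : (z + h) ^+ j.+1 - z ^+ j.+1 - j.+1%:R * z ^+ j.+1.-1 * h =
  (z + h) * ((z + h) ^+ j - z ^+ j - j%:R * z ^+ j.-1 * h) + j%:R * z ^+ j.-1 * h ^+ 2.
  case: j {IH} => [|j]; first by rewrite !expr0 !expr1 mulr1; ring.
  by rewrite /= !exprS -[j.+2%:R]natr1; ring.
rewrite (le_trans (nrmD _ _)) // !nrmM !nrmX nrm_nat -?expr2.
apply: le_trans (_ : r * (j%:R ^+ 2 * r ^+ j * nrm h ^+ 2) + j%:R * r ^+ j.+1 * nrm h ^+ 2 <= _).
  rewrite lerD //.
    by rewrite ler_pM ?nrm_ge0.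
  rewrite ler_wpM2r ?exprn_ge0 ?nrm_ge0 // ler_wpM2l ?ler0n //.
  apply: le_trans (_ : r ^+ j.-1 <= _).
    by rewrite lerXn2r // ?nnegrE ?nrm_ge0 //; lra.
  by rewrite ler_weXn2l //; lia.
have -> : r * (j%:R ^+ 2 * r ^+ j * nrm h ^+ 2) + j%:R * r ^+ j.+1 * nrm h ^+ 2 =
  (j%:R ^+ 2 + j%:R) * r ^+ j.+1 * nrm h ^+ 2 by rewrite (exprS r); ring.
rewrite ler_wpM2r ?exprn_ge0 ?nrm_ge0 // ler_wpM2r ?exprn_ge0 //; first by lra.
by rewrite -[j.+1%:R]natr1; have := ler0n R j; nra.
Qed.

Let sq_le_pow (j : nat) : j%:R ^+ 2 <= 2 * 2 ^+ j :> R.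
Proof.
rewrite -natrX -natrX -natrM ler_nat; elim/ltn_ind: j => -[|[|[|[|j]]]] // IH.
have := IH j.+3 (ltnSn _); rewrite !expnS; move: (2 ^ j)%N => x; nia.
Qed.

Let coef_term q s B j : 0 < s -> (forall z, nrm z <= s -> nrm q.[z] <= B) ->
  nrm q`_j <= B / s ^+ j.
Proof.
move=> s0 H; rewrite ler_pdivlMr ?exprn_gt0 //; apply: cauchy_estimate => // z zs.
by apply: H; rewrite zs.
Qed.

(** Cauchy's estimates bound the second-order remainder of a polynomial by its
    maximum on a larger disc only, so that the bound passes to uniform limits. *)
Let poly_quad q (r B : R) (z h : C) : 1 <= r -> (forall z, nrm z <= 4 * r -> nrm q.[z] <= B) ->
  nrm z <= r -> nrm (z + h) <= r ->
  nrm (q.[z + h] - q.[z] - dpoly (size q) q z * h) <= 4 * B * nrm h ^+ 2.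
Proof.
move=> r1 HB zr zhr; have r0 : 0 < r by lra.
have B0 : 0 <= B by apply: le_trans (HB z _); [exact: nrm_ge0|lra].
have -> : q.[z + h] - q.[z] - dpoly (size q) q z * h =
  \sum_(j < size q) q`_j * ((z + h) ^+ j - z ^+ j - j%:R * z ^+ j.-1 * h).
  rewrite !horner_coef /dpoly mulr_suml -!sumrB; apply: eq_bigr => j _; ring.
rewrite (le_trans (nrm_sum _ _ _)) //.
apply: le_trans (_ : \sum_(j < size q) (2 * B * nrm h ^+ 2) * (1 / 2) ^+ j <= _).
  apply: ler_sum => j _; rewrite nrmM.
  apply: le_trans (_ : B / (4 * r) ^+ j * (2 * 2 ^+ j * r ^+ j * nrm h ^+ 2) <= _).
    rewrite ler_pM ?nrm_ge0 //; first by apply: coef_term => //; lra.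
    rewrite (le_trans (pow_quad j r1 zr zhr)) // ler_wpM2r ?exprn_ge0 ?nrm_ge0 //.
    by rewrite ler_wpM2r ?exprn_ge0 // ltW.
  have -> : B / (4 * r) ^+ j * (2 * 2 ^+ j * r ^+ j * nrm h ^+ 2) = 2 * B * nrm h ^+ 2 * (1 / 2) ^+ j.
    have -> : 4 * r = 2 * (2 * r) by ring.
    by rewrite !exprMn exprVn expr1n; field; rewrite !expf_neq0 //= gt_eqF.
  by [].
rewrite -mulr_sumr; have := geo_half_le R (size q).
have : 0 <= 2 * B * nrm h ^+ 2 by rewrite !mulr_ge0 ?exprn_ge0 ?nrm_ge0.
by nra.
Qed.

Let dpoly_bound q (r B : R) (z : C) n : 1 <= r -> (forall z, nrm z <= 4 * r -> nrm q.[z] <= B) ->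
  nrm z <= r -> nrm (dpoly n q z) <= 4 * B.
Proof.
move=> r1 HB zr; have r0 : 0 < r by lra.
have B0 : 0 <= B by apply: le_trans (HB z _); [exact: nrm_ge0|lra].
rewrite /dpoly (le_trans (nrm_sum _ _ _)) //.
apply: le_trans (_ : \sum_(j < n) (2 * B) * (1 / 2) ^+ j <= _); last first.
  by rewrite -mulr_sumr; have := geo_half_le R n; nra.
apply: ler_sum => j _; rewrite !nrmM nrm_nat nrmX.
apply: le_trans (_ : B / (4 * r) ^+ j * (2 * 2 ^+ j * r ^+ j) <= _).
  rewrite ler_pM ?mulr_ge0 ?exprn_ge0 ?nrm_ge0 //; first by apply: coef_term => //; lra.
  rewrite ler_pM ?exprn_ge0 ?nrm_ge0 //.
    apply: le_trans (sq_le_pow j); case: (j : nat) => [|m]; first by rewrite expr0n.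
    by rewrite expr2 ler_peMr ?ler0n // ler1n.
  apply: le_trans (_ : r ^+ j.-1 <= _).
    by rewrite lerXn2r // ?nnegrE ?nrm_ge0 // ltW.
  by rewrite ler_weXn2l //; lia.
have -> : 4 * r = 2 * (2 * r) by ring.
rewrite le_eqVlt; apply/orP; left; apply/eqP.
by rewrite !exprMn exprVn expr1n; field; rewrite !expf_neq0 //= gt_eqF.
Qed.

Let dpoly_wide q n z : (size q <= n)%N -> dpoly n q z = dpoly (size q) q z.
Proof.
move=> le; rewrite /dpoly -(subnKC le) big_split_ord /= [X in _ + X]big1 ?addr0 //.
by move=> i _; rewrite nth_default ?mul0r // leq_addr.
Qed.

(** The derivatives of the approximating polynomials converge geometrically, by
    Cauchy's estimates, and their second-order remainders are uniformly bounded. *)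
Lemma entire_hasD f z : entire f -> exists D, hasD f z D.
Proof.
move=> Hf; pose r := nrm z + 1; have r1 : 1 <= r by rewrite lerDr nrm_ge0.
have s0 : 0 < 4 * r by lra.
have [B B0 HB] := entire_bounded Hf s0.
have [P HP] : {P : nat -> {poly C} & forall m y, nrm y <= 4 * r ->
    nrm (f y - (P m).[y]) <= (1 / 2) ^+ m}.
  apply: (@boolp.choice _ _ (fun m P => forall y, nrm y <= 4 * r ->
    nrm (f y - P.[y]) <= (1 / 2) ^+ m)) => m.
  by apply: Hf => //; rewrite exprn_gt0 // divr_gt0.
have hm1 m : (1 / 2 : R) ^+ m <= 1 by rewrite exprn_ile1 //; lra.
have PB m y : nrm y <= 4 * r -> nrm (P m).[y] <= B + 1.
  move=> yr; have -> : (P m).[y] = f y - (f y - (P m).[y]) by ring.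
  by rewrite (le_trans (nrmB _ _)) // lerD ?HB // (le_trans (HP m y yr)).
have zr : nrm z <= r by rewrite lerDl.
have [||D [_ HD]] := @geom_lim R (fun m => dpoly (size (P m)) (P m) z) 8 (1 / 2); first by lra.
  move=> m; have PP y : nrm y <= 4 * r -> nrm (P m.+1 - P m).[y] <= 2 * (1 / 2) ^+ m.
    move=> yr; rewrite hornerD hornerN (le_trans (nrm_triangle (f y) _ _)) //.
    rewrite nrmC; have := HP m y yr; have := HP m.+1 y yr; rewrite exprS.
    by have := exprn_ge0 m (_ : 0 <= 1 / 2 :> R); lra.
  pose n := maxn (size (P m.+1)) (size (P m)).
  rewrite -(@dpoly_wide (P m.+1) n) ?leq_maxl // -(@dpoly_wide (P m) n) ?leq_maxr //.
  have -> : dpoly n (P m.+1) z - dpoly n (P m) z = dpoly n (P m.+1 - P m) z.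
    by rewrite /dpoly -sumrB; apply: eq_bigr => i _; rewrite coefB mulrBl.
  by rewrite (le_trans (dpoly_bound n r1 PP zr)) //; lra.
exists D; apply: (@hasD_quad _ _ _ _ 1 (4 * (B + 1))) => // h h1.
have zhr : nrm (z + h) <= r by rewrite (le_trans (nrmD _ _)) // lerD // ltW.
apply/ler_addgt0Pr => e e0.
have [m _ Hm] := @half_small R (e / 20) 0 (divr_gt0 e0 (ltr0Sn _ _)).
have Q := poly_quad r1 (PB m) zr zhr.
have E1 := HP m (z + h) (le_trans zhr (_ : r <= 4 * r)).
have E2 := HP m z (le_trans zr (_ : r <= 4 * r)).
have {}E1 : nrm (f (z + h) - (P m).[z + h]) <= (1 / 2) ^+ m by apply: E1; lra.
have {}E2 : nrm (f z - (P m).[z]) <= (1 / 2) ^+ m by apply: E2; lra.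
have E3 : nrm ((dpoly (size (P m)) (P m) z - D) * h) <= 16 * (1 / 2) ^+ m.
  rewrite nrmM (le_trans (ler_pM (nrm_ge0 _) (nrm_ge0 _) (HD m) (ltW h1))) //.
  have -> : (1 - 1 / 2 : R)^-1 = 2 by field.
  by lra.
have -> : f (z + h) - f z - D * h = (f (z + h) - (P m).[z + h]) - (f z - (P m).[z])
  + ((P m).[z + h] - (P m).[z] - dpoly (size (P m)) (P m) z * h)
  + (dpoly (size (P m)) (P m) z - D) * h by ring.
have := nrmD ((f (z + h) - (P m).[z + h]) - (f z - (P m).[z])
  + ((P m).[z + h] - (P m).[z] - dpoly (size (P m)) (P m) z * h)) ((dpoly (size (P m)) (P m) z - D) * h).
have := nrmD ((f (z + h) - (P m).[z + h]) - (f z - (P m).[z]))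
  ((P m).[z + h] - (P m).[z] - dpoly (size (P m)) (P m) z * h).
have := nrmB (f (z + h) - (P m).[z + h]) (f z - (P m).[z]).
lra.
Qed.
End EntireClass.

(** * Infinite products *)

Section InfiniteProducts.
Variable R : realType.
Local Notation C := R[i].
Local Open Scope complex_scope.
Implicit Types (z p : C) (ps : seq C) (g f : C -> C).

(** The class of functions g that the products of the g(z p^k) preserve: g(0) = 1,
    with the linear bound that makes the factors converge geometrically to 1. *)
Definition unital g := entire g /\ forall s : R, 0 < s ->
  exists2 B : R, 0 <= B & forall z, nrm z <= s -> nrm (g z - 1) <= B * nrm z.

Lemma geo_le (r : R) n : 0 <= r < 1 -> \sum_(k < n) r ^+ k <= (1 - r)^-1.
Proof.
move=> /andP[r0 r1]; have r1' : 0 < 1 - r by rewrite subr_gt0.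
have E : (1 - r) * \sum_(i < n) r ^+ i = 1 - r ^+ n.
  rewrite -[in RHS](expr1n _ n) subrXX; congr (_ * _).
  by apply: eq_bigr => i _; rewrite expr1n mul1r.
by rewrite -[leRHS]mul1r ler_pdivlMr // mulrC E gerBl exprn_ge0.
Qed.

Let partial g p z n := \prod_(k < n) g (z * p ^+ k).

Let partial_bound g p (s : R) : unital g -> nrm p < 1 -> 0 < s ->
  exists2 B : R, 0 <= B & (forall z n, nrm z <= s ->
    nrm (partial g p z n.+1 - partial g p z n) <= B * nrm z * nrm p ^+ n).
Proof.
move=> [_ Hg] p1 s0; have [B B0 HB] := Hg s s0.
have r0 := nrm_ge0 p; have rr : 0 <= nrm p < 1 by rewrite r0.
have gB z k : nrm z <= s -> nrm (g (z * p ^+ k) - 1) <= B * nrm z * nrm p ^+ k.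
  move=> zs; rewrite (le_trans (HB _ _)) //.
    by rewrite nrmM nrmX (le_trans _ zs) // ler_piMr ?nrm_ge0 // exprn_ile1 // ltW.
  by rewrite nrmM nrmX mulrA.
pose M := expR (B * s / (1 - nrm p)).
have pM z n : nrm z <= s -> nrm (partial g p z n) <= M.
  move=> zs; rewrite /partial nrm_prod.
  apply: le_trans (_ : \prod_(k < n) expR (B * s * nrm p ^+ k) <= _).
    apply: ler_prod => k _; rewrite nrm_ge0 /=.
    have := gB z k zs; have h := expR_ge1Dx (B * s * nrm p ^+ k).
    have h2 : B * nrm z * nrm p ^+ k <= B * s * nrm p ^+ k.
      by rewrite ler_wpM2r ?exprn_ge0 // ler_wpM2l.
    have := nrmD (g (z * p ^+ k) - 1) 1; rewrite subrK nrm1; lra.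
  rewrite -expR_sum /M ler_expR -mulr_sumr ler_wpM2l ?geo_le //.
  by rewrite mulr_ge0 // ltW.
exists (M * B); first by rewrite mulr_ge0 // expR_ge0.
move=> z n zs; rewrite /partial big_ord_recr /= -/(partial g p z n).
have -> : partial g p z n * g (z * p ^+ n) - partial g p z n =
  partial g p z n * (g (z * p ^+ n) - 1) by ring.
rewrite nrmM -!mulrA ler_pM ?nrm_ge0 ?pM // mulrA; exact: gB.
Qed.

Let partial_lim g p : unital g -> nrm p < 1 -> forall s : R, 0 < s ->
  exists2 B : R, 0 <= B & forall z, nrm z <= s -> exists l, tends (partial g p z) l /\
    forall n, nrm (partial g p z n - l) <= B * nrm z * nrm p ^+ n.
Proof.
move=> Hg p1 s s0; have [B B0 HB] := partial_bound Hg p1 s0.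
have rr : 0 <= nrm p < 1 by rewrite nrm_ge0.
have r1' : 0 < 1 - nrm p by rewrite subr_gt0.
exists (B / (1 - nrm p)); first by rewrite divr_ge0 // ltW.
move=> z zs; have [l [Hl Hn]] := geom_lim rr (fun n => HB z n zs).
exists l; split => // n; rewrite (le_trans (Hn n)) // le_eqVlt; apply/orP; left.
by apply/eqP; ring.
Qed.

Local Arguments qpoch : simpl never.

Lemma qpoch0 z : qpoch z [::] = 1 - z.
Proof. by []. Qed.

Lemma qpoch_cons z p ps :
  qpoch z (p :: ps) = clim (fun n => \prod_(k < n) qpoch (z * p ^+ k) ps).
Proof. by []. Qed.

Definition contract ps := all (fun p => nrm p < 1) ps.

Let unital_tends g p z : unital g -> nrm p < 1 ->
  tends (partial g p z) (clim (partial g p z)).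
Proof.
move=> Hg p1; have s0 : 0 < nrm z + 1 by rewrite ltr_wpDl ?nrm_ge0.
have [B _ HB] := partial_lim Hg p1 s0.
have [|l [Hl _]] := HB z; first by rewrite lerDl.
by rewrite (clim_eq Hl).
Qed.

Lemma unital_qpoch ps : contract ps -> unital (fun z => qpoch z ps).
Proof.
elim: ps => [_|p ps IH /= /andP[p1 /IH Hg]].
  split; first by apply: eq_entire (entire_poly (1 - 'X)) => z; rewrite hornerD hornerN hornerC hornerX.
  by move=> s s0; exists 1 => // z _; rewrite qpoch0 addrAC subrr add0r nrmN mul1r.
split=> [|s s0].
  apply: entire_lim => s e s0 e0; have [B B0 HB] := partial_lim Hg p1 s0.
  have [n Hn] : exists n, B * s * nrm p ^+ n <= e.
    have hp : `|nrm p| < 1 by rewrite ger0_norm ?nrm_ge0.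
    have D0 : 0 < B * s + 1 by rewrite ltr_wpDl // mulr_ge0 // ltW.
    have /cvgrPdist_lt /(_ _ (divr_gt0 e0 D0)) [n _ /(_ n (leqnn n))] := cvg_expr hp.
    rewrite /= sub0r normrN ger0_norm ?exprn_ge0 ?nrm_ge0 // ltr_pdivlMr // => h.
    exists n; apply: le_trans (ltW h); rewrite mulrC ler_wpM2l ?exprn_ge0 ?nrm_ge0 //; lra.
  exists (fun z => partial (fun z => qpoch z ps) p z n).
    apply: entire_prod => k; apply: eq_entire (entire_comp (p ^+ k) 1 Hg.1) => z.
    by rewrite expr1 mulrC.
  move=> z zs; have [l [Hl Hnl]] := HB z zs.
  rewrite qpoch_cons (clim_eq Hl) nrmC (le_trans (Hnl n)) // (le_trans _ Hn) //.
  by rewrite ler_wpM2r ?exprn_ge0 ?nrm_ge0 // ler_wpM2l.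
have [B B0 HB] := partial_lim Hg p1 s0; exists B => // z zs.
have [l [Hl Hnl]] := HB z zs; rewrite qpoch_cons (clim_eq Hl) nrmC.
by have := Hnl 0%N; rewrite /partial big_ord0 expr0 mulr1.
Qed.

Lemma qpoch_tends z p ps : contract (p :: ps) ->
  tends (fun n => \prod_(k < n) qpoch (z * p ^+ k) ps) (qpoch z (p :: ps)).
Proof. by move=> /= /andP[p1 /unital_qpoch Hg]; exact: (unital_tends z Hg p1). Qed.

Lemma qpochS z p ps : contract (p :: ps) ->
  qpoch z (p :: ps) = qpoch z ps * qpoch (p * z) (p :: ps).
Proof.
move=> Hc; have := tends_shift (qpoch_tends z Hc).
move=> /tends_uniq; apply.
apply: eq_tends (tends_cstM (qpoch z ps) (qpoch_tends (p * z) Hc)) => n.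
rewrite big_ord_recl expr0 mulr1 /=; congr (_ * _); apply: eq_bigr => k _.
have -> : bump 0 k = k.+1 by [].
by rewrite exprS; congr qpoch; ring.
Qed.

(** Far enough in the product the tail is close to 1, so that an infinite product
    vanishes only through one of its factors. *)
Lemma qpoch_neq0 z p ps : contract (p :: ps) ->
  (forall k, qpoch (z * p ^+ k) ps != 0) -> qpoch z (p :: ps) != 0.
Proof.
move=> Hc H; have [p1 _] := andP Hc.
have Hsh n : qpoch z (p :: ps) = (\prod_(k < n) qpoch (z * p ^+ k) ps) * qpoch (z * p ^+ n) (p :: ps).
  elim: n => [|n IH]; first by rewrite big_ord0 expr0 mul1r mulr1.
  rewrite IH big_ord_recr /= -mulrA (qpochS _ Hc); congr (_ * (_ * qpoch _ _)).
  by rewrite exprS; ring.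
have s0 : 0 < nrm z + 1 by rewrite ltr_wpDl ?nrm_ge0.
have [_ /(_ _ s0) [B B0 HB]] := unital_qpoch Hc.
have hp : `|nrm p| < 1 by rewrite ger0_norm ?nrm_ge0.
have D0 : 0 < B * (nrm z + 1) + 1 by rewrite ltr_wpDl // mulr_ge0 // ltW.
have D1 : 0 < (B * (nrm z + 1) + 1)^-1 by rewrite invr_gt0.
have /cvgrPdist_lt /(_ _ D1) [n _ /(_ n (leqnn n))] := cvg_expr hp.
rewrite /= sub0r normrN ger0_norm ?exprn_ge0 ?nrm_ge0 // => h.
rewrite (Hsh n) mulf_neq0 //; first by apply/prodf_neq0 => k _.
have nz : nrm (z * p ^+ n) = nrm z * nrm p ^+ n by rewrite nrmM nrmX.
have pn1 : nrm p ^+ n <= 1 by rewrite exprn_ile1 ?nrm_ge0 // ltW.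
have := HB (z * p ^+ n); rewrite nz => /(_ _) H1.
have {H1} : nrm (qpoch (z * p ^+ n) (p :: ps) - 1) <= B * (nrm z * nrm p ^+ n).
  by apply: H1; have := nrm_ge0 z; nra.
apply: contraTneq => ->; rewrite sub0r nrmN nrm1 -ltNge.
rewrite -[(_ + 1)^-1]mul1r ltr_pdivlMr // in h.
apply: le_lt_trans h; rewrite mulrA mulrC ler_wpM2l ?exprn_ge0 ?nrm_ge0 //.
by have := nrm_ge0 z; nra.
Qed.

Lemma qpoch1_neq0 z p : nrm p < 1 -> (forall k, z * p ^+ k != 1) -> qpoch z [:: p] != 0.
Proof.
move=> p1 H;  apply: qpoch_neq0 => [|k]; first by rewrite /= p1.
by rewrite qpoch0 subr_eq0 eq_sym.
Qed.

Lemma qpoch2_neq0 z p P : nrm p < 1 -> nrm P < 1 ->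
  (forall k l, z * p ^+ k * P ^+ l != 1) -> qpoch z [:: p; P] != 0.
Proof.
move=> p1 P1 H; apply: qpoch_neq0 => [|k]; first by rewrite /= p1 P1.
by apply: qpoch1_neq0.
Qed.

Lemma qpoch1_at1 p : nrm p < 1 -> qpoch 1 [:: p] = 0.
Proof. by move=> p1; rewrite qpochS /= ?p1 // qpoch0 subrr mul0r. Qed.

Lemma qpoch2S z p P : nrm p < 1 -> nrm P < 1 ->
  qpoch z [:: p; P] = qpoch z [:: P] * qpoch (p * z) [:: p; P].
Proof. by move=> p1 P1; rewrite qpochS //= p1 P1. Qed.

(** The inner parameter is the one that is shifted: the quotient of the partial
    products of (z; p, P) and (P z; p, P) is a partial product of (z; p). *)
Lemma qpoch2S' z p P : nrm p < 1 -> nrm P < 1 ->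
  qpoch z [:: p; P] = qpoch z [:: p] * qpoch (P * z) [:: p; P].
Proof.
move=> p1 P1; have c2 : contract [:: p; P] by rewrite /= p1 P1.
have c1 : contract [:: p] by rewrite /= p1.
have cP : contract [:: P] by rewrite /= P1.
apply: tends_uniq (qpoch_tends z c2) _.
apply: eq_tends (tendsM (qpoch_tends z c1) (qpoch_tends (P * z) c2)) => n.
rewrite -big_split /=; apply: eq_bigr => k _.
by rewrite [RHS](qpochS _ cP); congr (_ * qpoch _ _); ring.
Qed.

Lemma entire_qpoch ps : contract ps -> entire (fun z => qpoch z ps).
Proof. by move=> /unital_qpoch[]. Qed.

(** The theta function in its product form, without the constant factor
    (p; p); it is Theta_p up to this factor. *)
Definition thetap p z := qpoch z [:: p] * qpoch (p / z) [:: p].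

Lemma thetap_shift p z : nrm p < 1 -> p != 0 -> z != 0 -> thetap p (p * z) = - z^-1 * thetap p z.
Proof.
move=> p1 p0 z0; have c1 : contract [:: p] by rewrite /= p1.
rewrite /thetap (qpochS z c1) qpoch0.
have -> : p / (p * z) = z^-1 by rewrite invfM mulrA divff ?mul1r.
by rewrite (qpochS z^-1 c1) qpoch0; field.
Qed.

Lemma thetapV p z : nrm p < 1 -> p != 0 -> z != 0 -> thetap p z^-1 = - z^-1 * thetap p z.
Proof.
move=> p1 p0 z0; rewrite -thetap_shift // /thetap invrK mulrC; congr (_ * qpoch _ _).
by rewrite invfM mulrA divff ?mul1r.
Qed.

Lemma thetap1 p : nrm p < 1 -> thetap p 1 = 0.
Proof. by move=> p1; rewrite /thetap qpoch1_at1 // mul0r. Qed.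

Lemma thetap_neq0 p z : nrm p < 1 -> p != 0 -> z != 0 -> (forall k : int, z != p ^ k) -> thetap p z != 0.
Proof.
move=> p1 p0 z0 H; rewrite /thetap mulf_neq0 //; apply: qpoch1_neq0 => // k.
  apply/eqP => E; have /eqP := H (- k%:Z); apply.
  rewrite -exprnN; apply: (@mulIf _ (p ^+ k)); first by rewrite expf_neq0.
  by rewrite E mulVf // expf_neq0.
apply/eqP => E; have /eqP := H k.+1%:Z; apply; rewrite -exprnP exprS.
by rewrite -[LHS]mulr1 -E; field.
Qed.

(** Theta functions enter the uniqueness arguments as functions on the punctured
    plane, with the argument rescaled or raised to a power. *)
Lemma thetap_laurent p c m : nrm p < 1 -> c != 0 -> laurent (fun z => thetap p (c * z ^+ m)).
Proof.
move=> p1 c0; have c1 : contract [:: p] by rewrite /= p1.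
apply: laurentM; first exact: (entire_laurent (entire_comp c m (entire_qpoch c1))).
apply: eq_laurent (entire_laurentV (entire_comp (p / c) m (entire_qpoch c1))) => z z0.
by congr qpoch; rewrite exprVn invfM mulrA.
Qed.

End InfiniteProducts.

(** * The odd theta function *)

Section Sigma.
Variable R : realType.
Local Notation C := R[i].
Local Notation Im := complex.Im.
Local Open Scope complex_scope.
Variable tau : C.
Hypothesis tau1 : `|epi (2 * tau)| < 1.
Implicit Types x y : C.

Let p := epi (2 * tau).

Lemma nome_lt1 : nrm (epi (2 * tau)) < 1.
Proof. by move: tau1; rewrite (normE (epi _)) ltcE /= => /andP[]. Qed.

Let p1 : nrm p < 1 := nome_lt1.
Let p0 : p != 0 := epi_neq0 _.

Lemma Im_tau_gt0 : 0 < Im tau.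
Proof.
have := p1; rewrite /p nrm_epi expR_lt1 oppr_lt0 pmulr_rgt0 ?pi_gt0 //.
by rewrite mulr_natl mulr2n; case: tau => a b /=; lra.
Qed.

Lemma epi_exprz x (m : int) : epi x ^ m = epi (m%:~R * x).
Proof.
case: m => m; first by rewrite -exprnP -epiX -pmulrn mulr_natl.
by rewrite NegzE -exprnN -epiX -epiN mulrNz -pmulrn mulNr mulr_natl.
Qed.

(** The function theta[1/2, 1/2] up to a constant: the entire odd function whose
    zeros are the points of the lattice Z tau + Z. *)
Definition sigma x : C := epi (- x) * thetap p (epi (2 * x)).

Lemma sigmaN x : sigma (- x) = - sigma x.
Proof.
rewrite /sigma mulrN opprK !epiN thetapV ?epi_neq0 //.
rewrite mulr_natl epiX; have := epi_neq0 x; move: (epi x) => e e0; field; exact: e0.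
Qed.

Lemma sigma0 : sigma 0 = 0.
Proof. by rewrite /sigma mulr0 epi0 thetap1 ?mulr0. Qed.

Lemma sigma_int x (b : int) : sigma (x + b%:~R) = epi b%:~R * sigma x.
Proof.
rewrite /sigma mulrDr epiD epi2_int mulr1 opprD epiD mulrA; congr (_ * _).
rewrite [LHS]mulrC; congr (_ * _).
by have := epi2_int R b; rewrite mulr_natl mulr2n epiD => H;
  apply: (mulfI (epi_neq0 b%:~R)); rewrite H -epiD subrr epi0.
Qed.

Lemma sigma_tau x : sigma (x + tau) = epi (1 - 2 * x - tau) * sigma x.
Proof.
rewrite /sigma mulrDr [2 * x + _]addrC epiD -/p thetap_shift ?epi_neq0 //.
rewrite opprD !epiD epi1 mulr_natl epiX !epiN epiX.
have := epi_neq0 x; have := epi_neq0 tau; move: (epi x) (epi tau) => e f f0 e0.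
by field; rewrite e0.
Qed.

Lemma sigma_mtau x : sigma (x - tau) = epi (1 + 2 * x - tau) * sigma x.
Proof.
have := sigma_tau (x - tau); rewrite subrK => ->; rewrite mulrA -epiD.
have -> : 1 + 2 * x - tau + (1 - 2 * (x - tau) - tau) = 2 by ring.
by rewrite epi2 mul1r.
Qed.

Lemma sigma_ntau x (a : int) : sigma (x + a%:~R * tau) =
  epi (a%:~R - 2 * a%:~R * x - a%:~R ^+ 2 * tau) * sigma x.
Proof.
case: (intP a) => [|n|n].
- by rewrite mul0r addr0 mulr0 mul0r expr0n /= mul0r !subr0 epi0 mul1r.
- rewrite -pmulrn; elim: n.+1 => {n} [|n IH].
    by rewrite mul0r addr0 mulr0 mul0r expr0n /= mul0r !subr0 epi0 mul1r.
  have -> : x + n.+1%:R * tau = x + n%:R * tau + tau by rewrite -natr1; ring.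
  by rewrite sigma_tau IH mulrA -epiD; congr (epi _ * _); rewrite -natr1; ring.
- rewrite mulrNz -pmulrn; elim: n.+1 => {n} [|n IH].
    by rewrite oppr0 mul0r addr0 mulr0 mul0r expr0n /= mul0r !subr0 epi0 mul1r.
  have -> : x + - n.+1%:R * tau = x + - n%:R * tau - tau by rewrite -natr1; ring.
  rewrite sigma_mtau IH mulrA -epiD; congr (_ * _).
  by rewrite -[LHS]divr1 -[X in _ / X](epi2 R) -epiB; congr epi; rewrite -natr1; ring.
Qed.

Lemma sigma_lattice x (a b : int) : sigma (x + (a%:~R * tau + b%:~R)) =
  epi (a%:~R + b%:~R - 2 * a%:~R * x - a%:~R ^+ 2 * tau) * sigma x.
Proof.
rewrite addrA sigma_int sigma_ntau mulrA -epiD; congr (epi _ * _); ring.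
Qed.

(** The condition says that x is not in the lattice Z tau + Z. *)
Lemma sigma_neq0 x : (forall a : int, epi (2 * x) != epi (2 * (a%:~R * tau))) -> sigma x != 0.
Proof.
move=> H; rewrite /sigma mulf_neq0 ?epi_neq0 // thetap_neq0 ?epi_neq0 // => k.
by rewrite /p epi_exprz mulrCA.
Qed.

Lemma hasD_sigma x : exists D, hasD sigma x D.
Proof.
have c1 : contract [:: p] by rewrite /= p1.
have He : hasD (fun y => epi (2 * y)) x (ipi R * epi (2 * x) * 2).
  by have := hasD_comp (hasD_scale 2 (hasD_id x)) (hasD_epi (2 * x)); rewrite mulr1.
have Hm : hasD (fun y => epi (- y)) x (ipi R * epi (- x) * (-1)).
  have := hasD_comp (hasD_scale (-1) (hasD_id x)) (hasD_epi (-1 * x)).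
  by rewrite mulr1 !mulN1r; apply: eq_hasD => y; rewrite mulN1r.
have [D1 H1] := entire_hasD (epi (2 * x)) (entire_qpoch c1).
have Hi := @hasD_inv R (fun y => epi (2 * y)) x _ (epi_neq0 (2 * x)) He.
have Hp := hasD_scale p Hi.
have [D2 H2] := entire_hasD (p / epi (2 * x)) (entire_qpoch c1).
have := hasD_mul Hm (hasD_mul (hasD_comp He H1) (hasD_comp Hp H2)).
by move=> H; eexists; exact: H.
Qed.

(** The series defining theta[1/2, 1/2] and its Laurent coefficients. *)
Let t (m : int) : C := epi ((m%:~R + 1 / 2) ^+ 2 * tau + (m%:~R + 1 / 2)).
Let tpol n := \poly_(k < n.*2.+1) t (k%:Z - n%:Z).

Let lcoef_tpol n k : (absz k <= n)%N -> lcoef n (tpol n) k = t k.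
Proof.
move=> kn; rewrite /lcoef; case E: (k + n%:Z) => [i|i]; last by lia.
rewrite coef_poly; have -> : (i < n.*2.+1)%N by lia.
by congr t; lia.
Qed.

Let nrm_t (m : int) : nrm (t m) = expR (- (pi * Im tau * (m%:~R + 1 / 2) ^+ 2)).
Proof.
rewrite /t nrm_epi; congr (expR (- _)); rewrite -mulrA; congr (_ * _).
have -> : (m%:~R + 1 / 2 : C) = (m%:~R + 1 / 2)%:C.
  by rewrite rmorphD /= rmorph_int; congr (_ + _); rewrite !fmorph_div /= ?rmorph1 ?rmorph_nat.
rewrite -rmorphXn; case: tau => a b /=; move: (_ ^+ 2) => r.
by rewrite mul0r !addr0 mulrC.
Qed.

Let t_decay (rho : R) : 1 <= rho -> exists2 K : R, 0 <= K & forall n : nat,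
  nrm (t n.+1%:Z) * rho ^+ n.+1 <= K * (1 / 2) ^+ n /\
  nrm (t (- n.+1%:Z)) * rho ^+ n.+1 <= K * (1 / 2) ^+ n.
Proof.
move=> r1; have r0 : 0 < rho by lra.
pose y := pi * Im tau; have y0 : 0 < y by rewrite mulr_gt0 ?pi_gt0 ?Im_tau_gt0.
pose L := ln (2 * rho); exists (rho * expR (L ^+ 2 / (4 * y))).
  by rewrite mulr_ge0 ?expR_ge0 // ltW.
move=> n.
have key (m : int) : n%:R ^+ 2 <= (m%:~R + 1 / 2 : R) ^+ 2 ->
    nrm (t m) * rho ^+ n.+1 <= rho * expR (L ^+ 2 / (4 * y)) * (1 / 2) ^+ n.
  move=> hm; rewrite nrm_t -/y.
  have r2 : 0 < 2 * rho by lra.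
  have E : (2 * rho) ^+ n = expR (n%:R * L).
    by rewrite expRM_natl lnK // posrE.
  have -> : rho ^+ n.+1 = rho * ((2 * rho) ^+ n * (1 / 2) ^+ n).
    by rewrite exprS -exprMn; congr (_ * _ ^+ _); field.
  rewrite E.
  have -> : expR (- (y * (m%:~R + 1 / 2) ^+ 2)) * (rho * (expR (n%:R * L) * (1 / 2) ^+ n)) =
    rho * expR (n%:R * L - y * (m%:~R + 1 / 2) ^+ 2) * (1 / 2) ^+ n.
    by rewrite expRD; ring.
  rewrite ler_wpM2r ?exprn_ge0 ?divr_ge0 // ler_wpM2l ?ler_expR ?(ltW r0) //.
  rewrite ler_pdivlMr; last by lra.
  have := sqr_ge0 (L - 2 * y * n%:R); have := ler_wpM2l (ltW y0) hm.
  by nra.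
split; apply: key.
  by rewrite -pmulrn -[n.+1%:R]natr1; have := ler0n R n; nra.
by rewrite mulrNz -pmulrn -[n.+1%:R]natr1; have := ler0n R n; nra.
Qed.

Let tser (z : C) := clim (fun n => lp n (tpol n) z).

Let lp_tpol n (z : C) : z != 0 -> lp n (tpol n) z = \sum_(k < n.*2.+1) t (k%:Z - n%:Z) * z ^ (k%:Z - n%:Z).
Proof.
move=> z0; rewrite /lp horner_poly mulr_suml; apply: eq_bigr => k _.
by rewrite expfzDr // -exprnN mulrA.
Qed.

Let tpol_step n (z : C) : z != 0 -> lp n.+1 (tpol n.+1) z - lp n (tpol n) z =
  t n.+1%:Z * z ^+ n.+1 + t (- n.+1%:Z) * z ^- n.+1.
Proof.
move=> z0; rewrite !lp_tpol // doubleS big_ord_recr big_ord_recl /=.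
have -> : 0%N%:Z - n.+1%:Z = - n.+1%:Z by rewrite sub0r.
have -> : n.*2.+2%:Z - n.+1%:Z = n.+1%:Z by lia.
rewrite -exprnN -exprnP; have -> : \sum_(i < n.*2.+1) t ((bump 0 i)%:Z - n.+1%:Z) * z ^ ((bump 0 i)%:Z - n.+1%:Z)
  = \sum_(k < n.*2.+1) t (k%:Z - n%:Z) * z ^ (k%:Z - n%:Z).
  by apply: eq_bigr => k _; have -> : (bump 0 k)%:Z - n.+1%:Z = k%:Z - n%:Z by rewrite /bump /=; lia.
by ring.
Qed.

Let tser_approx (rho : R) : 1 <= rho -> exists2 K : R, 0 <= K & forall z : C,
  rho^-1 <= nrm z <= rho -> tends (fun n => lp n (tpol n) z) (tser z) /\
    forall n, nrm (lp n (tpol n) z - tser z) <= K * (1 / 2) ^+ n.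
Proof.
move=> r1; have [K K0 HK] := t_decay r1; exists (4 * K); first by rewrite mulr_ge0.
move=> z /andP[z1 z2]; have r0 : 0 < rho by lra.
have zp : 0 < nrm z by rewrite (lt_le_trans _ z1) // invr_gt0.
have z0 : z != 0 by rewrite -nrm_gt0.
have [||l [Hl Hn]] := @geom_lim R (fun n => lp n (tpol n) z) (2 * K) (1 / 2); first by lra.
  move=> n; rewrite tpol_step // (le_trans (nrmD _ _)) // !nrmM nrmV nrmX.
  have [h1 h2] := HK n; have -> : 2 * K * (1 / 2) ^+ n = K * (1 / 2) ^+ n + K * (1 / 2) ^+ n by ring.
  rewrite lerD //.
    by apply: le_trans h1; rewrite ler_wpM2l ?nrm_ge0 // lerXn2r // ?nnegrE ltW.
  apply: le_trans h2; rewrite ler_wpM2l ?nrm_ge0 // -exprVn lerXn2r // ?nnegrE ?invr_ge0 ?(ltW r0) ?(ltW zp) //.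
  by rewrite -[leRHS]invrK lef_pV2 ?posrE ?invr_gt0.
rewrite /tser (clim_eq Hl); split => // n; rewrite (le_trans (Hn n)) //.
have -> : (1 - 1 / 2 : R)^-1 = 2 by field.
by lra.
Qed.

Let tser_laurent : laurent tser.
Proof.
move=> rho e r1 e0; have [K K0 HK] := tser_approx r1.
have D0 : 0 < K + 1 by lra.
have [n _ Hn] := @half_small R (e / (K + 1)) 0 (divr_gt0 e0 D0).
exists n, (tpol n) => z zr; have [_ /(_ n)] := HK z zr; rewrite nrmC => /le_trans -> //.
have h : 0 <= (1 / 2 : R) ^+ n by rewrite exprn_ge0 // divr_ge0.
move: Hn; rewrite ler_pdivlMr //; nra.
Qed.

Let tser_coefs : coefs tser t.
Proof.
have [a Ha] := laurent_coefs tser_laurent.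
have [K K0 HK] := tser_approx (lexx 1).
suff at_ : a = t by rewrite -at_.
apply/funext => k; apply/eqP; rewrite -subr_eq0 -nrm_eq0 eq_le nrm_ge0 andbT.
apply/ler_addgt0Pr => e e0; rewrite add0r; have D0 : 0 < K + 1 by lra.
have [n kn Hn] := @half_small R (e / (K + 1)) (absz k) (divr_gt0 e0 D0).
have := Ha 1 (K * (1 / 2) ^+ n) n (tpol n) k ltr01.
rewrite exp1rz mulr1 lcoef_tpol // => /(_ _) h.
apply: le_trans (h _) _.
  by move=> z z1; rewrite nrmC; apply: (HK z _).2; rewrite z1 invr1 lexx.
have h0 : 0 <= (1 / 2 : R) ^+ n by rewrite exprn_ge0 // divr_ge0.
by move: Hn; rewrite ler_pdivlMr //; nra.
Qed.

Let t_rec k : t (k + 1) = - p ^ (k + 1) * t k.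
Proof.
rewrite /p epi_exprz.
by rewrite /t -[- epi _]mulN1r -epi1 -!epiD; congr epi; rewrite rmorphD /=; field.
Qed.

(** Both sides have Laurent coefficients that satisfy the same recursion of step 1. *)
Lemma tser_thetap : exists2 c : C, c != 0 & forall z : C, z != 0 -> tser z = c * (thetap p z / z).
Proof.
have S1 : laurent (fun z : C => thetap p z).
  by apply: eq_laurent (thetap_laurent 1 p1 (oner_neq0 _)) => z _; rewrite expr1 mul1r.
have S2 : laurent (fun z : C => thetap p z / z).
  apply: laurentM S1 _; apply: eq_laurent (entire_laurentV (entire_poly 'X)) => z _.
  by rewrite hornerX.
have [a Ha] := laurent_coefs S1.
have Ha2 : coefs (fun z : C => thetap p z / z) (fun k => a (k + 1)).
  by have := coefs_shift (m := 1) Ha; under eq_fun do rewrite expr1.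
have arec := coefs_rec (c := -1) (N := 1) p0 S1 Ha.
have {}arec k : p ^ k * a k = -1 * a (k + 1).
  by apply: arec => z z0; rewrite thetap_shift // expr1; ring.
have t0 : t 0 != 0 := epi_neq0 _.
pose l := - a 1 / t 0.
have HL : laurent (fun z => thetap p z / z + l * tser z) := laurentD S2 (laurentZ l tser_laurent).
have Hl : coefs (fun z => thetap p z / z + l * tser z) (fun k => a (k + 1) + l * t k).
  exact: (coefsD (laurentZ l tser_laurent) Ha2 (coefsZ (c := l) tser_laurent tser_coefs)).
have b0 : forall k, a (k + 1) + l * t k = 0.
  have h1 : (-1 : C) / p != 0 by rewrite mulf_neq0 ?invr_eq0 // oppr_eq0 oner_eq0.
  apply: (rec_eq0 p0 h1 (ltn0Sn 0)) => [k|[|//] _]; last first.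
    by rewrite add0r /l divfK // addrN.
  have E : a (k + 1 + 1) = - (p ^ k * p) * a (k + 1).
    by have := arec (k + 1); rewrite mulN1r expfzDr // expr1z mulNr => ->; rewrite opprK.
  by rewrite E t_rec expfzDr // expr1z; field.
have E z : z != 0 -> thetap p z / z + l * tser z = 0.
  apply: (coefs0_eq0 HL) => //; have -> : (fun=> 0) = (fun k => a (k + 1) + l * t k) by apply/funext => k; rewrite b0.
  exact: Hl.
have l0 : l != 0.
  apply/eqP => l0; have N1 : (-1 : C) != 0 by rewrite oppr_eq0 oner_eq0.
  have := E _ N1; rewrite l0 mul0r addr0 => /eqP; rewrite mulf_eq0 invr_eq0 (negPf N1) orbF.
  apply/negP; apply: thetap_neq0 => // k; apply/eqP => pk.
  have nX (m : int) : nrm (p ^ m) = nrm p ^ m.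
    by case: m => m; rewrite ?NegzE -?exprnN ?nrmV nrmX.
  have := congr1 (@nrm R) pk; rewrite nrmN nrm1 nX => /esym/eqP.
  rewrite pexprz_eq1 ?nrm_ge0 // => /orP[/eqP k0|/eqP]; last by have := p1 => /[swap] ->; rewrite ltxx.
  move: pk; rewrite k0 expr0z => /eqP; rewrite eq_sym -subr_eq0 opprK -[1 + 1]/(2%:R) pnatr_eq0.
  by [].
exists (- l^-1); first by rewrite oppr_eq0 invr_eq0.
move=> z /E /eqP; rewrite addr_eq0 => /eqP ->; field; exact: l0.
Qed.

(** The characteristics (a, b) amount to a translation by a tau + b. *)
Lemma theta_sigma : exists2 c : C, c != 0 & forall a b x,
  theta (1 / 2 + a) (1 / 2 + b) x tau =
  c * epi (a ^+ 2 * tau + 2 * a * (x + 1 / 2 + b)) * sigma (x + a * tau + b).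
Proof.
have [c c0 Hc] := tser_thetap; exists c => // a b x.
pose y := x + a * tau + b.
have z0 := epi_neq0 (2 * y).
have [rho r1 zr] : exists2 rho : R, 1 <= rho & rho^-1 <= nrm (epi (2 * y)) <= rho.
  have nz : 0 < nrm (epi (2 * y)) by rewrite nrm_gt0.
  have nz1 : 0 < (nrm (epi (2 * y)))^-1 by rewrite invr_gt0.
  exists (1 + nrm (epi (2 * y)) + (nrm (epi (2 * y)))^-1); first lra.
  apply/andP; split; last by lra.
  by rewrite -[leRHS]invrK lef_pV2 ?posrE; lra.
have [K _ /(_ _ zr)[Ht _]] := tser_approx r1.
rewrite /theta (clim_eq (l := epi (a ^+ 2 * tau + 2 * a * (x + 1 / 2 + b)) * epi y * tser (epi (2 * y)))).
  have E2 : epi (2 * y) = epi y ^+ 2 by rewrite mulr_natl epiX.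
  rewrite Hc // /sigma -/y epiN E2; have := epi_neq0 y.
  by move: (epi y) => e e0; field.
apply: eq_tends (tends_cstM _ Ht) => n; rewrite lp_tpol // mulr_sumr; apply: eq_bigr => k _.
have -> : epi (2 * y) ^ (k%:Z - n%:Z) = epi (2 * (k%:R - n%:R) * y).
  by rewrite epi_exprz; congr epi; rewrite rmorphB /= -!pmulrn; ring.
rewrite /t -!epiD /epi; congr cexp; rewrite /y rmorphB /= -!pmulrn.
by field.
Qed.

End Sigma.

(** * Sums over the torsion points *)

Section PeriodicSums.
Variables (V : nmodType) (N : nat).
Implicit Types (f : int -> V) (m : int).

Lemma sum_periodS f : (forall k, f (k + N%:Z) = f k) ->
  \sum_(i < N) f (i%:Z + 1) = \sum_(i < N) f i%:Z.
Proof.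
move=> per; case: N per => [|n] per; first by rewrite !big_ord0.
rewrite big_ord_recr big_ord_recl /= addrC; congr (_ + _).
  by rewrite -(per 0) add0r -[n.+1]addn1 PoszD.
by apply: eq_bigr => i _; congr f; rewrite /bump /=; lia.
Qed.

Lemma sum_period f m : (forall k, f (k + N%:Z) = f k) ->
  \sum_(i < N) f (i%:Z + m) = \sum_(i < N) f i%:Z.
Proof.
move=> per; have up (n : nat) (g : int -> V) : (forall k, g (k + N%:Z) = g k) ->
    \sum_(i < N) g (i%:Z + n%:Z) = \sum_(i < N) g i%:Z.
  elim: n g => [|n IH] g gp; first by under eq_bigr do rewrite addr0.
  have := sum_periodS (f := fun k => g (k + n%:Z)) _; rewrite -(IH g gp) => <-.
    by apply: eq_bigr => i _; congr g; lia.
  by move=> k; rewrite -[RHS]gp; congr g; lia.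
case: m => n; first exact: up.
rewrite -(up n.+1 (fun k => f (k + Negz n))).
  by apply: eq_bigr => i _; congr f; lia.
by move=> k; rewrite -[RHS]per; congr f; lia.
Qed.

Lemma sum_period_opp f : (forall k, f (k + N%:Z) = f k) ->
  \sum_(i < N) f (- i%:Z) = \sum_(i < N) f i%:Z.
Proof.
move=> per; rewrite -(sum_period 1 per) (reindex_inj rev_ord_inj) /=.
apply: eq_bigr => -[i iN] _ /=; rewrite -[LHS]per; congr f; lia.
Qed.

(** Functions on (Z/N)^2 are represented by functions of integers: translations and
    negations of the indices need no reduction modulo N. *)
Definition periodic2 (h : int -> int -> V) := forall a b,
  h (a + N%:Z) b = h a b /\ h a (b + N%:Z) = h a b.

Definition sum2 (h : int -> int -> V) := \sum_(i < N) \sum_(j < N) h i%:Z j%:Z.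

Lemma eq_sum2 h h' : (forall a b, h a b = h' a b) -> sum2 h = sum2 h'.
Proof. by move=> E; apply: eq_bigr => i _; apply: eq_bigr => j _. Qed.

Lemma sum2_shift h m n : periodic2 h -> sum2 (fun a b => h (a + m) (b + n)) = sum2 h.
Proof.
move=> per; rewrite /sum2.
rewrite (@sum_period (fun k => \sum_(j < N) h k (j%:Z + n)) m) => [|k]; last first.
  by apply: eq_bigr => j _; case: (per k (j%:Z + n)).
by apply: eq_bigr => i _; rewrite (@sum_period (h i%:Z) n) // => k; case: (per i%:Z k).
Qed.

Lemma sum2_opp h : periodic2 h -> sum2 (fun a b => h (- a) (- b)) = sum2 h.
Proof.
move=> per; rewrite /sum2.
rewrite (@sum_period_opp (fun k => \sum_(j < N) h k (- j%:Z))) => [|k]; last first.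
  by apply: eq_bigr => j _; case: (per k (- j%:Z)).
by apply: eq_bigr => i _; rewrite (@sum_period_opp (h i%:Z)) // => k; case: (per i%:Z k).
Qed.

Lemma sum2_exchange (g : int -> int -> int -> int -> V) :
  sum2 (fun a b => sum2 (g a b)) = sum2 (fun c d => sum2 (fun a b => g a b c d)).
Proof.
have E (h : int -> int -> V) : sum2 h = \sum_(p : 'I_N * 'I_N) h p.1%:Z p.2%:Z by rewrite /sum2 pair_big.
rewrite !E; under eq_bigr do rewrite E.
by rewrite exchange_big /=; apply: eq_bigr => q _; rewrite E.
Qed.

End PeriodicSums.

Section Sum2Ring.
Variables (K : nzRingType) (N : nat).
Lemma sum2_mulr (c : K) h : c * sum2 N h = sum2 N (fun a b => c * h a b).
Proof. by rewrite /sum2 mulr_sumr; apply: eq_bigr => i _; rewrite mulr_sumr. Qed.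
Lemma sum2_mull (c : K) h : sum2 N h * c = sum2 N (fun a b => h a b * c).
Proof. by rewrite /sum2 mulr_suml; apply: eq_bigr => i _; rewrite mulr_suml. Qed.
End Sum2Ring.

(** * Theta function identities on the torsion points *)

Section Torsion.
Variable R : realType.
Local Notation C := R[i].
Local Open Scope complex_scope.
Variable tau : C.
Hypothesis tau1 : `|epi (2 * tau)| < 1.
Variable N : nat.
Hypothesis hN : (1 < N)%N.
Local Notation sig := (sigma tau).
Local Notation Nc := (N%:R : C).

Lemma epi_pow (x : C) n : epi x ^+ n = epi (n%:R * x).
Proof. by rewrite -epiX mulr_natl. Qed.

Let N0 : Nc != 0. Proof. by rewrite pnatr_eq0; case: N hN. Qed.
Let p := epi (2 * tau).
Let p1 : nrm p < 1 := nome_lt1 tau1.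
Let p0 : p != 0 := epi_neq0 _.
Let S := thetap p.

Lemma sigma_eq0P x : sig x = 0 <-> exists k : int, epi (2 * x) = epi (2 * (k%:~R * tau)).
Proof.
split=> [s0|[k E]].
  apply: contrapT => H; have /eqP := s0; apply/negP; apply: sigma_neq0 => // k.
  by apply/eqP => E; apply: H; exists k.
have := sigma_ntau tau1 0 k; rewrite sigma0 // mulr0 add0r /sigma => /eqP.
by rewrite mulf_eq0 (negPf (epi_neq0 _)) /= -E => /eqP ->; rewrite mulr0.
Qed.

(** The N-torsion points of the elliptic curve. *)
Definition om (a b : int) : C := (a%:~R * tau + b%:~R) / Nc.

Lemma sigma_om_neq0 x a b : sig (Nc * x) != 0 -> sig (x + om a b) != 0.
Proof.
apply: contra => /eqP/sigma_eq0P[k E]; apply/eqP/sigma_eq0P; exists (k * N%:Z - a).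
have := congr1 (fun z => z ^+ N) E; rewrite -!epiX => {}E.
have -> : 2 * (Nc * x) = (2 * (x + om a b)) *+ N - 2 * (a%:~R * tau) - 2 * b%:~R.
  by rewrite -mulr_natr /om; field.
rewrite epiB epi2_int divr1 epiB E -epiB; congr epi.
by rewrite rmorphB rmorphM /= -pmulrn -mulr_natr; ring.
Qed.

Definition chi (m : int) : C := epi (2 * m%:~R / Nc).

Lemma chiD m n : chi (m + n) = chi m * chi n.
Proof. by rewrite /chi -epiD rmorphD /=; congr epi; ring. Qed.

Lemma chi0 : chi 0 = 1.
Proof. by rewrite /chi mulr0 mul0r epi0. Qed.

Lemma chi_mulN m : chi (m * N%:Z) = 1.
Proof.
rewrite /chi -[RHS](epi2_int R m); congr epi.
by rewrite rmorphM /= -pmulrn; field.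
Qed.

Lemma chi_period m n : chi (m + n * N%:Z) = chi m.
Proof. by rewrite chiD chi_mulN mulr1. Qed.

Lemma chiX m n : chi m ^+ n = chi (m * n%:Z).
Proof. by rewrite /chi epi_pow; congr epi; rewrite rmorphM /= -pmulrn; ring. Qed.

Lemma sum_chi (g : 'I_N) : \sum_(k < N) chi (k%:Z * g%:Z) = Nc *+ (g == 0%N :> nat).
Proof.
have E : \sum_(k < N) chi (k%:Z * g%:Z) = \sum_(k < N) chi g%:Z ^+ k.
  by apply: eq_bigr => k _; rewrite chiX mulrC.
rewrite E; have [g0|g0] := posnP g.
  rewrite g0 chi0; under eq_bigr do rewrite expr1n.
  by rewrite sumr_const card_ord.
rewrite sum_root_eq0 //.
  by rewrite chiX chi_mulN.
by rewrite /chi -pmulrn; apply: epi_frac_neq1; rewrite g0 ltn_ord.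
Qed.

Lemma sum_chi_opp (g : 'I_N) : \sum_(k < N) chi (- (k%:Z * g%:Z)) = Nc *+ (g == 0%N :> nat).
Proof.
rewrite -sum_chi -[RHS](@sum_period_opp _ _ (fun k => chi (k * g%:Z))); last first.
  by move=> k; rewrite mulrDl [N%:Z * _]mulrC chi_period.
by apply: eq_bigr => i _; rewrite mulNr.
Qed.

Lemma sum2_chi (g h : 'I_N) :
  sum2 N (fun a b => chi (a * h%:Z - b * g%:Z)) =
  Nc ^+ 2 *+ ((g == 0%N :> nat) && (h == 0%N :> nat)).
Proof.
rewrite /sum2; under eq_bigr do [under eq_bigr do rewrite chiD; rewrite -mulr_sumr].
rewrite -mulr_suml sum_chi sum_chi_opp.
by case: (_ == _); case: (_ == _); rewrite ?mulr0n ?mulr1n ?(mul0r, mulr0).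
Qed.

(** The coefficients N W_alpha as functions of v = xi / N and y = zeta / N. *)
Definition w (a b : int) v y : C :=
  epi (2 * a%:~R * v) * sig (Nc * v + y + om a b) / sig (y + om a b).

Lemma w_periodic v y : sig (Nc * y) != 0 -> periodic2 N (fun a b => w a b v y).
Proof.
move=> y0 a b; have s0 := sigma_om_neq0 a b y0; rewrite /w; split.
  have -> : om (a + N%:Z) b = om a b + (1%:~R * tau + 0%:~R).
    by rewrite /om rmorphD /= -pmulrn; field.
  rewrite ![_ + (om a b + _)]addrA !sigma_lattice //.
  rewrite invfM; set A := epi _; set B := epi _; set D := epi _.
  have E : A * B / D = epi (2 * a%:~R * v).
    rewrite /A /B /D -epiD -epiB; congr epi.
    by rewrite rmorphD /= -pmulrn /om; field.
  rewrite -E; field; rewrite s0 epi_neq0 //.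
have -> : om a (b + N%:Z) = om a b + 1%:~R.
  by rewrite /om rmorphD /= -pmulrn; field.
rewrite ![_ + (om a b + _)]addrA !sigma_int //.
by field; rewrite s0 epi_neq0.
Qed.

Lemma w_opp a b v y : w (- a) (- b) (- v) (- y) = w a b v y.
Proof.
have omN : om (- a) (- b) = - om a b by rewrite /om !mulrNz; ring.
have E1 : Nc * - v + - y + om (- a) (- b) = - (Nc * v + y + om a b) by rewrite omN; ring.
have E2 : - y + om (- a) (- b) = - (y + om a b) by rewrite omN; ring.
have E3 : 2 * (- a)%:~R * - v = 2 * a%:~R * v by rewrite mulrNz; ring.
by rewrite /w E1 E2 E3 !sigmaN // invrN; ring.
Qed.

(** ** Duality between v and y *)

(** In the variable Y = e^(2 i pi y), translations by N-torsion points are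
    generated by the multiplications by r = p^(1/N) and by e^(2 i pi / N).  They permute the numbers
    cc a cyclically, except for a factor p when the first index wraps around; eps is
    the multiplier that this produces. *)
Let r := epi (2 * tau / Nc).
Let cc (a : 'I_N * 'I_N) : C := epi (2 * om a.1%:Z a.2%:Z).
Let s1 (a : 'I_N * 'I_N) := (ordS a.1, a.2).
Let s2 (a : 'I_N * 'I_N) := (a.1, ordS a.2).

Let s1_bij : bijective s1.
Proof.
by exists (fun a => (ord_pred a.1, a.2)) => -[a b]; rewrite /s1 /= ?ordSK ?ord_predK.
Qed.

Let s2_bij : bijective s2.
Proof.
by exists (fun a => (a.1, ord_pred a.2)) => -[a b]; rewrite /s2 /= ?ordSK ?ord_predK.
Qed.

Let ordS_val (i : 'I_N) : (ordS i : nat) = if i.+1 == N then 0%N else i.+1.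
Proof.
rewrite /=; case: eqP => [->|H]; first by rewrite modnn.
by rewrite modn_small // ltn_neqAle ltn_ord andbT; apply/eqP.
Qed.

Let cc_s2 a : epi (2 / Nc) * cc a = cc (s2 a).
Proof.
rewrite /cc -epiD [(s2 a).1]/(a.1) [(s2 a).2]/(ordS a.2) ordS_val; case: eqP => [E|_].
  have -> : 2 / Nc + 2 * om a.1 a.2 = 2 * om a.1 0 + 2 * 1%:~R.
    have -> : (a.2 : nat) = N.-1 by lia.
    have EN : Nc = N.-1%:R + 1 by rewrite natr1 prednK //; lia.
    rewrite /om -!pmulrn; have := N0; rewrite EN; move: (N.-1%:R : C) => x x0; field; exact: x0.
  by rewrite epiD epi2_int mulr1.
by congr epi; rewrite /om -!pmulrn -[a.2.+1%:R]natr1; field.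
Qed.

Let cc_s1 a : r * cc a = (if a.1.+1 == N then p else 1) * cc (s1 a).
Proof.
rewrite /cc /r -epiD [(s1 a).2]/(a.2) [(s1 a).1]/(ordS a.1) ordS_val; case: eqP => [E|_].
  rewrite /p -epiD; congr epi.
  have -> : (a.1 : nat) = N.-1 by lia.
  have EN : Nc = N.-1%:R + 1 by rewrite natr1 prednK //; lia.
  rewrite /om -!pmulrn; have := N0; rewrite EN; move: (N.-1%:R : C) => x x0; field; exact: x0.
by rewrite mul1r; congr epi; rewrite /om -!pmulrn -[a.1.+1%:R]natr1; field.
Qed.

Let eps (a : 'I_N * 'I_N) (Y : C) := if a.1.+1 == N then - (Y * cc (s1 a))^-1 else 1.

Let S_s1 a Y : Y != 0 -> S (r * Y * cc a) = eps a Y * S (Y * cc (s1 a)).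
Proof.
move=> Y0; have -> : r * Y * cc a = (if a.1.+1 == N then p else 1) * (Y * cc (s1 a)).
  by rewrite mulrCA -cc_s1; ring.
rewrite /eps; case: ifP => _; last by rewrite !mul1r.
by rewrite /S thetap_shift // mulf_neq0 ?epi_neq0.
Qed.

Let Q (Y : C) : C := \prod_(a : 'I_N * 'I_N) S (Y * cc a).
(** Q is a common denominator of the w a b v y, and F is the numerator of their sum, up
    to a factor independent of Y. *)
Let F (v Y : C) : C := \sum_(a : 'I_N * 'I_N) epi (2 * v) ^+ (a.1) * S (epi (2 * (Nc * v)) * Y * cc a) *
   \prod_(b | b != a) S (Y * cc b).

Let prod_eps Y : Y != 0 -> \prod_a eps a Y = - (Y ^+ N)^-1.
Proof.
move=> Y0; have N1 : (N.-1 < N)%N by case: N hN.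
rewrite -(pair_bigA _ (fun i j => eps (i, j) Y)) /= (bigD1 (Ordinal N1)) //= [X in _ * X]big1 ?mulr1; last first.
  move=> i iN; rewrite big1 // => j _; rewrite /eps /= ifF //.
  apply: contraNF iN => /eqP iN; apply/eqP/val_inj => /=; lia.
rewrite (eq_bigr (fun j : 'I_N => Y^-1 * epi (1 - 2 * j%:R / Nc))); last first.
  move=> j _; rewrite /eps /= ifT; last by apply/eqP; lia.
  rewrite /cc /=; have -> : (N.-1.+1 %% N = 0)%N by rewrite prednK ?modnn //; lia.
  rewrite invfM epiB epi1 /om mul0r add0r -pmulrn mulrA; ring.
rewrite big_split /= prodr_const card_ord exprVn -[RHS]mulrN1; congr (_ * _).
have -> : \prod_(j < N) epi (1 - 2 * j%:R / Nc) = epi (\sum_(j < N) (1 - 2 * j%:R / Nc)).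
  by rewrite (big_morph _ (@epiD R) (@epi0 R)).
rewrite -[RHS](epi1 R); congr epi.
have E n : \sum_(j < n) (1 - 2 * j%:R / Nc) = n%:R - n%:R * (n%:R - 1) / Nc.
  elim: n => [|n IH]; first by rewrite big_ord0; ring.
  by rewrite big_ord_recr /= IH -[n.+1%:R]natr1; field.
by rewrite E; field.
Qed.

Let Q_s1 Y : Y != 0 -> Q (r * Y) = - 1 * (Q Y / Y ^+ N).
Proof.
move=> Y0; rewrite /Q (eq_bigr _ (fun a _ => S_s1 a Y0)) big_split /= prod_eps //.
rewrite [in RHS](reindex s1) /=; last exact: onW_bij.
by ring.
Qed.

Let S_s2 a Y : S (epi (2 / Nc) * Y * cc a) = S (Y * cc (s2 a)).
Proof. by rewrite -cc_s2; congr S; ring. Qed.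

Let Q_s2 Y : Q (epi (2 / Nc) * Y) = Q Y.
Proof.
rewrite /Q (eq_bigr _ (fun a _ => S_s2 a Y)).
by rewrite [RHS](reindex s2) //; exact: onW_bij.
Qed.

Let F_s2 v Y : F v (epi (2 / Nc) * Y) = F v Y.
Proof.
rewrite /F [RHS](reindex s2) /=; last exact: onW_bij.
apply: eq_bigr => a _; rewrite [epi _ * (epi _ * Y)]mulrCA S_s2; congr (_ * _).
rewrite [RHS](reindex s2) /=; last exact: onW_bij.
apply: eq_big => [b|b _]; last by rewrite S_s2.
by rewrite (bij_eq s2_bij).
Qed.

Let F_s1 v Y : Y != 0 -> F v (r * Y) = - epi (- (2 * v)) * (F v Y / Y ^+ N).
Proof.
move=> Y0; set X := epi (2 * (Nc * v)); have X0 : X != 0 := epi_neq0 _.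
set V := epi (2 * v); have V0 : V != 0 := epi_neq0 _.
have XV : X = V ^+ N by rewrite /X /V epi_pow; congr epi; ring.
have -> : - epi (- (2 * v)) * (F v Y / Y ^+ N) = V^-1 * (\prod_a eps a Y) * F v Y.
  by rewrite prod_eps // epiN -/V; ring.
have -> : F v Y = \sum_a V ^+ (ordS a.1) * S (X * Y * cc (s1 a)) * \prod_(b | b != a) S (Y * cc (s1 b)).
  rewrite /F [LHS](reindex s1) /=; last exact: onW_bij.
  apply: eq_bigr => a _; congr (_ * _).
  rewrite [LHS](reindex s1) /=; last exact: onW_bij.
  by apply: eq_bigl => b; rewrite (bij_eq s1_bij).
rewrite mulr_sumr; apply: eq_bigr => a _; rewrite -/V -/X.
have -> : X * (r * Y) * cc a = r * (X * Y) * cc a by ring.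
rewrite S_s1 ?mulf_neq0 //.
rewrite (eq_bigr _ (fun b _ => S_s1 b Y0)) big_split /=.
rewrite (bigD1 a (P := predT)) //=.
have E : V ^+ a.1 * eps a (X * Y) = V^-1 * eps a Y * V ^+ (ordS a.1).
  rewrite ordS_val /eps; case: eqP => [aN|_].
    have XE : X = V * V ^+ a.1 by rewrite XV -exprS aN.
    by rewrite expr0 mulr1 XE; field; rewrite V0 expf_neq0 // Y0 epi_neq0.
  by rewrite exprS mulr1 mulr1 mulrA mulVf // mul1r.
rewrite /= in E; set U := \prod_(i | i != a) eps i Y; set T := \prod_(i | _) _.
transitivity ((V ^+ a.1 * eps a (X * Y)) * S (X * Y * cc (s1 a)) * (U * T)); first by ring.
by rewrite E; ring.
Qed.

Let S_laurent c : c != 0 -> laurent (fun Y => S (c * Y)).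
Proof. by move=> c0; apply: eq_laurent (thetap_laurent 1 p1 c0) => z _; rewrite expr1. Qed.

Let Q_laurent c : c != 0 -> laurent (fun Y => Q (c * Y)).
Proof.
move=> c0; apply: laurent_prod => a.
apply: eq_laurent (S_laurent (mulf_neq0 c0 (epi_neq0 (2 * om a.1%:Z a.2%:Z)))) => z _.
by congr S; rewrite /cc; ring.
Qed.

Let F_laurent v : laurent (F v).
Proof.
apply: laurent_sum => a; apply: laurentM.
  apply: laurentZ.
  apply: eq_laurent (S_laurent (mulf_neq0 (epi_neq0 (2 * (Nc * v))) (epi_neq0 (2 * om a.1%:Z a.2%:Z)))) => z _.
  by congr S; rewrite /cc; ring.
apply: laurent_prod => b.
apply: eq_laurent (S_laurent (epi_neq0 (2 * om b.1%:Z b.2%:Z))) => z _.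
by congr S; rewrite /cc; ring.
Qed.

Let r0 : r != 0 := epi_neq0 _.

(** Functions with a given multiplier under multiplication by r, of degree N, that
    are also invariant under the N-th roots of unity form a line. *)
Let uniq_line (c : C) f g Y1 : c != 0 -> laurent f -> laurent g ->
  (forall Y, Y != 0 -> f (r * Y) = c * (f Y / Y ^+ N)) ->
  (forall Y, Y != 0 -> g (r * Y) = c * (g Y / Y ^+ N)) ->
  (forall Y, f (epi (2 / Nc) * Y) = f Y) -> (forall Y, g (epi (2 / Nc) * Y) = g Y) ->
  Y1 != 0 -> g Y1 != 0 -> exists k, forall Y, Y != 0 -> f Y = k * g Y.
Proof.
move=> c0 Lf Lg rf rg wf wg Y10 gY1.
have [a Ha] := laurent_coefs Lf; have [b Hb] := laurent_coefs Lg.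
have w0 : epi (2 / Nc) != 0 := epi_neq0 _.
have ra := coefs_rec r0 Lf Ha rf; have rb := coefs_rec r0 Lg Hb rg.
have inv h d : laurent h -> coefs h d -> (forall Y, h (epi (2 / Nc) * Y) = h Y) ->
    forall i, (0 < i < N)%N -> d i%:Z = 0.
  move=> Lh Hd wh i iN; have := coefs_rec (c := 1) (N := 0) w0 Lh Hd.
  have wh' z : z != 0 -> h (epi (2 / Nc) * z) = 1 * (h z / z ^+ 0).
    by rewrite wh expr0 divr1 mul1r.
  move=> /(_ wh' i%:Z); rewrite mul1r addr0 => /eqP.
  rewrite -subr_eq0 -[X in _ - X]mul1r -mulrBl mulf_eq0 subr_eq0 => /orP[|/eqP//].
  rewrite epi_exprz -pmulrn; have -> : i%:R * (2 / Nc) = 2 * i%:R / Nc by ring.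
  by rewrite (negPf (epi_frac_neq1 R iN)).
have ia := inv _ _ Lf Ha wf; have ib := inv _ _ Lg Hb wg.
have b0 : b 0 != 0.
  apply/eqP => b00; have bz : forall k, b k = 0.
    apply: (rec_eq0 r0 c0 _ rb) => [|[//|i] iN]; first by case: N hN.
    by apply: ib.
  have /eqP := gY1; apply; apply: (coefs0_eq0 Lg) => //.
  by have -> : (fun=> 0) = b by apply/funext => k; rewrite bz.
pose k := - (a 0 / b 0); exists (- k) => Y Y0.
have LL := laurentD Lf (laurentZ k Lg).
have HL := coefsD (laurentZ k Lg) Ha (coefsZ (c := k) Lg Hb).
have z0 : forall m, a m + k * b m = 0.
  have rr m : r ^ m * (a m + k * b m) = c * (a (m + N%:Z) + k * b (m + N%:Z)).
    by rewrite !mulrDr ra [r ^ m * _]mulrCA rb; ring.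
  apply: (rec_eq0 r0 c0 _ rr) => [|[|i] iN]; first by case: N hN.
    by rewrite /k mulNr divfK // addrN.
  by rewrite ia ?ib //= mulr0 addr0.
have := coefs0_eq0 LL; have -> : (fun=> 0) = (fun k0 => a k0 + k * b k0) :> (int -> C).
  by apply/funext => m; rewrite z0.
by move=> /(_ HL Y Y0) /eqP; rewrite addr_eq0 => /eqP ->; ring.
Qed.

Let Q_neq0 y : sig (Nc * y) != 0 -> Q (epi (2 * y)) != 0.
Proof.
move=> y0; apply/prodf_neq0 => a _; have := sigma_om_neq0 a.1%:Z a.2%:Z y0.
by rewrite /sigma mulf_eq0 negb_or mulrDr epiD => /andP[_].
Qed.

(** The product over the N-torsion points is the theta function at the N-th
    multiple. *)
Let Q_power : exists C1, forall Y, Y != 0 -> Q Y = C1 * S (Y ^+ N).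
Proof.
have Lq : laurent Q by apply: eq_laurent (Q_laurent (oner_neq0 _)) => z _; rewrite mul1r.
have Ls : laurent (fun Y => S (Y ^+ N)).
  by apply: eq_laurent (thetap_laurent N p1 (oner_neq0 _)) => z _; rewrite mul1r.
have N1 : (-1 : C) != 0 by rewrite oppr_eq0 oner_eq0.
have [Y1 [Y10 SY1]] : exists Y1 : C, Y1 != 0 /\ S (Y1 ^+ N) != 0.
  exists (epi (1 / Nc)); split; first exact: epi_neq0.
  rewrite epi_pow mulrCA divff // mulr1 epi1 thetap_neq0 // => k; apply/eqP => pk.
  have nX (m : int) : nrm (p ^ m) = nrm p ^ m.
    by case: m => m; rewrite ?NegzE -?exprnN ?nrmV nrmX.
  have := congr1 (@nrm R) pk; rewrite nrmN nrm1 nX => /esym/eqP.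
  rewrite pexprz_eq1 ?nrm_ge0 // => /orP[/eqP k0|/eqP]; last by have := p1 => /[swap] ->; rewrite ltxx.
  move: pk; rewrite k0 expr0z => /eqP; rewrite eq_sym -subr_eq0 opprK -[1 + 1]/(2%:R) pnatr_eq0.
  by [].
have rs Y : Y != 0 -> S ((r * Y) ^+ N) = -1 * (S (Y ^+ N) / Y ^+ N).
  move=> Y0; rewrite exprMn.
  have -> : r ^+ N = p by rewrite /r /p epi_pow mulrCA divff // mulr1.
  by rewrite /S thetap_shift ?expf_neq0 //; ring.
have ws Y : S ((epi (2 / Nc) * Y) ^+ N) = S (Y ^+ N).
  by rewrite exprMn epi_pow mulrCA divff // mulr1 epi2 mul1r.
exact: (@uniq_line (-1) Q (fun Y => S (Y ^+ N)) Y1 N1 Lq Ls Q_s1 rs Q_s2 ws Y10 SY1).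
Qed.

(** The case b = 0 of the duality below.  Numerator and denominator of the sum lie on
    lines of functions of Y, and the constant is found at Y = 1, where a single
    term of the numerator survives. *)
Let duality0 : exists K, forall v y, sig (Nc * y) != 0 -> sig v != 0 ->
  sum2 N (fun a b => w a b v y) = K * (sig (Nc * v) * sig (v + Nc * y)) / (sig v * sig (Nc * y)).
Proof.
have [C1 HC1] := Q_power.
have o0 : (0 < N)%N by case: N hN.
pose z0 : 'I_N * 'I_N := (Ordinal o0, Ordinal o0).
have cc0 : cc z0 = 1 by rewrite /cc /om /= mul0r addr0 mul0r mulr0 epi0.
pose Pi := \prod_(b | b != z0) S (cc b).
exists (Pi / C1) => v y y0 v0.
set Y := epi (2 * y); have Y0 : Y != 0 := epi_neq0 _.
have QY : Q Y != 0 := Q_neq0 y0.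
have C10 : C1 != 0 by apply: contraNneq QY => C10; rewrite HC1 // C10 mul0r.
set V := epi (2 * v); have V0 : V != 0 := epi_neq0 _.
have SV : S V != 0 by move: v0; rewrite /sigma mulf_eq0 negb_or => /andP[_].
pose u := epi (2 * v / Nc); have u0 : u != 0 := epi_neq0 _.
have uN : u ^+ N = V by rewrite /u epi_pow mulrCA divff // mulr1.
have nV0 : - epi (- (2 * v)) != 0 by rewrite oppr_eq0 epi_neq0.
have Qu1 : Q (u * 1) != 0 by rewrite mulr1 HC1 // uN mulf_neq0.
have rq Y' : Y' != 0 -> Q (u * (r * Y')) = - epi (- (2 * v)) * (Q (u * Y') / Y' ^+ N).
  move=> Y'0; have -> : u * (r * Y') = r * (u * Y') by ring.
  by rewrite Q_s1 ?mulf_neq0 // exprMn uN epiN -/V invfM; ring.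
have wq Y' : Q (u * (epi (2 / Nc) * Y')) = Q (u * Y') by rewrite mulrCA Q_s2.
have [k Hk] := @uniq_line _ (F v) (fun Y => Q (u * Y)) 1 nV0 (F_laurent v) (Q_laurent u0)
  (@F_s1 v) rq (F_s2 v) wq (oner_neq0 _) Qu1.
have F1 : F v 1 = S (epi (2 * (Nc * v))) * Pi.
  rewrite /F (bigD1 z0) //= [X in _ + X]big1 ?addr0; last first.
    move=> a a0; rewrite (bigD1 z0) /=; last by rewrite eq_sym.
    by rewrite mul1r cc0 /S thetap1 // mul0r mulr0.
  rewrite expr0 mul1r mulr1 cc0 mulr1; congr (_ * _).
  by apply: eq_bigr => b _; rewrite mul1r.
have kE : k = S (epi (2 * (Nc * v))) * Pi / (C1 * S V).
  have := Hk 1 (oner_neq0 _); rewrite F1 mulr1 HC1 // uN => ->.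
  by field; rewrite C10 SV.
have SYN : S (Y ^+ N) != 0 by apply: contraNneq QY => E; rewrite HC1 // E mulr0.
have EF : F v Y / Q Y = S (epi (2 * (Nc * v))) * Pi / C1 * S (V * Y ^+ N) / (S V * S (Y ^+ N)).
  rewrite (Hk Y Y0) kE !HC1 ?mulf_neq0 // exprMn uN.
  by field; rewrite C10 SV SYN.
have <- : epi (- (Nc * v)) * (F v Y / Q Y) = sum2 N (fun a b => w a b v y).
  rewrite /sum2 pair_big /= /F mulr_suml mulr_sumr; apply: eq_bigr => a _.
  have Sa : S (Y * cc a) != 0 by move/prodf_neq0: QY => /(_ a isT).
  rewrite {1}/Q (bigD1 a (P := predT)) //=.
  have Pa : \prod_(b | b != a) S (Y * cc b) != 0.
    by apply/prodf_neq0 => b _; move/prodf_neq0: QY => /(_ b isT).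
  rewrite /w /sigma.
  have -> : epi (2 * (Nc * v + y + om a.1 a.2)) = epi (2 * (Nc * v)) * Y * cc a.
    by rewrite /Y /cc -!epiD; congr epi; ring.
  have -> : epi (2 * (y + om a.1 a.2)) = Y * cc a by rewrite /Y /cc -!epiD; congr epi; ring.
  have -> : epi (2 * a.1%:Z%:~R * v) = V ^+ a.1.
    by rewrite /V epi_pow; congr epi; rewrite -pmulrn; ring.
  have -> : epi (- (Nc * v + y + om a.1 a.2)) = epi (- (Nc * v)) * epi (- (y + om a.1 a.2)).
    by rewrite -epiD; congr epi; ring.
  by rewrite -/S; field; rewrite Sa Pa epi_neq0.
rewrite EF /sigma -/S.
have -> : epi (2 * (v + Nc * y)) = V * Y ^+ N.
  by rewrite /V /Y epi_pow -epiD; congr epi; ring.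
have -> : epi (2 * (Nc * y)) = Y ^+ N.
  by rewrite /Y epi_pow; congr epi; ring.
have -> : epi (- (v + Nc * y)) = epi (- v) * epi (- (Nc * y)) by rewrite -epiD; congr epi; ring.
by rewrite -/V; field; rewrite !epi_neq0 C10 SV SYN.
Qed.

Lemma om_add a b c d : om (a + c) (b + d) = om a b + om c d.
Proof. by rewrite /om !rmorphD /=; ring. Qed.

Lemma omN a b : om (- a) (- b) = - om a b.
Proof. by rewrite /om !mulrNz; ring. Qed.

Lemma om00 : om 0 0 = 0.
Proof. by rewrite /om mul0r addr0 mul0r. Qed.

(** The zeros of sigma differ by lattice points, and the real ones among these are
    integers. *)
Lemma sigma_zero_sep x (j M : nat) : (0 < j < M)%N -> sig x = 0 -> sig (x + j%:R / M%:R) != 0.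
Proof.
move=> jM /sigma_eq0P[k Ek]; apply/eqP => /sigma_eq0P[l El].
have E : epi (2 * j%:R / M%:R) = p ^ (l - k).
  have -> : 2 * j%:R / M%:R = 2 * (x + j%:R / M%:R) - 2 * x :> C by ring.
  rewrite epiB El Ek -epiB /p epi_exprz; congr epi; rewrite rmorphB /=; ring.
have nX (m : int) : nrm (p ^ m) = nrm p ^ m.
  by case: m => m; rewrite ?NegzE -?exprnN ?nrmV nrmX.
have := congr1 (@nrm R) E; have -> : 2 * j%:R / M%:R = (2 * j%:R / M%:R)%:C :> C.
  by rewrite !rmorphM fmorphV !rmorph_nat.
rewrite nrm_epi_real nX => /esym/eqP; rewrite pexprz_eq1 ?nrm_ge0 // => /orP[/eqP lk|/eqP h].
  by move: E; rewrite lk expr0z => /eqP; rewrite (negPf (epi_frac_neq1 R jM)).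
by have := p1; rewrite h ltxx.
Qed.

(** Inversion of the Fourier transform on the N-torsion subgroup, in the form
    given by the Weil pairing. *)
Lemma fourier_inv h (g1 g2 : int) : periodic2 N h ->
  sum2 N (fun b1 b2 => chi (b1 * g2 - b2 * g1) *
    sum2 N (fun a1 a2 => chi (a1 * b2 - a2 * b1) * h a1 a2)) = Nc ^+ 2 * h g1 g2.
Proof.
move=> ph; under eq_sum2 do rewrite sum2_mulr.
rewrite sum2_exchange.
pose f (d1 d2 : int) := sum2 N (fun b1 b2 => chi (d1 * b2 - d2 * b1)).
have fE (a1 a2 : int) : sum2 N (fun b1 b2 => chi (b1 * g2 - b2 * g1) * (chi (a1 * b2 - a2 * b1) * h a1 a2))
    = f (a1 - g1) (a2 - g2) * h a1 a2.
  rewrite sum2_mull; apply: eq_sum2 => b1 b2; rewrite mulrA -chiD; congr (chi _ * _); ring.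
rewrite (eq_sum2 _ fE).
have fp : periodic2 N f.
  move=> a b; split; apply: eq_sum2 => c d.
    by rewrite -[RHS](chi_period _ d); congr chi; ring.
  by rewrite -[RHS](chi_period _ (- c)); congr chi; ring.
rewrite -(sum2_shift (h := fun a1 a2 => f (a1 - g1) (a2 - g2) * h a1 a2) g1 g2); last first.
  move=> a b; have [h1 h2] := ph a b; split.
    have -> : a + N%:Z - g1 = a - g1 + N%:Z by ring.
    by rewrite h1 (fp _ _).1.
  have -> : b + N%:Z - g2 = b - g2 + N%:Z by ring.
  by rewrite h2 (fp _ _).2.
have fv (i j : 'I_N) : f i j = Nc ^+ 2 *+ ((i == 0%N :> nat) && (j == 0%N :> nat)).
  rewrite -sum2_chi -[RHS](@sum2_opp _ _ (fun a b => chi (a * j%:Z - b * i%:Z))).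
    by apply: eq_sum2 => c d; congr chi; ring.
  move=> a b; split.
    by rewrite -[RHS](chi_period _ j); congr chi; ring.
  by rewrite -[RHS](chi_period _ (- i%:Z)); congr chi; ring.
have o0 : (0 < N)%N by case: N hN.
rewrite /sum2 (bigD1 (Ordinal o0)) //= (bigD1 (Ordinal o0)) //=.
rewrite !addrK (fv (Ordinal o0) (Ordinal o0)) /= mulr1n !add0r.
rewrite [X in _ + X + _]big1 ?addr0 => [|j j0]; last first.
  rewrite addrK (fv (Ordinal o0) j) /=; have -> : (j == 0%N :> nat) = false.
    by apply: contraNF j0 => /eqP j0; apply/eqP/val_inj.
  by rewrite mulr0n mul0r.
rewrite big1 ?addr0 // => i i0; rewrite big1 // => j _; rewrite !addrK fv.
have -> : (i == 0%N :> nat) = false.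
  by apply: contraNF i0 => /eqP i0; apply/eqP/val_inj.
by rewrite mulr0n mul0r.
Qed.

(** The coefficients w are, up to a scalar, their own Fourier transforms, with v
    and y exchanged: as functions of y both sides are sections of one line
    bundle of degree 1 on the curve divided by its N-torsion. *)
Lemma duality : exists K, K ^+ 2 = Nc ^+ 2 /\ forall v y, sig (Nc * y) != 0 -> sig (Nc * v) != 0 ->
  forall b1 b2, sum2 N (fun a1 a2 => chi (a1 * b2 - a2 * b1) * w a1 a2 v y) =
    K * (sig (Nc * v) / sig (Nc * y)) * w b1 b2 y v.
Proof.
have [K HK] := duality0.
have D v y : sig (Nc * y) != 0 -> sig (Nc * v) != 0 ->
  forall b1 b2, sum2 N (fun a1 a2 => chi (a1 * b2 - a2 * b1) * w a1 a2 v y) =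
    K * (sig (Nc * v) / sig (Nc * y)) * w b1 b2 y v.
  move=> y0 v0 b1 b2; have vb := sigma_om_neq0 b1 b2 v0.
  have NV : Nc * (v + om b1 b2) = Nc * v + (b1%:~R * tau + b2%:~R) by rewrite /om; field.
  have := HK _ _ y0 vb; rewrite NV sigma_lattice //.
  set e2 := epi _ => H.
  pose e1 := epi (b1%:~R + b2%:~R - 2 * b1%:~R * (Nc * v + y) - b1%:~R ^+ 2 * tau).
  have wE a1 a2 : w a1 a2 (v + om b1 b2) y = e1 * (chi (a1 * b2 - a2 * b1) * w a1 a2 v y).
    rewrite /w NV; have -> : Nc * v + (b1%:~R * tau + b2%:~R) + y + om a1 a2 =
      Nc * v + y + om a1 a2 + (b1%:~R * tau + b2%:~R) by ring.
    rewrite sigma_lattice //; set L := epi (_ - _).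
    have EL : epi (2 * a1%:~R * (v + om b1 b2)) * L = e1 * chi (a1 * b2 - a2 * b1) * epi (2 * a1%:~R * v).
      rewrite /L /e1 /chi -!epiD; congr epi.
      by rewrite /om rmorphB !rmorphM /=; field.
    by rewrite mulrA EL; ring.
  move: H; rewrite (eq_sum2 _ wE) -sum2_mulr => /(canRL (mulKf (epi_neq0 _))) ->.
  have e12 : e2 = e1 * epi (2 * b1%:~R * y) by rewrite /e1 /e2 -epiD; congr epi; ring.
  rewrite e12 /w [v + om _ _ + _]addrAC [v + Nc * y]addrC.
  rewrite -/e1; have e10 : e1 != 0 := epi_neq0 _.
  by move: e1 e10 {wE e12} => e1 e10; field; rewrite y0 vb e10.
(* Applying the identity twice at v = y and inverting the Fourier transform yields
   K ^ 2 = N ^ 2 as soon as one w g1 g2 y y is nonzero. *)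
pose y := (1 / (2 * Nc)) / Nc.
have sy : sig (Nc * y) != 0.
  have -> : Nc * y = 0 + 1%:R / (2 * N)%N%:R by rewrite /y natrM; field.
  by apply: sigma_zero_sep; [lia|exact: sigma0].
exists K; split; last exact: D.
have H (g1 g2 : int) : Nc ^+ 2 * w g1 g2 y y = K ^+ 2 * w g1 g2 y y.
  rewrite -[LHS](fourier_inv g1 g2 (w_periodic y sy)).
  have E b1 b2 : chi (b1 * g2 - b2 * g1) * sum2 N (fun a1 a2 => chi (a1 * b2 - a2 * b1) * w a1 a2 y y)
      = K * (chi (b1 * g2 - b2 * g1) * w b1 b2 y y).
    by rewrite D // divff // mulr1; ring.
  by rewrite (eq_sum2 _ E) -sum2_mulr D // divff // mulr1; ring.
have [w00|w00] := eqVneq (w 0 0 y y) 0; last by apply: (mulIf w00).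
have s00 : sig (Nc * y + y) = 0.
  move/eqP: w00; rewrite /w mulr0 mul0r epi0 mul1r om00 !addr0 mulf_eq0 invr_eq0.
  have := sigma_om_neq0 0 0 sy; rewrite om00 addr0 => /negPf ->; rewrite orbF => /eqP //.
have j1 : (0 < 1 < N)%N by [].
have := sigma_zero_sep j1 s00.
have -> : 1%:R / Nc = om 0 1 by rewrite /om mul0r add0r.
move=> s01; have w01 : w 0 1 y y != 0.
    apply: mulf_neq0; last by rewrite invr_eq0; exact: sigma_om_neq0.
  by apply: mulf_neq0 s01; exact: epi_neq0.
exact: (mulIf w01 (esym (H 0 1))).
Qed.

(** ** The coefficients of V_12(v) V_21(-v) *)

Let dif_w a b v y : sig (Nc * y) != 0 -> dif (w a b v) y.
Proof.
move=> y0; have Da c : dif (fun z => sig (c + z + om a b)) y.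
  have Hi : hasD (fun z => c + z + om a b) y (0 + 1 + 0).
    exact: hasD_add (hasD_add (hasD_cst c y) (hasD_id y)) (hasD_cst _ y).
  have [D HD] := hasD_sigma tau1 (c + y + om a b).
  by eexists; exact: (hasD_comp Hi HD).
have [D1 H1] := Da (Nc * v); have [D2 H2] := Da 0.
have H2' : hasD (fun z => sig (z + om a b)) y D2.
  by apply: eq_hasD H2 => z; rewrite add0r.
have s0 := sigma_om_neq0 a b y0.
have H := hasD_mul (hasD_scale (epi (2 * a%:~R * v)) H1) (@hasD_inv _ (fun z => sig (z + om a b)) _ _ s0 H2').
by eexists; exact: H.
Qed.

(** A function with a multiplier of degree 2 is determined by its values at two
    points, if these values are independent. *)
Let class2_zero (c Z : C) f g k : c != 0 -> Z != 0 -> laurent f -> laurent g -> laurent k ->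
  (forall X, X != 0 -> f (p * X) = c * (f X / X ^+ 2)) ->
  (forall X, X != 0 -> g (p * X) = c * (g X / X ^+ 2)) ->
  (forall X, X != 0 -> k (p * X) = c * (k X / X ^+ 2)) ->
  f 1 = 0 -> f Z = 0 -> g 1 = 0 -> g Z != 0 -> k 1 != 0 -> forall X, X != 0 -> f X = 0.
Proof.
move=> c0 Z0 Lf Lg Lk rf rg rk f1 fZ g1 gZ k1.
have [a Ha] := laurent_coefs Lf; have [b Hb] := laurent_coefs Lg; have [d Hd] := laurent_coefs Lk.
have ra := coefs_rec p0 Lf Ha rf; have rb := coefs_rec p0 Lg Hb rg; have rd := coefs_rec p0 Lk Hd rk.
have rel (l m n : C) : l * a 0 + (m * b 0 + n * d 0) = 0 -> l * a 1 + (m * b 1 + n * d 1) = 0 ->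
    forall X, X != 0 -> l * f X + (m * g X + n * k X) = 0.
  move=> e0 e1.
  have L1 := laurentD (laurentZ m Lg) (laurentZ n Lk); have L2 := laurentD (laurentZ l Lf) L1.
  have H := coefsD L1 (coefsZ (c := l) Lf Ha) (coefsD (laurentZ n Lk) (coefsZ (c := m) Lg Hb) (coefsZ (c := n) Lk Hd)).
  apply: (coefs0_eq0 L2); have -> : (fun=> 0) = (fun i => l * a i + (m * b i + n * d i)) :> (int -> C).
    apply/funext => i; apply/esym; move: i.
    apply: (rec_eq0 p0 c0 (ltn0Sn 1)) => [i|[|[|//]] _] //.
    by rewrite !mulrDr ![p ^ i * (_ * _)]mulrCA ra rb rd; ring.
  exact: H.
have N1 := oner_neq0 C.
have := rel (b 0 * d 1 - b 1 * d 0) (d 0 * a 1 - d 1 * a 0) (a 0 * b 1 - a 1 * b 0).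
move=> /(_ _ _) H; have {H} : forall X, X != 0 -> (b 0 * d 1 - b 1 * d 0) * f X +
   ((d 0 * a 1 - d 1 * a 0) * g X + (a 0 * b 1 - a 1 * b 0) * k X) = 0 by apply: H; ring.
set l := b 0 * d 1 - b 1 * d 0; set m := d 0 * a 1 - d 1 * a 0; set n := a 0 * b 1 - a 1 * b 0 => H.
have n0 : n = 0.
  by have := H 1 N1; rewrite f1 g1 !mulr0 !add0r => /eqP; rewrite mulf_eq0 (negPf k1) orbF => /eqP.
have m0 : m = 0.
  by have := H Z Z0; rewrite fZ n0 mulr0 mul0r add0r addr0 => /eqP; rewrite mulf_eq0 (negPf gZ) orbF => /eqP.
have [l0|l0] := eqVneq l 0; last first.
  move=> X X0; have := H X X0; rewrite n0 m0 !mul0r !addr0 => /eqP.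
  by rewrite mulf_eq0 (negPf l0) => /eqP.
exfalso; have l0' : b 0 * d 1 = b 1 * d 0 by apply/eqP; rewrite -subr_eq0 -/l l0.
have b0z : b 0 = 0.
  have h : 0 * f 1 + (d 0 * g 1 + - b 0 * k 1) = 0.
    by apply: (rel 0 (d 0) (- b 0) _ _ 1 N1); rewrite ?mulNr ?l0'; ring.
  move: h; rewrite g1 mul0r mulr0 !add0r => /eqP.
  by rewrite mulf_eq0 (negPf k1) orbF oppr_eq0 => /eqP.
have b1z : b 1 = 0.
  have h : 0 * f 1 + (d 1 * g 1 + - b 1 * k 1) = 0.
    by apply: (rel 0 (d 1) (- b 1) _ _ 1 N1); rewrite ?mulNr -?l0'; ring.
  move: h; rewrite g1 mul0r mulr0 !add0r => /eqP.
  by rewrite mulf_eq0 (negPf k1) orbF oppr_eq0 => /eqP.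
have h : 0 * f Z + (1 * g Z + 0 * k Z) = 0.
  by apply: (rel 0 1 0 _ _ Z Z0); rewrite ?b0z ?b1z; ring.
by move/eqP: gZ; apply; rewrite -h; ring.
Qed.

Let S_class A X : X != 0 -> A != 0 -> S (p * X * A) = - (X * A)^-1 * S (X * A).
Proof. by move=> X0 A0; rewrite -mulrA /S thetap_shift // mulf_neq0. Qed.

Let SS_laurent A B : A != 0 -> B != 0 -> laurent (fun X => S (X * A) * S (X * B)).
Proof.
move=> A0 B0; apply: laurentM.
  by apply: eq_laurent (S_laurent A0) => z _; rewrite mulrC.
by apply: eq_laurent (S_laurent B0) => z _; rewrite mulrC.
Qed.

Let SS_class A B c X : A != 0 -> B != 0 -> (A * B)^-1 = c -> X != 0 ->
  S (p * X * A) * S (p * X * B) = c * (S (X * A) * S (X * B) / X ^+ 2).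
Proof.
move=> A0 B0 <- X0; rewrite !S_class //; field; by rewrite X0 A0 B0.
Qed.

(** The coefficient of I_g (x) I_g^-1, g = (g1, g2), in the product of the sum in
    R_12(xi) by the one in R_21(- xi), up to normalization. *)
Let unit_sum v y (g1 g2 : int) :=
  sum2 N (fun a b => chi (a * g2 - b * g1) * (w a b v y * w (a - g1) (b - g2) (- v) y)).

(** At v = 0 the coefficients w are all 1, i.e. R is the flip. *)
Let unit_at0 y (g1 g2 : 'I_N) : sig (Nc * y) != 0 ->
  unit_sum 0 y g1 g2 = Nc ^+ 2 *+ ((g1 == 0%N :> nat) && (g2 == 0%N :> nat)).
Proof.
move=> y0; rewrite -sum2_chi; apply: eq_sum2 => a b.
have w0 c d : w c d 0 y = 1.
  by rewrite /w !mulr0 epi0 mul1r add0r divff // sigma_om_neq0.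
by rewrite oppr0 !w0 !mulr1.
Qed.

(** At v = y duality exchanges the two families of coefficients with themselves,
    with constants K and - K: the sum is equal to its opposite. *)
Let unit_aty y (g1 g2 : int) : sig (Nc * y) != 0 -> unit_sum y y g1 g2 = 0.
Proof.
move=> y0; have [K [K2 HK]] := duality.
have K0 : K != 0.
  by apply: contraTneq (expf_neq0 2 N0) => K0; rewrite -K2 K0 expr0n eqxx.
have my0 : sig (Nc * - y) != 0 by rewrite mulrN sigmaN // oppr_eq0.
have Dm b1 b2 : w (- b1) (- b2) (- y) y =
    - K^-1 * sum2 N (fun d1 d2 => chi (d1 * b2 - d2 * b1) * w d1 d2 (- y) y).
  have e1 : sig (Nc * - y) / sig (Nc * y) = -1 by rewrite mulrN sigmaN // mulNr divff.
  by rewrite (HK (- y) y y0 my0 b1 b2) e1 -[w b1 b2 y (- y)]w_opp opprK; field.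
have E : unit_sum y y g1 g2 = - unit_sum y y g1 g2.
  rewrite {1}/unit_sum.
  have E1 a b : chi (a * g2 - b * g1) * (w a b y y * w (a - g1) (b - g2) (- y) y) =
     sum2 N (fun d1 d2 => - K^-1 * (chi (d1 * g2 - d2 * g1) * w d1 d2 (- y) y) *
       (chi (a * (g2 + d2) - b * (g1 + d1)) * w a b y y)).
    have -> : w (a - g1) (b - g2) (- y) y = w (- (g1 - a)) (- (g2 - b)) (- y) y by rewrite !opprB.
    rewrite Dm !sum2_mulr; apply: eq_sum2 => d1 d2.
    have -> : chi (a * g2 - b * g1) * (w a b y y * (- K^-1 * (chi (d1 * (g2 - b) - d2 * (g1 - a)) * w d1 d2 (- y) y)))
      = - K^-1 * (chi (a * g2 - b * g1) * chi (d1 * (g2 - b) - d2 * (g1 - a))) * w d1 d2 (- y) y * w a b y y by ring.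
    have -> : chi (a * g2 - b * g1) * chi (d1 * (g2 - b) - d2 * (g1 - a)) =
      chi (d1 * g2 - d2 * g1) * chi (a * (g2 + d2) - b * (g1 + d1)) by rewrite -!chiD; congr chi; ring.
    by ring.
  rewrite (eq_sum2 _ E1) sum2_exchange.
  have E2 d1 d2 : sum2 N (fun a b => - K^-1 * (chi (d1 * g2 - d2 * g1) * w d1 d2 (- y) y) *
       (chi (a * (g2 + d2) - b * (g1 + d1)) * w a b y y)) =
     - (chi (d1 * g2 - d2 * g1) * (w (d1 + g1) (d2 + g2) y y * w d1 d2 (- y) y)).
    rewrite -sum2_mulr (HK y y y0 y0) divff // mulr1 [g1 + d1]addrC [g2 + d2]addrC.
    by field.
  rewrite (eq_sum2 _ E2) /unit_sum.
  have sN h : sum2 N (fun a b => - h a b) = - sum2 N h :> C.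
    by rewrite /sum2 -sumrN; apply: eq_bigr => i _; rewrite sumrN.
  rewrite sN; congr (- _).
  rewrite -[RHS](sum2_shift (h := fun a b => chi (a * g2 - b * g1) * (w a b y y * w (a - g1) (b - g2) (- y) y)) g1 g2).
    by apply: eq_sum2 => d1 d2; rewrite !addrK; congr (chi _ * _); ring.
  move=> a b; have [h1 h2] := w_periodic y y0 a b.
  have [h3 h4] := w_periodic (- y) y0 (a - g1) (b - g2).
  have [c1 c2] : chi ((a + N%:Z) * g2 - b * g1) = chi (a * g2 - b * g1) /\
     chi (a * g2 - (b + N%:Z) * g1) = chi (a * g2 - b * g1).
    split; first by rewrite -[RHS](chi_period _ g2); congr chi; ring.
    by rewrite -[RHS](chi_period _ (- g1)); congr chi; ring.
  have e1 : a + N%:Z - g1 = a - g1 + N%:Z by ring.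
  have e2 : b + N%:Z - g2 = b - g2 + N%:Z by ring.
  by rewrite c1 c2 h1 h2 e1 e2 h3 h4.
have : unit_sum y y g1 g2 *+ 2 = 0 by rewrite mulr2n {1}E addNr.
by move/eqP; rewrite mulrn_eq0 /= => /eqP.
Qed.

(** As functions of X = e^(2 i pi N v), both sides have the same multiplier of degree
    2, and agree at v = 0 and v = y.  The assumption on y + g makes the values at these
    two points independent. *)
Let unit_nondegenerate y (g1 g2 : 'I_N) : sig (Nc * y) != 0 -> sig (Nc * y + om g1 g2) != 0 ->
  forall v, unit_sum v y g1 g2 = (Nc ^+ 2 *+ ((g1 == 0%N :> nat) && (g2 == 0%N :> nat))) *
    (sig (Nc * y + Nc * v) * sig (Nc * y - Nc * v) / sig (Nc * y) ^+ 2).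
Proof.
move=> y0 yg.
set dl := Nc ^+ 2 *+ _; pose Z := epi (2 * (Nc * y)); have Z0 : Z != 0 := epi_neq0 _.
pose a_ (a b : int) := y + om a b; pose b_ (a b : int) := y + om (a - g1%:Z) (b - g2%:Z).
have a0 a b : sig (a_ a b) != 0 by apply: sigma_om_neq0.
have b0 a b : sig (b_ a b) != 0 by apply: sigma_om_neq0.
pose c := epi (- (2 * om g1 g2)).
pose t a b X := S (X * epi (2 * a_ a b)) * S (X * epi (- (2 * b_ a b))).
pose tz X := S (X * Z) * S (X * Z^-1).
pose f X := (\sum_(i < N) \sum_(j < N) chi (i%:Z * g2%:Z - j%:Z * g1%:Z) / (sig (a_ i j) * sig (b_ i j)) * t i j X)
   + - (dl / sig (Nc * y) ^+ 2) * tz X.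
pose pre v := - epi (2 * g1%:R * v - 2 * (Nc * v) - om g1 g2).
have dl0 : dl != 0 -> g1%:Z = 0 /\ g2%:Z = 0.
  rewrite /dl; case: (boolP (_ && _)) => [/andP[/eqP z1 /eqP z2] _|_]; first by rewrite z1 z2.
  by rewrite mulr0n eqxx.
have sE x : sig x = epi (- x) * S (epi (2 * x)) by [].
have fE v : pre v * f (epi (2 * (Nc * v))) = unit_sum v y g1 g2 -
    dl * (sig (Nc * y + Nc * v) * sig (Nc * y - Nc * v) / sig (Nc * y) ^+ 2).
  rewrite /f mulrDr; congr (_ + _).
    rewrite mulr_sumr; apply: eq_bigr => i _; rewrite mulr_sumr; apply: eq_bigr => j _.
    rewrite /w -/(a_ i j) -/(b_ i j).
    have -> : Nc * v + y + om i j = Nc * v + a_ i j by rewrite /a_ addrA.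
    have -> : Nc * - v + y + om (i%:Z - g1%:Z) (j%:Z - g2%:Z) = - (Nc * v - b_ i j) by rewrite /b_; ring.
    rewrite sigmaN // (sE (Nc * v + a_ i j)) (sE (Nc * v - b_ i j)) /t -!epiD.
    have -> : 2 * (Nc * v + a_ i j) = 2 * (Nc * v) + 2 * a_ i j by ring.
    have -> : 2 * (Nc * v - b_ i j) = 2 * (Nc * v) - 2 * b_ i j by ring.
    set U := S _; set U' := S _; rewrite /pre.
    have -> : epi (2 * g1%:R * v - 2 * (Nc * v) - om g1 g2) =
      epi (2 * i%:Z%:~R * v) * epi (- (Nc * v + a_ i j)) * (epi (2 * (i%:Z - g1%:Z)%:~R * - v) * epi (- (Nc * v - b_ i j))).
      rewrite -!epiD; congr epi; rewrite /a_ /b_ om_add omN rmorphB /= -!pmulrn; ring.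
    move: (epi (2 * _ * v)) (epi (- (_ + _))) (epi (2 * _ * - v)) (epi (- (_ - _))) => e1 e2 e3 e4.
    by rewrite invfM; move: (chi _) (sig _)^-1 (sig _)^-1 => ch sa sb; ring.
  have [->|/dl0[z1 z2]] := eqVneq dl 0; first by rewrite mul0r oppr0 mul0r mulr0 mul0r oppr0.
  have -> : Nc * y + Nc * v = Nc * v + Nc * y by ring.
  have -> : Nc * y - Nc * v = - (Nc * v - Nc * y) by ring.
  rewrite sigmaN // (sE (Nc * v + Nc * y)) (sE (Nc * v - Nc * y)) /tz /Z -epiN -!epiD.
  have -> : 2 * (Nc * v + Nc * y) = 2 * (Nc * v) + 2 * (Nc * y) by ring.
  have -> : 2 * (Nc * v - Nc * y) = 2 * (Nc * v) - 2 * (Nc * y) by ring.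
  set U := S _; set U' := S _; rewrite /pre.
  have -> : (g1 : nat)%:R = 0 :> C by case: z1 => ->.
  have -> : epi (2 * 0 * v - 2 * (Nc * v) - om g1 g2) = epi (- (Nc * v + Nc * y)) * epi (- (Nc * v - Nc * y)).
    by rewrite -epiD z1 z2 om00; congr epi; ring.
  by field.
have f1 : f 1 = 0.
  have := fE 0; rewrite mulr0 mulr0 epi0 unit_at0 // -/dl addr0 subr0 -expr2 divff ?expf_neq0 //.
  by rewrite mulr1 subrr => /eqP; rewrite mulf_eq0 oppr_eq0 (negPf (epi_neq0 _)) => /eqP.
have fZ : f Z = 0.
  have := fE y; rewrite unit_aty // subrr sigma0 // mulr0 mul0r mulr0 subrr => /eqP.
  by rewrite mulf_eq0 oppr_eq0 (negPf (epi_neq0 _)) => /eqP.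
have Lt a b : laurent (t a b) by apply: SS_laurent; exact: epi_neq0.
have Lf : laurent f.
  apply: laurentD; last by apply: laurentZ; apply: SS_laurent; rewrite ?invr_eq0.
  by apply: laurent_sum => i; apply: laurent_sum => j; apply: laurentZ.
have ct a b X : X != 0 -> t a b (p * X) = c * (t a b X / X ^+ 2).
  move=> X0; apply: SS_class; rewrite ?epi_neq0 //.
  by rewrite -epiD -epiN /c; congr epi; rewrite /a_ /b_ om_add omN; ring.
have rf X : X != 0 -> f (p * X) = c * (f X / X ^+ 2).
  move=> X0; rewrite /f mulrDl mulrDr; congr (_ + _).
    rewrite mulr_suml mulr_sumr; apply: eq_bigr => i _.
    rewrite mulr_suml mulr_sumr; apply: eq_bigr => j _.
    by rewrite ct //; ring.
  have [->|/dl0[z1 z2]] := eqVneq dl 0; first by rewrite !(mul0r, oppr0, mulr0).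
  rewrite /tz (SS_class (c := c)) ?invr_eq0 //; first by ring.
  by rewrite divff // invr1 /c z1 z2 om00 mulr0 oppr0 epi0.
pose g X := S (X * 1) * S (X * epi (2 * om g1 g2)).
have Lg : laurent g by apply: SS_laurent; rewrite ?oner_neq0 ?epi_neq0.
have rg X : X != 0 -> g (p * X) = c * (g X / X ^+ 2).
  move=> X0; apply: SS_class; rewrite ?oner_neq0 ?epi_neq0 //.
  by rewrite mul1r /c epiN.
have g1z : g 1 = 0 by rewrite /g mulr1 /S thetap1 // mul0r.
have gZ : g Z != 0.
  rewrite /g mulr1 -epiD mulf_neq0 //.
    by move: y0; rewrite /sigma mulf_eq0 negb_or => /andP[_].
  by move: yg; rewrite /sigma mulf_eq0 negb_or mulrDr => /andP[_].
have k1 : t 0 0 1 != 0.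
  rewrite /t !mul1r mulf_neq0 //.
    by have := a0 0 0; rewrite /sigma mulf_eq0 negb_or => /andP[_].
  have : sig (- b_ 0 0) != 0 by rewrite sigmaN // oppr_eq0.
  by rewrite /sigma mulf_eq0 negb_or mulrN => /andP[_].
have c0 : c != 0 := epi_neq0 _.
have fz := class2_zero c0 Z0 Lf Lg (Lt 0 0) rf rg (ct 0 0) f1 fZ g1z gZ k1.
move=> v; have := fE v; rewrite fz ?epi_neq0 // mulr0 => /esym/eqP.
by rewrite subr_eq0 => /eqP.
Qed.

(** The coefficients of the unitarity relation; the values of y that the previous lemma
    excludes are reached by continuity. *)
Lemma unit_coef v y (g1 g2 : 'I_N) : sig (Nc * y) != 0 ->
  sum2 N (fun a b => chi (a * g2%:Z - b * g1%:Z) * (w a b v y * w (a - g1%:Z) (b - g2%:Z) (- v) y)) =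
  (Nc ^+ 2 *+ ((g1 == 0%N :> nat) && (g2 == 0%N :> nat))) *
    (sig (Nc * y + Nc * v) * sig (Nc * y - Nc * v) / sig (Nc * y) ^+ 2).
Proof.
move=> y0; have [yg|yg] := eqVneq (sig (Nc * y + om g1 g2)) 0; last first.
  exact: unit_nondegenerate.
(* If the two sides differed at y, they would differ nearby, in particular at some
   y + 1 / (M N), where the previous lemma applies. *)
apply/eqP; rewrite -subr_eq0; apply: contraTT isT => f0.
pose f y' := unit_sum v y' g1 g2 - (Nc ^+ 2 *+ ((g1 == 0%N :> nat) && (g2 == 0%N :> nat))) *
    (sig (Nc * y' + Nc * v) * sig (Nc * y' - Nc * v) / sig (Nc * y') ^+ 2).
have Ds c : dif (fun y' => sig (Nc * y' + c)) y.
  have Hi := hasD_add (hasD_scale Nc (hasD_id y)) (hasD_cst c y).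
  have [D HD] := hasD_sigma tau1 (Nc * y + c).
  by eexists; exact: (hasD_comp Hi HD).
have [D0 H0] : dif (fun y' => sig (Nc * y')) y.
  by have [D H] := Ds 0; exists D; apply: eq_hasD H => z; rewrite addr0.
have [D1 H1] := Ds (Nc * v); have [D2 H2] := Ds (- (Nc * v)).
have [Du Hu] : dif (fun y' => unit_sum v y' g1 g2) y.
  have Dt (i j : 'I_N) : dif (fun y' => chi (i%:Z * g2%:Z - j%:Z * g1%:Z) * (w i j v y' * w (i%:Z - g1%:Z) (j%:Z - g2%:Z) (- v) y')) y.
    have [E1 F1] := dif_w i j v y0; have [E2 F2] := dif_w (i%:Z - g1%:Z) (j%:Z - g2%:Z) (- v) y0.
    by eexists; exact: (hasD_scale _ (hasD_mul F1 F2)).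
  have [D HD] := @boolp.choice _ _ (fun (ij : 'I_N * 'I_N) D => hasD (fun y' => chi (ij.1%:Z * g2%:Z - ij.2%:Z * g1%:Z) * (w ij.1 ij.2 v y' * w (ij.1%:Z - g1%:Z) (ij.2%:Z - g2%:Z) (- v) y')) y D) (fun ij => Dt ij.1 ij.2).
  by eexists; exact: (hasD_sum _ (fun i => hasD_sum _ (fun j => HD (i, j)))).
have y02 : sig (Nc * y) ^+ 2 != 0 by rewrite expf_neq0.
have Hf := hasD_add Hu (hasD_scale (-1) (hasD_scale (Nc ^+ 2 *+ ((g1 == 0%N :> nat) && (g2 == 0%N :> nat)))
  (hasD_mul (hasD_mul H1 H2) (@hasD_inv _ (fun y' => sig (Nc * y') ^+ 2) _ _ y02 (hasD_mul H0 H0))))).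
have {}Hf : exists D, hasD f y D.
  by eexists; apply: eq_hasD Hf => z; rewrite /f mulN1r.
have [D {}Hf] := Hf.
have [d1 d10 Hd1] := hasD_neq0 Hf f0; have [d2 d20 Hd2] := hasD_neq0 H0 y0.
have dd : 0 < Num.min d1 d2 by rewrite lt_min d10.
have [M M1 HM] : exists2 M : nat, (1 < M)%N & (M%:R^-1 : R) < Num.min d1 d2.
  exists (Num.trunc (Num.min d1 d2)^-1).+2 => //.
  have h : (Num.min d1 d2)^-1 < (Num.trunc (Num.min d1 d2)^-1).+2%:R.
    by rewrite (lt_trans (truncnS_gt _)) // ltr_nat.
  by rewrite -[ltRHS]invrK ltf_pV2 // posrE ?invr_gt0 // ltr0n.
have M0 : M%:R != 0 :> C by rewrite pnatr_eq0 -lt0n ltnW.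
pose h : C := 1%:R / M%:R / Nc.
have nh : nrm h < Num.min d1 d2.
  rewrite /h !nrmM !nrmV !nrm_nat mul1r (le_lt_trans _ HM) //.
  by rewrite ler_piMr ?invr_ge0 // invf_le1 ?ltr0n ?ler1n ltnW.
move: nh; rewrite lt_min => /andP[/Hd1 fh /Hd2 sh]; move/eqP: fh; case; rewrite /f.
apply/eqP; rewrite subr_eq0; apply/eqP; apply: unit_nondegenerate => //.
have -> : Nc * (y + h) + om g1 g2 = Nc * y + om g1 g2 + 1%:R / M%:R by rewrite /h; field; rewrite M0.
by apply: sigma_zero_sep.
Qed.

(** ** The coefficients of the partial transposes *)

(** Partial transposition makes the convolution commutative, so that the Fourier
    transform turns it into a product; by duality the product of the two transforms
    is independent of the frequency, and the convolution is a delta function. *)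
Lemma cross_coef v y (g1 g2 : 'I_N) : sig (Nc * y) != 0 -> sig (Nc * v) != 0 ->
  sig (Nc * (v + Nc * y)) != 0 ->
  sum2 N (fun a b => w a b v y * w (a - g1%:Z) (b - g2%:Z) (- v - Nc * y) y) =
  (Nc ^+ 2 *+ ((g1 == 0%N :> nat) && (g2 == 0%N :> nat))) *
    - (sig (Nc * v) * sig (Nc * (v + Nc * y)) / sig (Nc * y) ^+ 2).
Proof.
move=> y0 v0 vy0; have [K [K2 HK]] := duality.
set u := - v - Nc * y; have uE : u = - (v + Nc * y) by rewrite /u opprD.
have u0 : sig (Nc * u) != 0 by rewrite uE mulrN sigmaN // oppr_eq0.
pose h (g1 g2 : int) := sum2 N (fun a b => w a b v y * w (a - g1) (b - g2) u y).
set s := - (sig (Nc * v) * _ / _).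
have ph : periodic2 N h.
  move=> a b; split; apply: eq_sum2 => c d; congr (_ * _).
    have -> : c - a = c - (a + N%:Z) + N%:Z by ring.
    by rewrite (w_periodic u y0 _ _).1.
  have -> : d - b = d - (b + N%:Z) + N%:Z by ring.
  by rewrite (w_periodic u y0 _ _).2.
have Fh b1 b2 : sum2 N (fun c1 c2 => chi (c1 * b2 - c2 * b1) * h c1 c2) = Nc ^+ 2 * s.
  have E1 c1 c2 : chi (c1 * b2 - c2 * b1) * h c1 c2 =
      sum2 N (fun a1 a2 => chi (a1 * b2 - a2 * b1) * w a1 a2 v y *
        (chi ((c1 - a1) * b2 - (c2 - a2) * b1) * w (- (c1 - a1)) (- (c2 - a2)) u y)).
    rewrite sum2_mulr; apply: eq_sum2 => a1 a2; rewrite !opprB.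
    have -> : chi (c1 * b2 - c2 * b1) = chi (a1 * b2 - a2 * b1) * chi ((c1 - a1) * b2 - (c2 - a2) * b1).
      by rewrite -chiD; congr chi; ring.
    by ring.
  rewrite (eq_sum2 _ E1) sum2_exchange.
  pose q c1 c2 := chi (c1 * b2 - c2 * b1) * w (- c1) (- c2) u y.
  have pq : periodic2 N q.
    move=> a b; rewrite /q; split.
      have -> : - a = - (a + N%:Z) + N%:Z by ring.
      rewrite (w_periodic u y0 _ _).1; congr (_ * _).
      by rewrite -[RHS](chi_period _ b2); congr chi; ring.
    have -> : - b = - (b + N%:Z) + N%:Z by ring.
    rewrite (w_periodic u y0 _ _).2; congr (_ * _).
    by rewrite -[RHS](chi_period _ (- b1)); congr chi; ring.
  have E2 a1 a2 : sum2 N (fun c1 c2 => chi (a1 * b2 - a2 * b1) * w a1 a2 v y *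
        (chi ((c1 - a1) * b2 - (c2 - a2) * b1) * w (- (c1 - a1)) (- (c2 - a2)) u y))
     = chi (a1 * b2 - a2 * b1) * w a1 a2 v y * sum2 N q.
    by rewrite -sum2_mulr; congr (_ * _); exact: (sum2_shift (- a1) (- a2) pq).
  rewrite (eq_sum2 _ E2) -sum2_mull (HK v y y0 v0).
  have -> : sum2 N q = K * (sig (Nc * u) / sig (Nc * y)) * w (- b1) (- b2) y u.
    rewrite -(HK u y y0 u0) -(sum2_opp pq); apply: eq_sum2 => c1 c2.
    by rewrite /q !opprK; congr (chi _ * _); ring.
  have -> : w (- b1) (- b2) y u = w b1 b2 (- y) (- u) by rewrite -[RHS]w_opp !opprK.
  rewrite /w uE opprK mulrN sigmaN //.
  have -> : Nc * - y + (v + Nc * y) + om b1 b2 = v + om b1 b2 by ring.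
  have -> : Nc * y + v + om b1 b2 = v + Nc * y + om b1 b2 by ring.
  have t1 := sigma_om_neq0 b1 b2 v0; have t2 := sigma_om_neq0 b1 b2 vy0.
  rewrite -K2 /s; have -> : 2 * b1%:~R * - y = - (2 * b1%:~R * y) by ring.
  rewrite epiN; have := epi_neq0 (2 * b1%:~R * y).
  move: (epi _) t1 t2 y0 (sig (Nc * v)) (sig (Nc * (v + Nc * y))).
  move: (sig (v + om _ _)) (sig (v + Nc * y + _)) (sig (Nc * y)) => A B D e A0 B0 D0 U U' e0.
  by field; rewrite A0 B0 D0 e0.
have := fourier_inv g1 g2 ph.
have E b1 b2 : chi (b1 * g2%:Z - b2 * g1%:Z) * sum2 N (fun a1 a2 => chi (a1 * b2 - a2 * b1) * h a1 a2)
   = chi (b1 * g2%:Z - b2 * g1%:Z) * (Nc ^+ 2 * s) by rewrite Fh.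
rewrite (eq_sum2 _ E) -sum2_mull sum2_chi => H.
apply: (mulfI (_ : Nc ^+ 2 != 0)); first by rewrite expf_neq0.
by rewrite -[LHS]H; ring.
Qed.
End Torsion.

(** * Heisenberg matrices *)

Section Heisenberg.
Variable R : realType.
Local Notation C := R[i].
Variable N : nat.
Hypothesis hN : (1 < N)%N.
Local Notation Nc := (N%:R : C).
Local Notation chi := (@chi R N).

Let N0n : (0 < N)%N := ltnW hN.
Let N0 : Nc != 0. Proof. by rewrite pnatr_eq0 -lt0n. Qed.

(** The Heisenberg matrices g^b h^a for integer exponents, by their entries. *)
Definition Iz (a b : int) : 'M[C]_N :=
  \matrix_(i, j) (chi (b * i%:Z) *+ (N%:Z %| i%:Z + a - j%:Z)%Z).

Let modN (x : int) : 'I_N := Ordinal (ltn_pmod `|(x %% N%:Z)%Z|%N N0n).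

Let modNP (x : int) (k : 'I_N) : (N%:Z %| x - k%:Z)%Z = (k == modN x).
Proof.
have N0z : N%:Z != 0 by lia.
have m0 : (0 <= (x %% N%:Z)%Z)%R by rewrite modz_ge0.
have m1 : ((x %% N%:Z)%Z < N%:Z)%R by rewrite ltz_pmod //; lia.
have E : (modN x : nat)%:Z = (x %% N%:Z)%Z.
  by rewrite /= modn_small ?gez0_abs //; lia.
rewrite -eqz_mod_dvd; apply/eqP/eqP => [H|->].
  apply/val_inj/eqP; rewrite -(eqr_nat int) !natz E H modz_small //.
  by have := ltn_ord k; lia.
by rewrite E modz_mod.
Qed.

Let sum_modN (V : zmodType) (x : int) (F : 'I_N -> V) :
  \sum_k F k *+ (N%:Z %| x - k%:Z)%Z = F (modN x).
Proof.
transitivity (\sum_(k | k == modN x) F k); last by rewrite big_pred1_eq.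
rewrite [RHS]big_mkcond; apply: eq_bigr => k _; rewrite modNP.
by case: (k == modN x).
Qed.

Lemma chi_mod m n : (N%:Z %| m - n)%Z -> chi m = chi n.
Proof.
move=> /dvdzP[k E]; have -> : m = n + k * N%:Z by rewrite -E addrC subrK.
exact: chi_period.
Qed.

Lemma Iz_mul a b c d : Iz a b *m Iz c d = chi (a * d) *: Iz (a + c) (b + d).
Proof.
apply/matrixP => i j; rewrite !mxE.
rewrite (eq_bigr (fun k : 'I_N => (chi (b * i%:Z) * (chi (d * k%:Z) *+ (N%:Z %| k%:Z + c - j%:Z)%Z))
   *+ (N%:Z %| (i%:Z + a) - k%:Z)%Z)) => [|k _]; last by rewrite !mxE mulrnAl.
rewrite sum_modN; have /dvdzP[q E] : (N%:Z %| (i%:Z + a) - (modN (i%:Z + a))%:Z)%Z by rewrite modNP.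
set k := modN _ in E *; rewrite mulrnAr.
have -> : (N%:Z %| k%:Z + c - j%:Z)%Z = (N%:Z %| i%:Z + (a + c) - j%:Z)%Z.
  have -> : i%:Z + (a + c) - j%:Z = (k%:Z + c - j%:Z) + q * N%:Z by rewrite -E; ring.
  by rewrite [RHS]rpredDr //; apply: dvdz_mull.
rewrite mulrnAr; congr (_ *+ _).
rewrite -!chiD; apply: chi_mod.
have -> : b * i%:Z + d * k%:Z - (a * d + (b + d) * i%:Z) = - d * (i%:Z + a - k%:Z) by ring.
by rewrite E mulrA dvdz_mull.
Qed.

Lemma Iz00 : Iz 0 0 = 1%:M.
Proof.
apply/matrixP => i j; rewrite !mxE mul0r chi0 addr0 modNP; congr (_ *+ _).
have -> : modN i%:Z = i.
  apply/val_inj => /=; rewrite modz_small ?absz_nat ?modn_small //.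
  by have := ltn_ord i; lia.
by rewrite eq_sym.
Qed.

Lemma Iz_periodic a b : Iz (a + N%:Z) b = Iz a b /\ Iz a (b + N%:Z) = Iz a b.
Proof.
split; apply/matrixP => i j; rewrite !mxE.
  congr (_ *+ _); have -> : i%:Z + (a + N%:Z) - j%:Z = (i%:Z + a - j%:Z) + N%:Z by ring.
  by congr nat_of_bool; rewrite [LHS]rpredDr //; apply: dvdzz.
congr (_ *+ _); rewrite -[RHS](chi_period R hN _ i%:Z); congr chi; ring.
Qed.

Lemma Iz_inv a b : Iz a b *m (chi (a * b) *: Iz (- a) (- b)) = 1%:M.
Proof.
rewrite -scalemxAr Iz_mul !subrr Iz00 scalerA -chiD.
have -> : a * b + a * - b = 0 by ring.
by rewrite chi0 scale1r.
Qed.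

Lemma invmx_Iz a b : invmx (Iz a b) = chi (a * b) *: Iz (- a) (- b).
Proof.
have H := Iz_inv a b; have [U _] := mulmx1_unit H.
by apply: (can_inj (mulKmx U)); rewrite mulmxV // H.
Qed.

Lemma gmx_Iz : gmx R N = Iz 0 1.
Proof.
apply/matrixP => i j; rewrite !mxE addr0 modNP.
have -> : modN i%:Z = i.
  apply/val_inj => /=; rewrite modz_small ?absz_nat ?modn_small //.
  by have := ltn_ord i; lia.
rewrite eq_sym mul1r; congr (_ *+ _).
by rewrite /chi epi_pow -pmulrn; congr epi; ring.
Qed.

Lemma hmx_Iz : hmx R N = Iz 1 0.
Proof.
apply/matrixP => i j; rewrite !mxE mul0r chi0; congr (nat_of_bool _)%:R.
rewrite modNP -val_eqE /= eq_sym; congr (_ == _).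
have -> : i%:Z + 1 = i.+1%:Z by lia.
by rewrite modz_nat absz_nat modn_mod.
Qed.

Lemma Imx_Iz (a b : 'I_N) : Imx R a b = Iz a%:Z b%:Z.
Proof.
have gX n : (gmx R N) ^+ n = Iz 0 n%:Z.
  elim: n => [|n IH]; first by rewrite expr0 Iz00.
  rewrite exprS IH gmx_Iz; have := Iz_mul 0 1 0 n%:Z; rewrite mul0r chi0 scale1r add0r => H.
  by rewrite [LHS]H; congr Iz; lia.
have hX n : (hmx R N) ^+ n = Iz n%:Z 0.
  elim: n => [|n IH]; first by rewrite expr0 Iz00.
  rewrite exprS IH hmx_Iz; have := Iz_mul 1 0 n%:Z 0; rewrite mulr0 chi0 scale1r add0r => H.
  by rewrite [LHS]H; congr Iz; lia.
by rewrite /Imx gX hX Iz_mul mul0r chi0 scale1r add0r addr0.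
Qed.

(** I_alpha (x) I_alpha^-1 for integer indices *)
Definition Jz (a b : int) : 'M[C]_(N * N) := Iz a b *t (chi (a * b) *: Iz (- a) (- b)).

Lemma tensZl m n p q (c : C) (A : 'M[C]_(m, n)) (B : 'M[C]_(p, q)) : (c *: A) *t B = c *: (A *t B).
Proof. by apply/matrixP => i j; rewrite !mxE mulrA. Qed.

Lemma tensZr m n p q (c : C) (A : 'M[C]_(m, n)) (B : 'M[C]_(p, q)) : A *t (c *: B) = c *: (A *t B).
Proof. by apply/matrixP => i j; rewrite !mxE; ring. Qed.

Lemma tens11 : (1%:M : 'M[C]_N) *t (1%:M : 'M[C]_N) = 1%:M.
Proof.
apply/matrixP => i j; rewrite !mxE -natrM mulnb; congr (nat_of_bool _)%:R.
apply/andP/eqP => [[/eqP e1 /eqP e2]|-> //].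
rewrite -[LHS]mxtens_unindexK -[RHS]mxtens_unindexK.
by rewrite [X in mxtens_index X = _]surjective_pairing [X in _ = mxtens_index X]surjective_pairing e1 e2.
Qed.

Lemma Jz_mul a b c d : Jz a b *m Jz c d = chi (a * d - b * c) *: Jz (a + c) (b + d).
Proof.
rewrite /Jz tensmx_mul Iz_mul -scalemxAl -scalemxAr Iz_mul !opprD.
rewrite !(tensZl, tensZr, scalerA) -!chiD; congr (chi _ *: _); ring.
Qed.

Lemma Jz00 : Jz 0 0 = 1%:M.
Proof. by rewrite /Jz mulr0 chi0 scale1r oppr0 Iz00 tens11. Qed.

Lemma Jz_periodic a b : Jz (a + N%:Z) b = Jz a b /\ Jz a (b + N%:Z) = Jz a b.
Proof.
have [h1 h2] := Iz_periodic a b.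
have [h3 _] := Iz_periodic (- (a + N%:Z)) (- b); have [_ h4] := Iz_periodic (- a) (- (b + N%:Z)).
rewrite /Jz h1 h2; split.
  rewrite -h3; congr (_ *t (_ *: Iz _ _)); last by ring.
  by rewrite -[RHS](chi_period R hN _ b); congr chi; ring.
rewrite -h4; congr (_ *t (_ *: Iz _ _)); last by ring.
by rewrite -[RHS](chi_period R hN _ a); congr chi; ring.
Qed.

Lemma tr2E (M : 'M[C]_(N * N)) i k j l :
  tr2 M (mxtens_index (i, l)) (mxtens_index (j, k)) = M (mxtens_index (i, k)) (mxtens_index (j, l)).
Proof. by rewrite mxE !mxtens_indexK. Qed.

Lemma tr2_tens (A B : 'M[C]_N) : tr2 (A *t B) = A *t B^T.
Proof. by apply/matrixP => i j; rewrite !mxE !mxtens_indexK. Qed.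

Lemma tr2D (M M' : 'M[C]_(N * N)) : tr2 (M + M') = tr2 M + tr2 M'.
Proof. by apply/matrixP => i j; rewrite !mxE. Qed.

Lemma tr2Z c (M : 'M[C]_(N * N)) : tr2 (c *: M) = c *: tr2 M.
Proof. by apply/matrixP => i j; rewrite !mxE. Qed.

Lemma tr20 : tr2 (0 : 'M[C]_(N * N)) = 0.
Proof. by apply/matrixP => i j; rewrite !mxE. Qed.

Lemma tr2K (M : 'M[C]_(N * N)) : tr2 (tr2 M) = M.
Proof.
apply/matrixP => x y; case: (mxtens_indexP x) => i k; case: (mxtens_indexP y) => j l.
by rewrite !tr2E.
Qed.

Lemma tr2_1 : tr2 (1%:M : 'M[C]_(N * N)) = 1%:M.
Proof. by rewrite -tens11 tr2_tens trmx1. Qed.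

Lemma tr2_sum2 (h : int -> int -> 'M[C]_(N * N)) : tr2 (sum2 N h) = sum2 N (fun a b => tr2 (h a b)).
Proof.
rewrite /sum2 (big_morph _ tr2D tr20); apply: eq_bigr => i _.
by rewrite (big_morph _ tr2D tr20).
Qed.

Lemma JzE a b : Jz a b = Iz a b *t (chi (a * b) *: Iz (- a) (- b)).
Proof. by []. Qed.

Lemma tr2_Jz a b : tr2 (Jz a b) = Iz a b *t (chi (a * b) *: Iz (- a) (- b))^T.
Proof. exact: tr2_tens. Qed.

Local Opaque Jz Iz tr2.

(** Transposing the inverse gives the contragredient representation, whose cocycle is
    inverse to that of the first factor: the character in Jz_mul disappears. *)
Lemma tr2_Jz_mul a b c d : tr2 (Jz a b) *m tr2 (Jz c d) = tr2 (Jz (a + c) (b + d)).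
Proof.
pose B := chi (a * b) *: Iz (- a) (- b); pose D := chi (c * d) *: Iz (- c) (- d).
transitivity ((Iz a b *t B^T) *m (Iz c d *t D^T)).
  by congr (_ *m _); exact: tr2_Jz.
rewrite tensmx_mul.
rewrite [X in X *t _]Iz_mul.
rewrite [RHS]tr2_Jz.
have -> : B^T *m D^T = (D *m B)^T by rewrite trmx_mul.
have -> : D *m B = (chi (c * d) * chi (a * b) * chi (c * b)) *: Iz (- (a + c)) (- (b + d)).
  rewrite /D /B -[LHS]scalemxAl -[X in _ *: X]scalemxAr [X in _ *: (_ *: X)]Iz_mul !scalerA.
  by rewrite -!opprD [c + a]addrC [d + b]addrC mulrNN.
rewrite [X in _ *t X]linearZ /=.
rewrite [X in _ = _ *t X]linearZ /=.
rewrite !(tensZl, tensZr) !scalerA -!chiD.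
congr (chi _ *: _); ring.
Qed.

Lemma tr2_ZJz_mul x y a b c d :
  tr2 (x *: Jz a b) *m tr2 (y *: Jz c d) = (x * y) *: tr2 (Jz (a + c) (b + d)).
Proof.
transitivity ((x *: tr2 (Jz a b)) *m (y *: tr2 (Jz c d))).
  by congr (_ *m _); exact: tr2Z.
rewrite -[LHS]scalemxAl -[X in _ *: X]scalemxAr [LHS]scalerA.
by congr (_ *: _); exact: tr2_Jz_mul.
Qed.

Local Notation P := (flip R N).

Lemma flipE i k j l : P (mxtens_index (i, k)) (mxtens_index (j, l)) = ((j == k) && (l == i))%:R.
Proof. by rewrite mxE !mxtens_indexK /= xpair_eqE. Qed.

Lemma flip_mull (M : 'M[C]_(N * N)) i k y : (P *m M) (mxtens_index (i, k)) y = M (mxtens_index (k, i)) y.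
Proof.
rewrite mxE (bigD1 (mxtens_index (k, i))) //= flipE !eqxx mul1r big1 ?addr0 // => x.
case: (mxtens_indexP x) => j l; rewrite flipE => H.
case: eqP => [e1|_]; last by rewrite mul0r.
by case: eqP => [e2|_]; [rewrite e1 e2 eqxx in H|rewrite mul0r].
Qed.

Lemma flip_mulr (M : 'M[C]_(N * N)) x j l : (M *m P) x (mxtens_index (j, l)) = M x (mxtens_index (l, j)).
Proof.
rewrite mxE (bigD1 (mxtens_index (l, j))) //= flipE !eqxx mulr1 big1 ?addr0 // => y.
case: (mxtens_indexP y) => i k; rewrite flipE => H.
case: eqP => [e1|_]; last by rewrite mulr0.
by case: eqP => [e2|_]; [rewrite e1 e2 eqxx in H|rewrite mulr0].
Qed.

Lemma flip_conj_tens (A B : 'M[C]_N) : P *m (A *t B) *m P = B *t A.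
Proof.
apply/matrixP => x y; case: (mxtens_indexP x) => i k; case: (mxtens_indexP y) => j l.
by rewrite flip_mulr flip_mull !tensmxE mulrC.
Qed.

Lemma flipK : P *m P = 1%:M.
Proof. by rewrite -[X in X *m _]mulmx1 -tens11 flip_conj_tens. Qed.

Lemma flip_Jz a b : P *m Jz a b *m P = Jz (- a) (- b).
Proof. by rewrite !JzE flip_conj_tens !opprK mulrNN tensZl tensZr. Qed.

(** Elements of the span of the I_alpha (x) I_alpha^-1, given by their
    coefficients; products become (twisted) convolutions. *)
Definition Vm (f : int -> int -> C) : 'M[C]_(N * N) := sum2 N (fun a b => f a b *: Jz a b).

Lemma mulmx_sum2l n (h : int -> int -> 'M[C]_n) (M : 'M[C]_n) : sum2 N h *m M = sum2 N (fun a b => h a b *m M).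
Proof. by rewrite /sum2 mulmx_suml; apply: eq_bigr => i _; rewrite mulmx_suml. Qed.

Lemma mulmx_sum2r n (h : int -> int -> 'M[C]_n) (M : 'M[C]_n) : M *m sum2 N h = sum2 N (fun a b => M *m h a b).
Proof. by rewrite /sum2 mulmx_sumr; apply: eq_bigr => i _; rewrite mulmx_sumr. Qed.

(** The flip inverts the index, because it exchanges I_alpha and its inverse. *)
Lemma flip_Vm f : periodic2 N f -> P *m Vm f *m P = Vm (fun a b => f (- a) (- b)).
Proof.
move=> pf; rewrite /Vm mulmx_sum2r mulmx_sum2l.
rewrite -[RHS](sum2_opp (N := N)).
  by apply: eq_sum2 => a b; rewrite !opprK -scalemxAr -scalemxAl flip_Jz.
move=> a b; have [h1 _] := pf (- (a + N%:Z)) (- b); have [_ h2] := pf (- a) (- (b + N%:Z)).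
have [j1 j2] := Jz_periodic a b; rewrite j1 j2 -h1 -h2; split; congr (f _ _ *: _); ring.
Qed.

Lemma sum2_scale (V : lmodType C) (h : int -> int -> C) (v : V) :
  sum2 N (fun a b => h a b *: v) = sum2 N h *: v.
Proof. by rewrite /sum2 scaler_suml; apply: eq_bigr => i _; rewrite scaler_suml. Qed.

Lemma Vm_mul_flip f g : periodic2 N f -> periodic2 N g -> 
  Vm f *m (P *m Vm g *m P) = Vm (fun c d =>
    sum2 N (fun a b => chi (a * d - b * c) * (f a b * g (a - c) (b - d)))).
Proof.
move=> pf pg; rewrite flip_Vm // /Vm mulmx_sum2l.
pose G (a b c d : int) := chi (a * d - b * c) * (f a b * g (a - c) (b - d)) *: Jz c d.
have E a b : (f a b *: Jz a b) *m sum2 N (fun c d => g (- c) (- d) *: Jz c d) = sum2 N (G a b).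
  rewrite mulmx_sum2r -(sum2_shift (h := G a b) a b).
    apply: eq_sum2 => c d; rewrite /G -scalemxAl -scalemxAr Jz_mul !scalerA.
    rewrite [c + a]addrC [d + b]addrC; congr (_ *: _).
    have -> : a - (a + c) = - c by ring. have -> : b - (b + d) = - d by ring.
    rewrite [LHS]mulrC; have -> : a * (b + d) - b * (a + c) = a * d - b * c by ring.
    by [].
  move=> c d; rewrite /G; have [j1 j2] := Jz_periodic c d; rewrite j1 j2.
  have [h1 _] := pg (a - (c + N%:Z)) (b - d); have [_ h2] := pg (a - c) (b - (d + N%:Z)).
  rewrite -h1 -h2; split; congr (_ * (_ * g _ _) *: _); try ring.
    by rewrite -[RHS](chi_period R hN _ (- b)); congr chi; ring.
  by rewrite -[RHS](chi_period R hN _ a); congr chi; ring.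
rewrite (eq_sum2 _ E) sum2_exchange; apply: eq_sum2 => c d; rewrite /G.
by rewrite sum2_scale.
Qed.

Lemma tr2_Vm_mul_flip f g : periodic2 N f -> periodic2 N g -> 
  tr2 (Vm f) *m tr2 (P *m Vm g *m P) = tr2 (Vm (fun c d =>
    sum2 N (fun a b => f a b * g (a - c) (b - d)))).
Proof.
move=> pf pg; rewrite flip_Vm // /Vm !tr2_sum2 mulmx_sum2l.
pose G (a b c d : int) := (f a b * g (a - c) (b - d)) *: tr2 (Jz c d).
have E a b : tr2 (f a b *: Jz a b) *m sum2 N (fun c d => tr2 (g (- c) (- d) *: Jz c d)) = sum2 N (G a b).
  rewrite mulmx_sum2r -(sum2_shift (h := G a b) a b).
    apply: eq_sum2 => c d; apply: etrans (tr2_ZJz_mul (f a b) (g (- c) (- d)) a b c d) _.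
    rewrite /G [c + a]addrC [d + b]addrC; congr (_ *: _).
    have -> : a - (a + c) = - c by ring.
    by have -> : b - (b + d) = - d by ring.
  move=> c d; rewrite /G; have [j1 j2] := Jz_periodic c d; rewrite j1 j2.
  have [h1 _] := pg (a - (c + N%:Z)) (b - d); have [_ h2] := pg (a - c) (b - (d + N%:Z)).
  by rewrite -h1 -h2; split; congr (_ * g _ _ *: _); ring.
rewrite (eq_sum2 _ E) sum2_exchange; apply: eq_sum2 => c d; rewrite /G.
by rewrite sum2_scale tr2Z.
Qed.

Lemma sum2_only0 (V : nmodType) (h : int -> int -> V) :
  (forall i j : 'I_N, ~~ ((i == 0%N :> nat) && (j == 0%N :> nat)) -> h i j = 0) ->
  sum2 N h = h 0 0.
Proof.
move=> H; have zn (i : 'I_N) : (i == 0%N :> nat) = (i == Ordinal N0n) by [].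
rewrite /sum2 (bigD1 (Ordinal N0n)) //= [X in _ + X]big1 => [|i i0]; last first.
  by apply: big1 => j _; apply: H; rewrite (zn i) (negPf i0).
rewrite addr0 (bigD1 (Ordinal N0n)) //= [X in _ + X]big1 ?addr0 // => j j0.
by apply: (H (Ordinal N0n)); rewrite (zn j) (negPf j0).
Qed.

Lemma Vm_delta (f : int -> int -> C) (s : C) :
  (forall i j : 'I_N, f i j = (Nc ^+ 2 *+ ((i == 0%N :> nat) && (j == 0%N :> nat))) * s) ->
  Vm f = (Nc ^+ 2 * s)%:M.
Proof.
move=> E; rewrite /Vm sum2_only0.
  by rewrite Jz00 scalemx1; congr (_%:M); have := E (Ordinal N0n) (Ordinal N0n); rewrite mulr1n.
by move=> i j H; rewrite E (negPf H) mulr0n mul0r scale0r.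
Qed.

End Heisenberg.

(** * The sum over the Heisenberg matrices in R *)

Section Belavin.
Variable R : realType.
Local Notation C := R[i].
Variable N : nat.
Hypothesis hN : (1 < N)%N.
Variable tau : C.
Hypothesis tau1 : `|epi (2 * tau)| < 1.
Local Notation Nc := (N%:R : C).
Local Notation chi := (@chi R N).
Local Notation sig := (sigma tau).
Local Notation P := (flip R N).
Implicit Types xi zeta : C.

Let N0 : Nc != 0. Proof. by rewrite pnatr_eq0 -lt0n ltnW. Qed.

Definition Vmx xi zeta : 'M[C]_(N * N) :=
  \sum_(a1 < N) \sum_(a2 < N) W a1 a2 xi zeta tau *: (Imx R a1 a2 *t invmx (Imx R a1 a2)).

Lemma W_w (a b : 'I_N) xi zeta : W a b xi zeta tau = Nc^-1 * w tau N a b (xi / Nc) (zeta / Nc).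
Proof.
have [c c0 Hc] := theta_sigma tau1; rewrite /W !Hc /w /om.
have E1 : xi + zeta / Nc + a%:R / Nc * tau + b%:R / Nc = Nc * (xi / Nc) + zeta / Nc + ((a%:Z)%:~R * tau + (b%:Z)%:~R) / Nc.
  by rewrite -!pmulrn; field.
have E2 : zeta / Nc + a%:R / Nc * tau + b%:R / Nc = zeta / Nc + ((a%:Z)%:~R * tau + (b%:Z)%:~R) / Nc.
  by rewrite -!pmulrn; field.
rewrite E1 E2; set A := epi _; set B := epi _; set D := epi _.
move: (sig (_ / _ + _ / _)) => t; move: (sig _) => s.
have E : A = D * B by rewrite /A /B /D -epiD; congr epi; rewrite -pmulrn; field.
rewrite E !invfM; have B0 : B != 0 := epi_neq0 _; move: B B0 {A E} => B B0.
by move: t^-1 => t'; field; rewrite N0 c0 B0.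
Qed.

Lemma VmxE xi zeta : Vmx xi zeta = Nc^-1 *: Vm N (fun a b => w tau N a b (xi / Nc) (zeta / Nc)).
Proof.
rewrite /Vmx /Vm /sum2 scaler_sumr; apply: eq_bigr => a _.
rewrite scaler_sumr; apply: eq_bigr => b _.
by rewrite W_w scalerA Imx_Iz // invmx_Iz.
Qed.

Lemma Vmx_unit xi zeta : sig zeta != 0 -> Vmx xi zeta *m (P *m Vmx (- xi) zeta *m P) =
  (sig (zeta + xi) * sig (zeta - xi) / sig zeta ^+ 2)%:M.
Proof.
move=> z0; have zE : Nc * (zeta / Nc) = zeta by field.
have xE : Nc * (xi / Nc) = xi by field.
have y0 : sig (Nc * (zeta / Nc)) != 0 by rewrite zE.
rewrite !VmxE -!(scalemxAr, scalemxAl) Vm_mul_flip //; last 2 first.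
- exact: w_periodic.
- exact: w_periodic.
rewrite scalerA (Vm_delta hN (s := sig (zeta + xi) * sig (zeta - xi) / sig zeta ^+ 2)).
  by rewrite scale_scalar_mx; congr (_%:M); field; rewrite z0 N0.
by move=> i j; rewrite mulNr unit_coef // zE xE.
Qed.

Lemma Vmx_cross xi zeta : sig zeta != 0 -> sig xi != 0 -> sig (xi + Nc * zeta) != 0 ->
  tr2 (Vmx xi zeta) *m tr2 (P *m Vmx (- xi - Nc * zeta) zeta *m P) =
  (- (sig xi * sig (xi + Nc * zeta) / sig zeta ^+ 2))%:M.
Proof.
move=> z0 x0 xz0; have zE : Nc * (zeta / Nc) = zeta by field.
have xE : Nc * (xi / Nc) = xi by field.
have xzE : Nc * (xi / Nc + Nc * (zeta / Nc)) = xi + Nc * zeta by field.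
have uE : (- xi - Nc * zeta) / Nc = - (xi / Nc) - Nc * (zeta / Nc) by field.
have y0 : sig (Nc * (zeta / Nc)) != 0 by rewrite zE.
rewrite !VmxE -!(scalemxAr, scalemxAl) !tr2Z -!(scalemxAr, scalemxAl).
rewrite tr2_Vm_mul_flip //; last 2 first.
- exact: w_periodic.
- exact: w_periodic.
rewrite scalerA (Vm_delta hN (s := - (sig xi * sig (xi + Nc * zeta) / sig zeta ^+ 2))).
  rewrite -scalemx1 tr2Z tr2_1 scalerA scalemx1; congr (_%:M); field; by rewrite z0 N0.
have x0' : sig (Nc * (xi / Nc)) != 0 by rewrite xE.
have xz0' : sig (Nc * (xi / Nc + Nc * (zeta / Nc))) != 0 by rewrite xzE.
move=> i j; rewrite uE; apply: etrans (cross_coef tau1 hN i j y0 x0' xz0') _.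
by rewrite xzE zE xE.
Qed.

(** Translating the argument of sigma by tau + 1 multiplies the coefficient of index
    (a, b) by a character of (a, b), which is also what commuting g h past I_(a, b)
    produces. *)
Lemma Vmx_shift xi zeta : (Iz R N 1 1 *t 1%:M) *m Vmx (xi + tau + 1) zeta =
  epi (- tau - 2 * xi - 2 * (zeta / Nc)) *: (Vmx xi zeta *m (Iz R N 1 1 *t 1%:M)).
Proof.
rewrite !VmxE -[LHS]scalemxAr -[X in _ = _ *: X]scalemxAl [RHS]scalerA.
rewrite [X in _ = X *: _]mulrC -[RHS]scalerA; congr (_ *: _).
rewrite /Vm mulmx_sum2r mulmx_sum2l.
have -> : epi (- tau - 2 * xi - 2 * (zeta / Nc)) *: sum2 N (fun a b => (w tau N a b (xi / Nc) (zeta / Nc) *: Jz R N a b) *m (Iz R N 1 1 *t 1%:M))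
  = sum2 N (fun a b => epi (- tau - 2 * xi - 2 * (zeta / Nc)) *: ((w tau N a b (xi / Nc) (zeta / Nc) *: Jz R N a b) *m (Iz R N 1 1 *t 1%:M))).
  by rewrite /sum2 scaler_sumr; apply: eq_bigr => i _; rewrite scaler_sumr.
apply: eq_sum2 => a b.
pose M0 := Iz R N (a + 1) (b + 1) *t (chi (a * b) *: Iz R N (- a) (- b)).
have H1 : (Iz R N 1 1 *t 1%:M) *m Jz R N a b = chi b *: M0.
  rewrite JzE tensmx_mul mul1mx [X in X *t _]Iz_mul // tensZl mul1r.
  by rewrite [1 + a]addrC [1 + b]addrC.
have H2 : Jz R N a b *m (Iz R N 1 1 *t 1%:M) = chi a *: M0.
  by rewrite JzE tensmx_mul mulmx1 [X in X *t _]Iz_mul // tensZl mulr1.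
rewrite -[LHS]scalemxAr -[X in _ = _ *: X]scalemxAl H1 H2 !scalerA; congr (_ *: _).
rewrite /w.
have -> : Nc * ((xi + tau + 1) / Nc) + zeta / Nc + om tau N a b =
  Nc * (xi / Nc) + zeta / Nc + om tau N a b + (1%:~R * tau + 1%:~R) by field.
rewrite sigma_lattice //; set s := sig _; set t := sig _; set L := epi (_ - _ - _ * tau).
have E : epi (2 * a%:~R * ((xi + tau + 1) / Nc)) * L * chi b =
  epi (- tau - 2 * xi - 2 * (zeta / Nc)) * epi (2 * a%:~R * (xi / Nc)) * chi a.
  rewrite /L /chi -!epiD -[LHS]divr1 -[X in _ / X](epi2 R) -epiB; congr epi.
  by rewrite /om; field.
transitivity (epi (2 * a%:~R * ((xi + tau + 1) / Nc)) * L * chi b * (s / t)); first by ring.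
by rewrite E; ring.
Qed.

End Belavin.

(** * Unitarity, crossing and quasi-periodicity of R *)

Section Scalars.
Variable R : realType.
Local Notation C := R[i].
Variable N : nat.
Hypothesis hN : (1 < N)%N.
Variables zeta tau : C.
Hypothesis zeta1 : `|epi zeta| < 1.
Hypothesis tau1 : `|epi (2 * tau)| < 1.
Local Notation Nc := (N%:R : C).
Local Notation p := (epi (2 * tau)).
Local Notation P := (epi (2 * (Nc * zeta))).
Local Notation sig := (sigma tau).
Implicit Types x y xi : C.

Let N0 : Nc != 0. Proof. by rewrite pnatr_eq0 -lt0n ltnW. Qed.

Let p1 : nrm p < 1 := nome_lt1 tau1.

Lemma qP : epi zeta ^+ (2 * N) = P.
Proof. by rewrite -epiX; congr epi; rewrite -[LHS]mulr_natr natrM; ring. Qed.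

Lemma P_lt1 : nrm P < 1.
Proof.
rewrite -qP nrmX exprn_ilt1 ?nrm_ge0 //; first by rewrite muln_eq0 /= -lt0n ltnW.
by rewrite -ltcR -normE rmorph1.
Qed.

Let P1 : nrm P < 1 := P_lt1.

(** The condition [generic] in a form that makes its stability under the translations by
    tau and zeta visible. *)
Definition gen x := forall a b : int, epi (2 * (x + (a%:~R * tau + b%:~R * zeta))) != 1.

Lemma genericE x : generic zeta tau x -> gen x.
Proof.
move=> H a b; have := H (- a) (- b); rewrite -epiD; apply: contraNN => /eqP E.
have -> : 2 * x = 2 * (x + (a%:~R * tau + b%:~R * zeta)) +
  (2 * ((- a)%:~R * tau) + 2 * ((- b)%:~R * zeta)) by rewrite !mulrNz; ring.
by rewrite [X in X == _]epiD E mul1r.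
Qed.

Lemma gen_shift x (a b : int) : gen x -> gen (x + (a%:~R * tau + b%:~R * zeta)).
Proof.
move=> H c d; have := H (a + c) (b + d); rewrite !rmorphD /=.
by congr (epi _ != 1); ring.
Qed.

Lemma gen_int x : gen x -> gen (x + 1).
Proof.
move=> H a b; have := H a b.
have -> : 2 * (x + 1 + (a%:~R * tau + b%:~R * zeta)) = 2 * (x + (a%:~R * tau + b%:~R * zeta)) + 2 by ring.
by rewrite epiD epi2 mulr1.
Qed.

Lemma genN x : gen x -> gen (- x).
Proof.
move=> H a b; have := H (- a) (- b); apply: contraNN => /eqP E.
have -> : 2 * (x + ((- a)%:~R * tau + (- b)%:~R * zeta)) = - (2 * (- x + (a%:~R * tau + b%:~R * zeta))).
  by rewrite !mulrNz; ring.
by rewrite epiN E invr1.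
Qed.

(** The infinite products in the logarithm of their argument. *)
Definition gam x := qpoch (epi (2 * x)) [:: p; P].
Definition poP x := qpoch (epi (2 * x)) [:: P].
Definition pop x := qpoch (epi (2 * x)) [:: p].

Lemma gam_tau x : gam x = poP x * gam (x + tau).
Proof.
have E : epi (2 * (x + tau)) = p * epi (2 * x) by rewrite -epiD; congr epi; ring.
by rewrite /gam E; exact: qpoch2S.
Qed.

Lemma gam_P x : gam x = pop x * gam (x + Nc * zeta).
Proof.
have E : epi (2 * (x + Nc * zeta)) = P * epi (2 * x) by rewrite -epiD; congr epi; ring.
by rewrite /gam E; exact: qpoch2S'.
Qed.

Lemma gam_neq0 x : gen x -> gam x != 0.
Proof.
move=> H; apply: qpoch2_neq0 => // k l; have := H k%:Z (N * l)%:Z.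
rewrite -!epiX -!epiD; congr (epi _ != 1).
by rewrite -!pmulrn natrM -[in X in _ + X + _]mulr_natr -[X in _ = _ + X]mulr_natr; ring.
Qed.

Lemma poP_neq0 x : gen x -> poP x != 0.
Proof. by move=> H; have := gam_neq0 H; rewrite gam_tau mulf_eq0 negb_or => /andP[]. Qed.

Lemma sig_neq0 x : gen x -> sig x != 0.
Proof.
move=> H; apply: sigma_neq0 => // a; have := H (- a) 0; apply: contraNN => /eqP E.
have -> : 2 * (x + ((- a)%:~R * tau + 0%:~R * zeta)) = 2 * x - 2 * (a%:~R * tau) by rewrite mulrNz mul0r; ring.
by rewrite epiB E divff // epi_neq0.
Qed.

Lemma sigE x : sig x = epi (- x) * (pop x * pop (tau - x)).
Proof. by rewrite /sigma /thetap /pop -epiB mulrBr. Qed.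

Lemma dif_gam x : dif gam x.
Proof.
have [|D H] := @entire_hasD R (fun z => qpoch z [:: p; P]) (epi (2 * x)).
  by apply: entire_qpoch; rewrite /= p1 P1.
apply: (@dif_comp R (fun y => epi (2 * y)) (fun z => qpoch z [:: p; P])); last by exists D.
by apply: dif_comp (dif_epi _); apply: dif_mul; [exact: dif_cst|exact: dif_id].
Qed.

Lemma dif_poP x : dif poP x.
Proof.
have [|D H] := @entire_hasD R (fun z => qpoch z [:: P]) (epi (2 * x)).
  by apply: entire_qpoch; rewrite /= P1.
apply: (@dif_comp R (fun y => epi (2 * y)) (fun z => qpoch z [:: P])); last by exists D.
by apply: dif_comp (dif_epi _); apply: dif_mul; [exact: dif_cst|exact: dif_id].
Qed.

(** The numerator of 1 / kappa; the denominator is its value at - x. *)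
Definition knum x := gam (Nc * zeta - x) * gam (zeta + x) * gam (tau - x) * gam (tau + (Nc - 1) * zeta + x).

Lemma kappaVE x : kappaV N x zeta tau = knum x / knum (- x).
Proof.
have q2 : epi zeta ^+ 2 = epi (2 * zeta) by rewrite -epiX -[zeta *+ 2]mulr_natl.
have qN2 : epi zeta ^+ (2 * N - 2) = epi (2 * ((Nc - 1) * zeta)).
  rewrite -epiX; congr epi; rewrite -[LHS]mulr_natr natrB; last by rewrite leq_pmulr // ltnW.
  by rewrite natrM; ring.
have E (a b : C) : epi (2 * a) * epi (2 * b) = epi (2 * (a + b)) by rewrite mulrDr epiD.
have E' (a b : C) : epi (2 * a) / epi (2 * b) = epi (2 * (a - b)) by rewrite mulrBr epiB.
by rewrite /kappaV qP q2 qN2 !E !E' /knum !opprK.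
Qed.

Lemma tauNE x : tauN N x zeta = epi ((2 / Nc - 2) * x) *
  (poP (zeta / 2 + x) * poP ((Nc - 1 / 2) * zeta - x) / (poP (zeta / 2 - x) * poP ((Nc - 1 / 2) * zeta + x))).
Proof.
rewrite /tauN qP /Theta; congr (_ * _).
have c0 : qpoch P [:: P] != 0.
  apply: qpoch1_neq0 => // k; apply/eqP => /(congr1 (@nrm R)); rewrite nrm1 -exprS nrmX => E.
  have : nrm P ^+ k.+1 < 1 by rewrite exprn_ilt1 ?nrm_ge0.
  by rewrite E ltxx.
have -> : epi zeta * epi (2 * x) = epi (2 * (zeta / 2 + x)) by rewrite -epiD; congr epi; field.
have -> : epi zeta / epi (2 * x) = epi (2 * (zeta / 2 - x)) by rewrite -epiB; congr epi; field.
rewrite -!epiB.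
have -> : 2 * (Nc * zeta) - 2 * (zeta / 2 + x) = 2 * ((Nc - 1 / 2) * zeta - x) by field.
have -> : 2 * (Nc * zeta) - 2 * (zeta / 2 - x) = 2 * ((Nc - 1 / 2) * zeta + x) by field.
by rewrite -/(poP _) -/(poP _) -/(poP _) -/(poP _) invfM mulrACA divff // mulr1.
Qed.

(** The function f(y) = tau_N(q^(1/2) e^(i pi y)), in whose terms the statement is
    written, has period N zeta. *)
Definition ftau y := tauN N (zeta / 2 + y) zeta.

Lemma ftauE y : ftau y = epi ((2 / Nc - 2) * (zeta / 2 + y)) *
  (poP (zeta + y) * poP ((Nc - 1) * zeta - y) / (poP (- y) * poP (Nc * zeta + y))).
Proof.
rewrite /ftau tauNE; congr (_ * (poP _ * poP _ / (poP _ * poP _))); by field.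
Qed.

Lemma poP_S x : poP x = (1 - epi (2 * x)) * poP (x + Nc * zeta).
Proof.
have E : epi (2 * (x + Nc * zeta)) = P * epi (2 * x) by rewrite -epiD; congr epi; ring.
by rewrite /poP E qpochS /= ?P1.
Qed.

Lemma gen_zeta x (b : int) y : gen x -> y = x + b%:~R * zeta -> gen y.
Proof. by move=> H ->; have := gen_shift 0 b H; rewrite mul0r add0r. Qed.

Lemma ftau_periodic y : poP (- y) != 0 -> poP (Nc * zeta + y) != 0 ->
  ftau (y + Nc * zeta) = ftau y.
Proof.
move=> c1 d2; rewrite !ftauE.
have E1 : zeta + (y + Nc * zeta) = (zeta + y) + Nc * zeta by ring.
have E2 : (Nc - 1) * zeta - (y + Nc * zeta) = - zeta - y by ring.
have E3 : - (y + Nc * zeta) = - y - Nc * zeta by ring.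
have E4 : Nc * zeta + (y + Nc * zeta) = (Nc * zeta + y) + Nc * zeta by ring.
rewrite E1 E2 E3 E4.
have := poP_S (zeta + y); have := poP_S (- zeta - y).
have := poP_S (- y - Nc * zeta); have := poP_S (Nc * zeta + y).
have -> : - zeta - y + Nc * zeta = (Nc - 1) * zeta - y by ring.
have -> : - y - Nc * zeta + Nc * zeta = - y by ring.
move=> F1 F2 F3 F4.
have [Y1 d1] : epi (2 * (Nc * zeta + y)) != 1 /\ poP (Nc * zeta + y + Nc * zeta) != 0.
  move: d2; rewrite F1; move: (epi _) (poP _) => Y d.
  by rewrite mulf_eq0 negb_or subr_eq0 eq_sym => /andP[].
have EX : epi (2 * (- zeta - y)) = (epi (2 * (zeta + y)))^-1 by rewrite -epiN; congr epi; ring.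
have EY : epi (2 * (- y - Nc * zeta)) = (epi (2 * (Nc * zeta + y)))^-1 by rewrite -epiN; congr epi; ring.
have Ee : epi ((2 / Nc - 2) * (zeta / 2 + (y + Nc * zeta))) =
  epi ((2 / Nc - 2) * (zeta / 2 + y)) * epi (2 * (zeta + y)) / epi (2 * (Nc * zeta + y)).
  by rewrite -epiD -epiB; congr epi; field.
rewrite Ee F1 F2 F3 F4 EX EY; move: (epi_neq0 (2 * (zeta + y))) (epi_neq0 (2 * (Nc * zeta + y))) Y1 c1 d1.
move: (epi (_ * (zeta / 2 + y))) (poP ((Nc - 1) * zeta - y)) (poP (zeta + y + Nc * zeta)) (poP (Nc * zeta + y + Nc * zeta)) (poP (- y)) (epi (2 * (Nc * zeta + y))) (epi (2 * (zeta + y))).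
move=> e b a d c Y X X0 Y0 Y1 c0 d0.
have Y2 : Y - 1 != 0 by rewrite subr_eq0.
have Y3 : 1 - Y != 0 by rewrite subr_eq0 eq_sym.
have -> : 1 - Y^-1 = (Y - 1) / Y by field.
have -> : 1 - X^-1 = (X - 1) / X by field.
field; by rewrite X0 Y0 c0 d0 Y2 Y3.
Qed.

Hypothesis zeta_reg : sig zeta != 0.

(** A function whose nonvanishing is an open condition under which the identities
    for R hold; it is nonzero at generic points. *)
Definition reg x := knum x * knum (- x) * (sig x * sig (x + zeta) * sig (x - zeta)).

Lemma knum_neq0 x : gen x -> knum x != 0.
Proof.
move=> H; have H' := genN H; rewrite /knum !mulf_neq0 //; apply: gam_neq0.
- by apply: (gen_zeta (b := N%:Z) H'); rewrite -pmulrn; ring.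
- by apply: (gen_zeta (b := 1) H); ring.
- by have := gen_shift 1 0 H'; congr gen; ring.
- have := gen_shift 1 (N%:Z - 1) H; congr gen.
  by rewrite rmorphB /= -pmulrn; ring.
Qed.

Lemma gen_reg x : gen x -> reg x != 0.
Proof.
move=> H; rewrite /reg; apply: mulf_neq0.
  by apply: mulf_neq0; apply: knum_neq0 => //; exact: genN.
apply: mulf_neq0; first apply: mulf_neq0; apply: sig_neq0 => //.
  by apply: (gen_zeta (b := 1) H); ring.
by apply: (gen_zeta (b := -1) H); ring.
Qed.

Lemma dif_sig x : dif sig x.
Proof. by have [D H] := hasD_sigma tau1 x; exists D. Qed.

Lemma dif_knum x : dif knum x.
Proof.
have m a b y : dif (fun y => gam (a + b * y)) y by apply: dif_comp_aff => ?; exact: dif_gam.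
apply: (eq_dif (f := fun y => gam (Nc * zeta + (-1) * y) * gam (zeta + 1 * y) *
  gam (tau + (-1) * y) * gam (tau + (Nc - 1) * zeta + 1 * y))).
  by move=> y; rewrite /knum !mul1r !mulN1r.
by do 3?[apply: dif_mul].
Qed.

Lemma dif_reg x : dif reg x.
Proof.
have s a y : dif (fun y => sig (a + 1 * y)) y by apply: dif_comp_aff => ?; exact: dif_sig.
have k a b y : dif (fun y => knum (a + b * y)) y by apply: dif_comp_aff => ?; exact: dif_knum.
apply: (eq_dif (f := fun y => knum (0 + 1 * y) * knum (0 + (-1) * y) *
  (sig (0 + 1 * y) * sig (zeta + 1 * y) * sig (- zeta + 1 * y)))).
  move=> y; rewrite /reg !mul1r !mulN1r !add0r.
  by rewrite [zeta + y]addrC [- zeta + y]addrC.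
apply: dif_mul; first by apply: dif_mul.
by apply: dif_mul => //; apply: dif_mul.
Qed.

Lemma reg_neq0 x : reg x != 0 ->
  [/\ knum x != 0, knum (- x) != 0, sig x != 0, sig (x + zeta) != 0 & sig (x - zeta) != 0].
Proof.
rewrite /reg; move: (knum (- x)) (knum x) (sig (x - zeta)) (sig (x + zeta)) (sig x) => a b c d e.
by rewrite !mulf_eq0 !negb_or => /andP[/andP[-> ->] /andP[/andP[-> ->] ->]].
Qed.

Lemma knum_neq0P x : knum x != 0 -> [/\ gam (Nc * zeta - x) != 0,
  gam (zeta + x) != 0, gam (tau - x) != 0 & gam (tau + (Nc - 1) * zeta + x) != 0].
Proof.
rewrite /knum; move: (gam (Nc * zeta - x)) (gam (zeta + x)) (gam (tau - x)) (gam _) => a b c d.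
by rewrite !mulf_eq0 !negb_or => /andP[/andP[/andP[-> ->] ->] ->].
Qed.

Lemma pop_sig x : pop x * pop (tau - x) = epi x * sig x.
Proof. by rewrite sigE mulrA -epiD subrr epi0 mul1r. Qed.

(** The scalar in front of the sum in R. *)
Definition cR x := epi ((2 / Nc - 2) * x) * kappaV N x zeta tau * (sig zeta / sig (x + zeta)).

Lemma cR_unit x : reg x != 0 ->
  cR x * cR (- x) * (sig (zeta + x) * sig (zeta - x) / sig zeta ^+ 2) = 1.
Proof.
move=> /reg_neq0[k0 k0' _ s1 s2]; rewrite /cR !kappaVE opprK [zeta + x]addrC [zeta - x]addrC.
have s3 : sig (- x + zeta) != 0.
  have -> : - x + zeta = - (x - zeta) by ring.
  by rewrite sigmaN // oppr_eq0.
have e : epi ((2 / Nc - 2) * - x) = (epi ((2 / Nc - 2) * x))^-1 by rewrite mulrN epiN.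
rewrite e; have := epi_neq0 ((2 / Nc - 2) * x); move: k0 k0' s1 s3 zeta_reg.
move: (knum x) (knum (- x)) (sig (x + zeta)) (sig (- x + zeta)) (sig zeta) (epi (_ * x)).
by move=> a b c d f g a0 b0 c0 d0 f0 g0; field; rewrite a0 b0 c0 d0 f0 g0.
Qed.

(** Each double product at x + N zeta differs from the one at x by a simple product in
    powers of p, and these recombine into values of sigma. *)
Lemma kappa_cross x : reg x != 0 -> reg (x + Nc * zeta) != 0 ->
  kappaV N x zeta tau * kappaV N (- x - Nc * zeta) zeta tau =
  - epi (2 * zeta - 2 * Nc * zeta) * (sig (x + zeta) * sig (- x - Nc * zeta + zeta)
     / (sig x * sig (x + Nc * zeta))).
Proof.
move=> /reg_neq0[k1 k2 s1 s2 _] /reg_neq0[k3 k4 s3 _ s4].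
rewrite !kappaVE.
have -> : - (- x - Nc * zeta) = x + Nc * zeta by ring.
have E : - (x + Nc * zeta) = - x - Nc * zeta by ring.
rewrite E in k4.
have [g1 _ g3 _] := knum_neq0P k1; have [_ g6 _ g8] := knum_neq0P k2.
have [ga h2 gb h4] := knum_neq0P k3; have [h5 _ h7 _] := knum_neq0P k4.
have [gc _ gd _] := knum_neq0P k2; rewrite /knum.
have gamP y z : z = y + Nc * zeta -> gam y = pop y * gam z by move=> ->; exact: gam_P.
have A1 : gam (zeta + x) = pop (zeta + x) * gam (zeta + (x + Nc * zeta)) by apply: gamP; ring.
have A2 : gam (tau + (Nc - 1) * zeta + x) =
  pop (tau + (Nc - 1) * zeta + x) * gam (tau + (Nc - 1) * zeta + (x + Nc * zeta)).
  by apply: gamP; ring.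
have A3 : gam (Nc * zeta - - x) = pop (Nc * zeta - - x) * gam (Nc * zeta - (- x - Nc * zeta)).
  by apply: gamP; ring.
have A4 : gam (tau - - x) = pop (tau - - x) * gam (tau - (- x - Nc * zeta)) by apply: gamP; ring.
have A5 : gam (Nc * zeta - (x + Nc * zeta)) = pop (Nc * zeta - (x + Nc * zeta)) * gam (Nc * zeta - x).
  by apply: gamP; ring.
have A6 : gam (tau - (x + Nc * zeta)) = pop (tau - (x + Nc * zeta)) * gam (tau - x) by apply: gamP; ring.
have A7 : gam (zeta + (- x - Nc * zeta)) = pop (zeta + (- x - Nc * zeta)) * gam (zeta - x).
  by apply: gamP; ring.
have A8 : gam (tau + (Nc - 1) * zeta + (- x - Nc * zeta)) =
  pop (tau + (Nc - 1) * zeta + (- x - Nc * zeta)) * gam (tau + (Nc - 1) * zeta - x).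
  by apply: gamP; ring.
have B y z w v : y = w -> z = tau - w -> v = w -> pop y * pop z = epi v * sig w.
  by move=> -> -> ->; exact: pop_sig.
have B1 := B (Nc * zeta - (x + Nc * zeta)) (tau - - x) (- x) (- x).
have B2 := B (Nc * zeta - - x) (tau - (x + Nc * zeta)) (x + Nc * zeta) (x + Nc * zeta).
have B3 := B (zeta + x) (tau + (Nc - 1) * zeta + (- x - Nc * zeta)) (x + zeta) (x + zeta).
have B4 := B (zeta + (- x - Nc * zeta)) (tau + (Nc - 1) * zeta + x) (- x - Nc * zeta + zeta) (- x - Nc * zeta + zeta).
move: B1 B2 B3 B4 => /(_ _ _ erefl) B1 /(_ _ _ erefl) B2 /(_ _ _ erefl) B3 /(_ _ _ erefl) B4.
move: (B1 ltac:(ring) ltac:(ring)) (B2 ltac:(ring) ltac:(ring)) (B3 ltac:(ring) ltac:(ring)) (B4 ltac:(ring) ltac:(ring)) => {B1 B2 B3 B4 B} B1 B2 B3 B4.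
have nzl (a b : C) : a * b != 0 -> a != 0 by rewrite mulf_eq0 negb_or => /andP[].
move: ga gb gc gd; rewrite A1 A2 A3 A4 A5 A6 A7 A8 => /nzl a1 /nzl b2 /nzl b1 /nzl a2.
have Ee : epi (2 * zeta - 2 * Nc * zeta) * (epi (- x) * epi (x + Nc * zeta)) =
  epi (x + zeta) * epi (- x - Nc * zeta + zeta) by rewrite -!epiD; congr epi; ring.
rewrite sigmaN // in B1.
have K (G1 G3 G6 G8 H2 H4 H5 H7 a b c d a' b' c' d' : C) :
  [/\ G1 != 0, G3 != 0, G6 != 0 & G8 != 0] -> [/\ H2 != 0, H4 != 0, H5 != 0 & H7 != 0] ->
  [/\ a != 0, a' != 0, b != 0 & b' != 0] ->
  (G1 * (c * H2) * G3 * (d' * H4)) / ((b * H5) * G6 * (a' * H7) * G8) *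
  ((H5 * (d * G6) * H7 * (c' * G8)) / ((a * G1) * H2 * (b' * G3) * H4)) =
  (c * c') * (d * d') / ((a * a') * (b * b')).
  move=> [? ? ? ?] [? ? ? ?] [? ? ? ?]; field.
  by do !(apply/andP; split).
rewrite K //.
rewrite B1 B2 B3 B4.
move: Ee s1 s3 (epi_neq0 (- x)) (epi_neq0 (x + Nc * zeta)).
move: (sig (- x - Nc * zeta + zeta)) (sig (x + zeta)) (sig (x + Nc * zeta)) (sig x)
  (epi (- x)) (epi (x + Nc * zeta)) (epi (2 * zeta - _)) (epi (x + zeta)) (epi (- x - Nc * zeta + zeta)).
move=> t1 t2 t3 t4 e1 e2 e3 e4 e5 E' s1 s3 e10 e20.
transitivity ((e4 * e5) * (t2 * t1) / ((e1 * (- t4)) * (e2 * t3))); first by congr (_ / _); ring.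
by rewrite -E'; field; rewrite s1 s3 e10 e20.
Qed.

Lemma cR_cross x : reg x != 0 -> reg (x + Nc * zeta) != 0 ->
  cR x * cR (- x - Nc * zeta) * - (sig x * sig (x + Nc * zeta) / sig zeta ^+ 2) = 1.
Proof.
move=> r1 r2; have [_ _ s1 s2 _] := reg_neq0 r1; have [_ _ s3 _ s4] := reg_neq0 r2.
have s5 : sig (- x - Nc * zeta + zeta) != 0.
  have -> : - x - Nc * zeta + zeta = - (x + Nc * zeta - zeta) by ring.
  by rewrite sigmaN // oppr_eq0.
have Kc := kappa_cross r1 r2.
have Ee : epi ((2 / Nc - 2) * x) * epi ((2 / Nc - 2) * (- x - Nc * zeta)) *
  epi (2 * zeta - 2 * Nc * zeta) = 1 by rewrite -!epiD -[RHS]epi0; congr epi; field.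
rewrite /cR; move: Kc Ee s1 s2 s3 s5 zeta_reg.
move: (kappaV N x zeta tau) (kappaV N (- x - _) zeta tau) => k k'.
move: (sig (- x - Nc * zeta + zeta)) (sig (x + zeta)) (sig (x + Nc * zeta)) (sig x) (sig zeta)
  (epi (2 * zeta - _)) (epi (_ * x)) (epi (_ * (- x - _))).
move=> t1 t2 t3 t4 t5 e3 e1 e2 Ek E s1 s2 s3 s5 s6.
transitivity (e1 * e2 * (k * k') * - (t5 / t2 * (t5 / t1) * (t4 * t3 / t5 ^+ 2))); first by ring.
rewrite Ek -E; field; by rewrite s1 s2 s3 s5 s6.
Qed.

Lemma ftau_poles x : gen x -> poP (- x) != 0 /\ poP (Nc * zeta + x) != 0.
Proof.
move=> H; split; apply: poP_neq0; first exact: genN.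
by apply: (gen_zeta (b := N%:Z) H); rewrite -pmulrn; ring.
Qed.

(** Here the quotients of double products are simple products in powers of q^(2N), the
    same ones as in tau_N. *)
Lemma kappa_tau x : gen x ->
  kappaV N (x + tau + 1) zeta tau * (poP (zeta + x) * poP ((Nc - 1) * zeta - x) *
    (poP (zeta - x - tau) * poP ((Nc - 1) * zeta + x + tau))) =
  kappaV N x zeta tau * (poP (- x) * poP (Nc * zeta + x) *
    (poP (x + tau) * poP (Nc * zeta - x - tau))).
Proof.
move=> H; rewrite !kappaVE.
have gam1 y z : z = y + 1 -> gam y = gam z.
  by move=> ->; rewrite /gam mulrDr epiD mulr1 epi2 mulr1.
have gam1' y z : z = y - 1 -> gam y = gam z by move=> ->; apply: esym; apply: gam1; ring.
have E1 : knum (x + tau + 1) = gam (Nc * zeta - x - tau) * gam (zeta + x + tau) * gam (- x) *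
   gam (tau + (Nc - 1) * zeta + x + tau).
  rewrite /knum (gam1 (Nc * zeta - (x + tau + 1)) (Nc * zeta - x - tau)); last by ring.
  rewrite (gam1' (zeta + (x + tau + 1)) (zeta + x + tau)); last by ring.
  rewrite (gam1 (tau - (x + tau + 1)) (- x)); last by ring.
  by rewrite (gam1' (tau + (Nc - 1) * zeta + (x + tau + 1)) (tau + (Nc - 1) * zeta + x + tau)) //; ring.
have E2 : knum (- (x + tau + 1)) = gam (Nc * zeta + x + tau) * gam (zeta - x - tau) *
   gam (x + tau + tau) * gam ((Nc - 1) * zeta - x).
  rewrite /knum (gam1' (Nc * zeta - - (x + tau + 1)) (Nc * zeta + x + tau)); last by ring.
  rewrite (gam1 (zeta - (x + tau + 1)) (zeta - x - tau)); last by ring.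
  rewrite (gam1' (tau - - (x + tau + 1)) (x + tau + tau)); last by ring.
  by rewrite (gam1 (tau + (Nc - 1) * zeta - (x + tau + 1)) ((Nc - 1) * zeta - x)) //; ring.
have F1 : knum x = gam (Nc * zeta - x) * gam (zeta + x) * gam (tau - x) * gam (tau + (Nc - 1) * zeta + x) := erefl _.
have F2 : knum (- x) = gam (Nc * zeta + x) * gam (zeta - x) * gam (x + tau) * gam (tau + (Nc - 1) * zeta - x).
  rewrite /knum !opprK (addrC tau x); exact: erefl.
have gamT y z : z = y + tau -> gam y = poP y * gam z by move=> ->; exact: gam_tau.
have A1 := gamT (Nc * zeta - x - tau) (Nc * zeta - x) ltac:(ring).
have A2 := gamT (zeta + x) (zeta + x + tau) ltac:(ring).
have A3 := gamT (- x) (tau - x) ltac:(ring).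
have A4 := gamT (tau + (Nc - 1) * zeta + x) (tau + (Nc - 1) * zeta + x + tau) ltac:(ring).
have A5 := gamT (Nc * zeta + x) (Nc * zeta + x + tau) ltac:(ring).
have A6 := gamT (zeta - x - tau) (zeta - x) ltac:(ring).
have A7 := gamT (x + tau) (x + tau + tau) ltac:(ring).
have A8 := gamT ((Nc - 1) * zeta - x) (tau + (Nc - 1) * zeta - x) ltac:(ring).
have S1 : (Nc - 1) * zeta + x + tau = tau + (Nc - 1) * zeta + x by ring.
have k1 := knum_neq0 H; have k2 := knum_neq0 (genN H).
have F : gen (- (x + tau + 1)) by apply/genN/gen_int; have := gen_shift 1 0 H; congr gen; ring.
have k3 := knum_neq0 F.
rewrite E2 in k3; rewrite E1 E2 S1.
rewrite F2 in k2; rewrite F1 in k1; rewrite F1 F2.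
move: k1 k2 k3; rewrite A1 A2 A3 A4 A5 A6 A7 A8.
have K (a1 a2 a3 a4 a5 a6 a7 a8 g1 g2 g3 g4 g5 g6 g7 g8 : C) :
  g1 * (a2 * g2) * g3 * (a4 * g4) != 0 -> (a5 * g5) * g6 * (a7 * g7) * g8 != 0 ->
  g5 * (a6 * g6) * g7 * (a8 * g8) != 0 ->
  (a1 * g1 * g2 * (a3 * g3) * g4) / (g5 * (a6 * g6) * g7 * (a8 * g8)) * (a2 * a8 * (a6 * a4)) =
  (g1 * (a2 * g2) * g3 * (a4 * g4)) / ((a5 * g5) * g6 * (a7 * g7) * g8) * (a3 * a5 * (a7 * a1)).
  rewrite !mulf_eq0 !negb_or => /andP[/andP[/andP[? /andP[? ?]] ?] /andP[? ?]].
  move=> /andP[/andP[/andP[/andP[? ?] ?] /andP[? ?]] ?] /andP[/andP[/andP[? /andP[? ?]] ?] /andP[? ?]].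
  by field; do !(apply/andP; split).
by move=> k1 k2 k3; apply: K.
Qed.

Lemma cR_tau x : gen x ->
  ftau x * ftau (- (x + tau + 1)) * cR (x + tau + 1) * epi (- tau - 2 * x - 2 * (zeta / Nc)) = cR x.
Proof.
move=> H.
have gt : gen (x + tau) by have := gen_shift 1 0 H; congr gen; ring.
rewrite !ftauE.
have poP1 y z : z = y + 1 -> poP y = poP z.
  by move=> ->; rewrite /poP mulrDr epiD mulr1 epi2 mulr1.
have poP1' y z : z = y - 1 -> poP y = poP z by move=> ->; apply: esym; apply: poP1; ring.
rewrite (poP1 (zeta - (x + tau + 1)) (zeta - x - tau)); last by ring.
rewrite (poP1' ((Nc - 1) * zeta - - (x + tau + 1)) ((Nc - 1) * zeta + x + tau)); last by ring.
rewrite (poP1' (- - (x + tau + 1)) (x + tau)); last by ring.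
rewrite (poP1 (Nc * zeta - (x + tau + 1)) (Nc * zeta - x - tau)); last by ring.
have Kt := kappa_tau H.
have Es : sig (x + tau + 1 + zeta) = epi (- tau - 2 * (x + zeta)) * sig (x + zeta).
  have -> : x + tau + 1 + zeta = x + zeta + (1%:~R * tau + 1%:~R) by ring.
  have -> : epi (- tau - 2 * (x + zeta)) =
    epi (1%:~R + 1%:~R - 2 * 1%:~R * (x + zeta) - 1%:~R ^+ 2 * tau).
    rewrite -[LHS]mul1r -[X in X * _](epi2 R) -[LHS]epiD; congr epi; ring.
  exact: sigma_lattice.
have Ee : epi ((2 / Nc - 2) * (zeta / 2 + x)) * epi ((2 / Nc - 2) * (zeta / 2 - (x + tau + 1))) *
   epi ((2 / Nc - 2) * (x + tau + 1)) * epi (- tau - 2 * x - 2 * (zeta / Nc)) =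
   epi ((2 / Nc - 2) * x) * epi (- tau - 2 * (x + zeta)).
  by rewrite -!epiD; congr epi; field.
have n1 : poP (- x) != 0 by apply: poP_neq0; exact: genN.
have n2 : poP (Nc * zeta + x) != 0.
  by apply: poP_neq0; apply: (gen_zeta (b := N%:Z) H); rewrite -pmulrn; ring.
have n3 : poP (x + tau) != 0 by exact: poP_neq0.
have n4 : poP (Nc * zeta - x - tau) != 0.
  by apply: poP_neq0; apply: (gen_zeta (b := N%:Z) (genN gt)); rewrite -pmulrn; ring.
rewrite /cR Es; move: Kt Ee n1 n2 n3 n4 (epi_neq0 (- tau - 2 * (x + zeta))).
move: (poP (zeta + x)) (poP ((Nc - 1) * zeta - x)) (poP (zeta - x - tau)) (poP ((Nc - 1) * zeta + x + tau))
  (poP (- x)) (poP (Nc * zeta + x)) (poP (x + tau)) (poP (Nc * zeta - x - tau)) (kappaV N x zeta tau)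
  (kappaV N (x + tau + 1) zeta tau) => a1 a2 a3 a4 b1 b2 b3 b4 k k'.
move: (sig zeta) (sig (x + zeta)) => s1 s2.
move: (epi (_ * (zeta / 2 + x))) (epi (_ * (zeta / 2 - _))) (epi (_ * (x + tau + 1)))
  (epi (- tau - 2 * x - _)) (epi ((2 / Nc - 2) * x)) (epi (- tau - 2 * (x + zeta))).
move=> e1 e2 e3 e4 e5 e6 Kt Ee n1 n2 n3 n4 n5; rewrite (invfM e6); move: s2^-1 => {}s2.
transitivity ((e1 * e2 * e3 * e4) * (k' * (a1 * a2 * (a3 * a4))) / (b1 * b2 * (b3 * b4)) * (s1 * (e6^-1 * s2))).
  by field; rewrite n1 n2 n3 n4 n5.
by rewrite Ee Kt; field; rewrite n1 n2 n3 n4 n5.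
Qed.

Local Notation gh := (gmx_half R N).
Local Notation gh' := (invmx (gmx_half R N)).
Local Notation G := (gh *t gh).
Local Notation G' := (gh' *t gh').
Local Notation Pf := (flip R N).
Local Notation V x := (Vmx N tau x zeta).

Lemma gmx_halfK : gh *m gh' = 1%:M.
Proof.
pose D : 'M[C]_N := \matrix_(i, j) (epi (- (i%:R / Nc)) *+ (i == j)).
have H : gh *m D = 1%:M.
  apply/matrixP => i j; rewrite !mxE (bigD1 i) //= !mxE eqxx mulr1n big1 ?addr0.
    by rewrite mulrnAr -epiD subrr epi0.
  by move=> k ki; rewrite !mxE eq_sym (negPf ki) mulr0n mul0r.
by have [U _] := mulmx1_unit H; rewrite mulmxV.
Qed.

Lemma gmx_halfKV : gh' *m gh = 1%:M.
Proof. exact: mulmx1C gmx_halfK. Qed.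

(** The quotient of theta functions in R is independent of the normalization of
    theta, so that sigma can replace it. *)
Lemma RmxE x : Rmx N x zeta tau = cR x *: (G *m V x *m G').
Proof.
have [c c0 Hc] := theta_sigma tau1.
have th y : theta (1 / 2) (1 / 2) y tau = c * sig y.
  have := Hc 0 0 y; rewrite !addr0 mul0r addr0 expr0n /= mul0r mulr0 mul0r addr0.
  by rewrite epi0 mulr1.
rewrite /Rmx /Rtilde !th -[LHS]mulmxA -/(Vmx N tau x zeta).
rewrite -scalemxAl -scalemxAr -[X in _ = _ *: X]mulmxA; congr (_ *: _).
rewrite /cR; congr (_ * _); rewrite invfM mulrACA divff // mul1r //.
Qed.

Lemma flip_G : Pf *m G = G *m Pf.
Proof. by rewrite -[in RHS](flip_conj_tens gh gh) -[RHS]mulmxA flipK mulmx1. Qed.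

Lemma flip_G' : Pf *m G' = G' *m Pf.
Proof. by rewrite -[in RHS](flip_conj_tens gh' gh') -[RHS]mulmxA flipK mulmx1. Qed.

Lemma R21E x : R21 N x zeta tau = cR x *: (G *m (Pf *m V x *m Pf) *m G').
Proof.
rewrite /R21 RmxE -[LHS]mulmxA -scalemxAl -[LHS]scalemxAr; congr (_ *: _).
by rewrite !mulmxA flip_G -!mulmxA flip_G'.
Qed.

Lemma R_unit x : reg x != 0 -> Rmx N x zeta tau *m R21 N (- x) zeta tau = 1%:M.
Proof.
move=> rx; rewrite RmxE R21E -[LHS]scalemxAl -[X in _ *: X]scalemxAr [LHS]scalerA.
have GG : G' *m G = 1%:M by rewrite tensmx_mul gmx_halfKV tens11.
have GG2 : G *m G' = 1%:M by rewrite tensmx_mul gmx_halfK tens11.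
have -> : G *m V x *m G' *m (G *m (Pf *m V (- x) *m Pf) *m G') =
  G *m (V x *m (Pf *m V (- x) *m Pf)) *m G'.
  by rewrite !mulmxA -[G *m V x *m G' *m G]mulmxA GG mulmx1.
rewrite Vmx_unit // mul_mx_scalar -scalemxAl GG2 scalerA cR_unit // scale1r //.
Qed.

Lemma delta_tens (i k j l : 'I_N) :
  delta_mx (mxtens_index (i, k)) (mxtens_index (j, l)) = delta_mx i j *t delta_mx k l :> 'M[C]_(N * N).
Proof.
have inj (a b c d : 'I_N) : (mxtens_index (a, b) == mxtens_index (c, d)) = (a == c) && (b == d).
  by rewrite (inj_eq (can_inj (@mxtens_indexK N N))).
apply/matrixP => x y; case: (mxtens_indexP x) => a b; case: (mxtens_indexP y) => c d.
by rewrite tensmxE !mxE !inj -natrM mulnb andbACA.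
Qed.

(** Under partial transposition the matrices that act on the second factor change
    sides. *)
Lemma tr2_conj (A B D E : 'M[C]_N) (M : 'M[C]_(N * N)) :
  tr2 ((A *t B) *m M *m (D *t E)) = (A *t E^T) *m tr2 M *m (D *t B^T).
Proof.
have tr2s n (F : 'I_n -> 'M[C]_(N * N)) : tr2 (\sum_i F i) = \sum_i tr2 (F i).
  exact: (big_morph _ (@tr2D R N) (@tr20 R N)).
rewrite [M in LHS]matrix_sum_delta [M in RHS]matrix_sum_delta.
rewrite mulmx_sumr mulmx_suml !tr2s mulmx_sumr mulmx_suml; apply: eq_bigr => x _.
rewrite mulmx_sumr mulmx_suml !tr2s mulmx_sumr mulmx_suml; apply: eq_bigr => y _.
rewrite -scalemxAr -scalemxAl !tr2Z -scalemxAr -scalemxAl; congr (_ *: _).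
case: (mxtens_indexP x) => i k; case: (mxtens_indexP y) => j l.
by rewrite delta_tens !tensmx_mul !tr2_tens !tensmx_mul !trmx_mul mulmxA.
Qed.

Lemma R_cross x : reg x != 0 -> reg (x + Nc * zeta) != 0 ->
  tr2 (Rmx N x zeta tau) *m tr2 (R21 N (- x - Nc * zeta) zeta tau) = 1%:M.
Proof.
move=> r1 r2; have [_ _ s1 _ _] := reg_neq0 r1; have [_ _ s3 _ _] := reg_neq0 r2.
rewrite RmxE R21E !tr2Z !tr2_conj -[LHS]scalemxAl -[X in _ *: X]scalemxAr [LHS]scalerA.
have E1 : (gh' *t gh^T) *m (gh *t gh'^T) = 1%:M.
  by rewrite tensmx_mul gmx_halfKV -trmx_mul gmx_halfKV trmx1 tens11.
have E2 : (gh *t gh'^T) *m (gh' *t gh^T) = 1%:M by exact: mulmx1C.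
set X := tr2 (V x); set Y := tr2 (Pf *m _ *m Pf).
have -> : (gh *t gh'^T) *m X *m (gh' *t gh^T) *m ((gh *t gh'^T) *m Y *m (gh' *t gh^T)) =
   (gh *t gh'^T) *m (X *m Y) *m (gh' *t gh^T).
  by rewrite -[LHS]mulmxA [X in _ *m X]mulmxA [X in _ *m (X *m _)]mulmxA E1 mul1mx !mulmxA.
rewrite /X /Y Vmx_cross // mul_mx_scalar -scalemxAl E2 scalerA cR_cross // scale1r //.
Qed.

(** Quasi-periodicity, in the form R^(- p^(1/2) x) = tau_N(q^(1/2) x)^-1 G^-1 R(x) G, with
    R^ the rescaled matrix of the exchange relation and G the twist that defines
    L^-. *)
Lemma R_tau x : gen x ->
  ftau x *: ((twist R N *t 1%:M) *m Rhat N (x + tau + 1) zeta tau) =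
  Rmx N x zeta tau *m (twist R N *t 1%:M).
Proof.
move=> H; set T := twist R N *t 1%:M.
have Gg : gh *m gh = gmx R N.
  apply/matrixP => i j; rewrite !mxE (bigD1 i) //= !mxE eqxx mulr1n big1 ?addr0.
    rewrite mulrnAr -epiD epi_pow; congr (epi _ *+ _); by field.
  by move=> k ki; rewrite !mxE eq_sym (negPf ki) mulr0n mul0r.
have E1 : T *m G = chi R N 1 *: (G *m (Iz R N 1 1 *t 1%:M)).
  rewrite /T 2!tensmx_mul mul1mx mulmx1 -tensZl; congr (_ *t _).
  have -> : twist R N *m gh = gh *m (hmx R N *m (gh *m gh)) by rewrite /twist -!mulmxA.
  by rewrite Gg gmx_Iz // hmx_Iz // Iz_mul // mul1r addr0 add0r -scalemxAr.
have E2 : G' *m T = (hmx R N *t 1%:M) *m (gh *t gh').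
  rewrite /T 2!tensmx_mul mul1mx mulmx1; congr (_ *t _).
  by rewrite /twist !mulmxA gmx_halfKV mul1mx.
have E3 : chi R N 1 *: (Iz R N 1 1 *t 1%:M *m G') = (hmx R N *t 1%:M) *m (gh *t gh').
  rewrite !tensmx_mul !mul1mx -tensZl; congr (_ *t _).
  have -> : chi R N 1 *: (Iz R N 1 1 *m gh') = (chi R N 1 *: Iz R N 1 1) *m gh' by rewrite -scalemxAl.
  have -> : chi R N 1 *: Iz R N 1 1 = hmx R N *m gmx R N.
    by rewrite gmx_Iz // hmx_Iz // Iz_mul // mul1r addr0 add0r.
  by rewrite -Gg -!mulmxA gmx_halfK mulmx1.
have E4 : T *m (G *m V (x + tau + 1) *m G') =
  epi (- tau - 2 * x - 2 * (zeta / Nc)) *: (G *m V x *m G' *m T).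
  have -> : T *m (G *m V (x + tau + 1) *m G') = (T *m G) *m V (x + tau + 1) *m G' by rewrite !mulmxA.
  rewrite E1 -[X in X *m G' = _]scalemxAl -[LHS]scalemxAl.
  set e := epi _; have E5 : G *m (Iz R N 1 1 *t 1%:M) *m V (x + tau + 1) = e *: (G *m V x *m (Iz R N 1 1 *t 1%:M)).
    by rewrite -[LHS]mulmxA Vmx_shift // -[LHS]scalemxAr mulmxA.
  rewrite E5 -[X in _ *: X]scalemxAl [LHS]scalerA [X in X *: _]mulrC -[LHS]scalerA; congr (_ *: _).
  rewrite -[RHS]mulmxA E2 -E3 -[RHS]scalemxAr; congr (_ *: _).
  by rewrite -[LHS]mulmxA.
rewrite /Rhat !RmxE -[T *m _]scalemxAr -[T *m _]scalemxAr E4 !scalerA -[RHS]scalemxAl.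
congr (_ *: _); rewrite -[RHS](cR_tau H) /ftau.
by congr (_ * epi _); rewrite [LHS]mulrA.
Qed.

Lemma ftau_neq0 x : gen x -> ftau x != 0.
Proof.
move=> H; have H' := genN H; rewrite ftauE; apply: mulf_neq0; first exact: epi_neq0.
have a1 : poP (zeta + x) != 0 by apply: poP_neq0; apply: (gen_zeta (b := 1) H); ring.
have a2 : poP ((Nc - 1) * zeta - x) != 0.
  by apply: poP_neq0; apply: (gen_zeta (b := N%:Z - 1) H'); rewrite rmorphB /= -pmulrn; ring.
have a3 : poP (- x) != 0 by exact: poP_neq0.
have a4 : poP (Nc * zeta + x) != 0.
  by apply: poP_neq0; apply: (gen_zeta (b := N%:Z) H); rewrite -pmulrn; ring.
by apply: mulf_neq0; [apply: mulf_neq0|rewrite invr_eq0; apply: mulf_neq0].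
Qed.

Lemma dif_ftau x : gen x -> dif ftau x.
Proof.
move=> H; have k a b y : dif (fun y => poP (a + b * y)) y by apply: dif_comp_aff => ?; exact: dif_poP.
have n3 : poP (0 + -1 * x) != 0 by rewrite add0r mulN1r; apply: poP_neq0; exact: genN.
have n4 : poP (Nc * zeta + 1 * x) != 0.
  by rewrite mul1r; apply: poP_neq0; apply: (gen_zeta (b := N%:Z) H); rewrite -pmulrn; ring.
apply: (eq_dif (f := fun y => epi ((2 / Nc - 2) * (zeta / 2) + (2 / Nc - 2) * y) *
  (poP (zeta + 1 * y) * poP ((Nc - 1) * zeta + (-1) * y) *
  (poP (0 + (-1) * y) * poP (Nc * zeta + 1 * y))^-1))).
  by move=> y; rewrite ftauE !mul1r !mulN1r add0r mulrDr.
apply: dif_mul; first by apply: dif_comp_aff => ?; exact: dif_epi.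
apply: dif_mul; first exact: dif_mul.
by apply: dif_inv; [exact: mulf_neq0|exact: dif_mul].
Qed.

Lemma dif_cR x : reg x != 0 -> dif cR x.
Proof.
move=> /reg_neq0[_ k0 _ s0 _].
have k b y : dif (fun y => knum (0 + b * y)) y by apply: dif_comp_aff => ?; exact: dif_knum.
apply: (eq_dif (f := fun y => epi (0 + (2 / Nc - 2) * y) * (knum (0 + 1 * y) * (knum (0 + (-1) * y))^-1) *
  (sig zeta * (sig (zeta + 1 * y))^-1))).
  by move=> y; rewrite /cR kappaVE !add0r mulN1r !mul1r [zeta + y]addrC.
apply: dif_mul; first apply: dif_mul.
- by apply: dif_comp_aff => ?; exact: dif_epi.
- apply: dif_mul; first exact: k.
  by apply: dif_inv; [rewrite add0r mulN1r|exact: k].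
- apply: dif_mul; first exact: dif_cst.
  apply: dif_inv; first by rewrite mul1r addrC.
  by apply: dif_comp_aff => ?; exact: dif_sig.
Qed.

Lemma dif_Vmx x i j : dif (fun y => V y i j) x.
Proof.
pose W1 a b y := w tau N a b (y / Nc) (zeta / Nc).
have wd (a b : int) : dif (W1 a b) x.
  rewrite /W1 /w; apply: dif_mul; last exact: dif_cst.
  apply: dif_mul.
    apply: (eq_dif (f := fun y => epi (0 + (2 * a%:~R / Nc) * y))).
      by move=> y; congr epi; ring.
    by apply: dif_comp_aff => ?; exact: dif_epi.
  apply: (eq_dif (f := fun y => sig ((zeta / Nc + om tau N a b) + 1 * y))).
    by move=> y; congr (sig _); field.
  by apply: dif_comp_aff => ?; exact: dif_sig.
apply: (eq_dif (f := fun y => Nc^-1 * \sum_(a < N) \sum_(b < N) (W1 a b y * Jz R N a b i j))).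
  move=> y; rewrite VmxE // mxE; congr (_ * _); rewrite /Vm /sum2 summxE.
  by apply: eq_bigr => a _; rewrite summxE; apply: eq_bigr => b _; rewrite [RHS]mxE.
apply: dif_mul; first exact: dif_cst.
by apply: dif_sum => a; apply: dif_sum => b; apply: dif_mul => //; exact: dif_cst.
Qed.

Lemma dif_Rmx x i j : reg x != 0 -> dif (fun y => Rmx N y zeta tau i j) x.
Proof.
move=> r; apply: (eq_dif (f := fun y => cR y * \sum_k (\sum_l G i l * V y l k) * G' k j)).
  move=> y; rewrite RmxE mxE; congr (_ * _); rewrite mxE; apply: eq_bigr => k _.
  by congr (_ * _); rewrite [RHS]mxE.
apply: dif_mul; first exact: dif_cR.
apply: dif_sum => k; apply: dif_mul; last exact: dif_cst.
apply: dif_sum => l; apply: dif_mul; first exact: dif_cst.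
exact: dif_Vmx.
Qed.

End Scalars.

(** * Exchange relations *)

Section TensorLegs.
Variable R : realType.
Local Notation C := R[i].
Variables (N : nat) (A : algType C).
Implicit Types (X Y : 'M[A]_N) (M : 'M[A]_(N * N)).

Definition leg1 X : 'M[A]_(N * N) := X *t 1%:M.
Definition leg2 X : 'M[A]_(N * N) := 1%:M *t X.
(** Scalar matrices of operators: the complex matrices. *)
Definition scal n (M : 'M[C]_n) : 'M[A]_n := map_mx (in_alg A) M.

Lemma scalM n (M M' : 'M[C]_n) : scal (M *m M') = scal M *m scal M'.
Proof. exact: map_mxM. Qed.

Lemma scal1 n : scal (1%:M : 'M[C]_n) = 1%:M.
Proof. exact: map_mx1. Qed.

Lemma mul_mx_scalarE n (a : A) (M : 'M[A]_n) i j : (M *m a%:M) i j = M i j * a.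
Proof.
rewrite mxE (bigD1 j) //= big1 ?addr0; first by rewrite mxE eqxx mulr1n.
by move=> b bj; rewrite mxE (negPf bj) mulr0n mulr0.
Qed.

Lemma scal_central n (c : C) (M : 'M[A]_n) : scal c%:M *m M = M *m scal c%:M.
Proof.
have -> : scal (c%:M : 'M[C]_n) = (c%:A)%:M by exact: map_scalar_mx.
by apply/matrixP => i j; rewrite mul_mx_scalarE mul_scalar_mx mxE mulr_algl mulr_algr.
Qed.

Lemma scalZ n (c : C) (M : 'M[C]_n) : scal (c *: M) = scal c%:M *m scal M.
Proof. by rewrite -scalM mul_scalar_mx. Qed.

Lemma scal_leg1 (B : 'M[C]_N) : scal (B *t 1%:M) = leg1 (scal B).
Proof. by rewrite /scal /leg1 map_mxT map_mx1. Qed.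

Lemma sum_tens (V : nmodType) (F : 'I_(N * N) -> V) :
  \sum_x F x = \sum_i \sum_k F (mxtens_index (i, k)).
Proof.
rewrite pair_bigA /= (reindex (@mxtens_index N N)) /=; last first.
  exists (@mxtens_unindex N N) => x _; [exact: mxtens_indexK|exact: mxtens_unindexK].
by apply: eq_bigr => -[i k] _.
Qed.

Lemma leg1_mull X M i k y :
  (leg1 X *m M) (mxtens_index (i, k)) y = \sum_a X i a * M (mxtens_index (a, k)) y.
Proof.
rewrite mxE sum_tens; apply: eq_bigr => a _.
rewrite (bigD1 k) //= tensmxE [1%:M k k]mxE eqxx mulr1 big1 ?addr0 // => b bk.
by rewrite tensmxE mxE eq_sym (negPf bk) mulr0 mul0r.
Qed.

Lemma leg1_mulr X M x j l :
  (M *m leg1 X) x (mxtens_index (j, l)) = \sum_a M x (mxtens_index (a, l)) * X a j.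
Proof.
rewrite mxE sum_tens; apply: eq_bigr => a _.
rewrite (bigD1 l) //= tensmxE [1%:M l l]mxE eqxx mulr1 big1 ?addr0 // => b bl.
by rewrite tensmxE mxE (negPf bl) !mulr0.
Qed.

Lemma leg2_mulr X M x j l :
  (M *m leg2 X) x (mxtens_index (j, l)) = \sum_b M x (mxtens_index (j, b)) * X b l.
Proof.
rewrite mxE sum_tens (bigD1 j) //= [X in _ + X]big1 => [|a aj].
  by rewrite addr0; apply: eq_bigr => b _; rewrite tensmxE mxE eqxx mul1r.
by apply: big1 => b _; rewrite tensmxE mxE (negPf aj) mul0r mulr0.
Qed.

Lemma leg1E X i k j l : leg1 X (mxtens_index (i, k)) (mxtens_index (j, l)) = X i j *+ (k == l).
Proof. by rewrite tensmxE mxE mulr_natr. Qed.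

Lemma leg2E X i k j l : leg2 X (mxtens_index (i, k)) (mxtens_index (j, l)) = X k l *+ (i == j).
Proof. by rewrite tensmxE mxE mulr_natl. Qed.

Lemma leg1M X Y : leg1 X *m leg1 Y = leg1 (X *m Y).
Proof.
apply/matrixP => x y; case: (mxtens_indexP x) => i k; case: (mxtens_indexP y) => j l.
rewrite leg1_mull leg1E mxE -sumrMnl; apply: eq_bigr => a _.
by rewrite leg1E mulrnAr.
Qed.

Lemma leg1_1 : leg1 1%:M = 1%:M.
Proof.
apply/matrixP => x y; case: (mxtens_indexP x) => i k; case: (mxtens_indexP y) => j l.
rewrite leg1E !mxE (inj_eq (can_inj (@mxtens_indexK N N))) xpair_eqE -mulrnA.
by case: (i == j); case: (k == l).
Qed.

Lemma leg2_leg1E X Y i k j l :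
  (leg2 X *m leg1 Y) (mxtens_index (i, k)) (mxtens_index (j, l)) = X k l * Y i j.
Proof.
rewrite leg1_mulr (bigD1 i) //= leg2E eqxx big1 ?addr0 // => a ai.
by rewrite leg2E eq_sym (negPf ai) mul0r.
Qed.

Lemma leg1_leg2E X Y i k j l :
  (leg1 X *m leg2 Y) (mxtens_index (i, k)) (mxtens_index (j, l)) = X i j * Y k l.
Proof.
rewrite leg2_mulr (bigD1 k) //= leg1E eqxx big1 ?addr0 // => a ai.
by rewrite leg1E eq_sym (negPf ai) mul0r.
Qed.

Lemma scal_leg12 (B : 'M[C]_N) X : leg1 (scal B) *m leg2 X = leg2 X *m leg1 (scal B).
Proof.
apply/matrixP => x y; case: (mxtens_indexP x) => i k; case: (mxtens_indexP y) => j l.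
by rewrite leg1_leg2E leg2_leg1E mxE mulr_algl mulr_algr.
Qed.

(** An exchange relation between an operator X on the first leg and an operator Y on
    the second makes the trace of X commute with the entries of Y, provided the two
    scalar matrices have the same inverse up to partial transposition: multiplying by
    that inverse and taking the trace over the first leg removes both at once. *)
Lemma trace_commute (B B' Q : 'M[C]_(N * N)) X Y :
  leg1 X *m scal B *m leg2 Y = scal B' *m leg2 Y *m leg1 X ->
  tr2 B *m Q = 1%:M -> tr2 Q *m B' = 1%:M ->
  forall j m, \tr X * Y j m = Y j m * \tr X.
Proof.
move=> E BQ QB j m.
pose o (x : 'I_(N * N)) := (mxtens_unindex x).1; pose t (x : 'I_(N * N)) := (mxtens_unindex x).2.
have oE i k : o (mxtens_index (i, k)) = i by rewrite /o mxtens_indexK.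
have tE i k : t (mxtens_index (i, k)) = k by rewrite /t mxtens_indexK.
have EL a x : \sum_y tr2 B y x *: (X a (o y) * Y (t y) m) =
  (leg1 X *m scal B *m leg2 Y) (mxtens_index (a, t x)) (mxtens_index (o x, m)).
  case: (mxtens_indexP x) => b k; rewrite oE tE leg2_mulr sum_tens exchange_big.
  apply: eq_bigr => d _; rewrite leg1_mull mulr_suml; apply: eq_bigr => c _.
  by rewrite oE tE tr2E mxE mulr_algr -scalerAl.
have ER a x : \sum_y B' (mxtens_index (a, t x)) y *: (Y (t y) m * X (o y) (o x)) =
  (scal B' *m leg2 Y *m leg1 X) (mxtens_index (a, t x)) (mxtens_index (o x, m)).
  case: (mxtens_indexP x) => b k; rewrite oE tE -mulmxA mxE; apply: eq_bigr => y _.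
  case: (mxtens_indexP y) => c d; rewrite oE tE leg2_leg1E mxE mulr_algl.
  by [].
have EE a x := etrans (EL a x) (etrans (congr1 (fun M : 'M[A]_(N * N) => M _ _) E) (esym (ER a x))).
have QQ : \sum_a \sum_x Q x (mxtens_index (a, j)) *: (\sum_y tr2 B y x *: (X a (o y) * Y (t y) m)) =
   \tr X * Y j m.
  rewrite /mxtrace mulr_suml; apply: eq_bigr => a _.
  transitivity (\sum_y (tr2 B *m Q) y (mxtens_index (a, j)) *: (X a (o y) * Y (t y) m)).
    under eq_bigr do rewrite scaler_sumr.
    rewrite exchange_big; apply: eq_bigr => y _; rewrite mxE scaler_suml.
    by apply: eq_bigr => x _; rewrite scalerA mulrC.
  rewrite BQ (bigD1 (mxtens_index (a, j))) //= mxE eqxx scale1r oE tE big1 ?addr0 // => y yn.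
  by rewrite mxE (negPf yn) scale0r.
have Q2 : \sum_a \sum_x Q x (mxtens_index (a, j)) *:
  (\sum_y B' (mxtens_index (a, t x)) y *: (Y (t y) m * X (o y) (o x))) = Y j m * \tr X.
  transitivity (\sum_b \sum_y (tr2 Q *m B') (mxtens_index (b, j)) y *: (Y (t y) m * X (o y) b)).
    under eq_bigr do rewrite sum_tens.
    rewrite exchange_big; apply: eq_bigr => b _.
    under [RHS]eq_bigr do rewrite mxE sum_tens scaler_suml.
    rewrite [RHS]exchange_big; apply: eq_bigr => a _.
    under [RHS]eq_bigr do rewrite scaler_suml.
    rewrite [RHS]exchange_big; apply: eq_bigr => k _.
    rewrite oE tE scaler_sumr; apply: eq_bigr => y _.
    by rewrite scalerA tr2E.
  rewrite QB /mxtrace mulr_sumr; apply: eq_bigr => b _.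
  rewrite (bigD1 (mxtens_index (b, j))) //= mxE eqxx scale1r oE tE big1 ?addr0 // => y yn.
  by rewrite mxE eq_sym (negPf yn) scale0r.
rewrite -QQ -Q2; apply: eq_bigr => a _; apply: eq_bigr => x _; congr (_ *: _); exact: EE.
Qed.

(** Commuting with all entries of a matrix passes to its inverse. *)
Lemma commute_inverse (a : A) X Y : is_inverse X Y ->
  (forall i j, a * X i j = X i j * a) -> forall i j, a * Y i j = Y i j * a.
Proof.
move=> [XY YX] H i j.
have E : a%:M *m X = X *m a%:M.
  by apply/matrixP => k l; rewrite mul_mx_scalarE mul_scalar_mx mxE.
have F : a%:M *m Y = Y *m a%:M.
  by rewrite -[LHS]mul1mx -YX -!mulmxA [X *m _]mulmxA -E -mulmxA XY mulmx1.
by have := congr1 (fun M : 'M[A]_N => M i j) F; rewrite mul_scalar_mx mxE mul_mx_scalarE.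
Qed.

End TensorLegs.

Section ExchangeAlgebra.
Variables (A : pzRingType) (n : nat).
Implicit Types (X Y l : 'M[A]_n).

(** Transport of an exchange relation through a twist g of the first factor. *)
Lemma exchange_twist (g g' F Q Qh Qh' Q' l l' : 'M[A]_n) :
  Q *m g = F *m (g *m Qh) -> Q' = g *m (F *m Qh') *m g' -> Qh *m l *m l' = l' *m l *m Qh' ->
  g' *m g = 1%:M -> g' *m l' = l' *m g' -> g *m l' = l' *m g -> (forall M, F *m M = M *m F) ->
  Q *m (g *m l *m g') *m l' = l' *m (g *m l *m g') *m Q'.
Proof.
move=> E1 -> E gg c' cg cF.
have -> : Q *m (g *m l *m g') *m l' = (Q *m g) *m l *m (g' *m l') by rewrite !mulmxA.
have -> : l' *m (g *m l *m g') *m (g *m (F *m Qh') *m g') =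
  l' *m g *m l *m (g' *m g) *m F *m Qh' *m g' by rewrite !mulmxA.
rewrite E1 c' gg mulmx1 -cF -cg.
have -> : F *m (g *m Qh) *m l *m (l' *m g') = F *m g *m (Qh *m l *m l') *m g' by rewrite !mulmxA.
by rewrite E !mulmxA.
Qed.

(** Two exchange relations with the same right-hand side matrix Q' combine into one
    for the product Y X^-1, from which Q' disappears. *)
Lemma exchange_quotient (Q Qi Q' Qi' P Pi X Xi Y l : 'M[A]_n) :
  Q *m X *m l = l *m X *m Q' -> P *m Y *m l = l *m Y *m Q' ->
  Qi *m Q = 1%:M -> Pi *m P = 1%:M -> Q' *m Qi' = 1%:M -> X *m Xi = 1%:M -> Xi *m X = 1%:M ->
  (Y *m Xi) *m Qi *m l = Pi *m l *m (Y *m Xi).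
Proof.
move=> EX EY QQ PP QQ' XX XX'.
have E1 : X *m l *m Qi' = Qi *m l *m X.
  have -> : X *m l = Qi *m (Q *m X *m l) by rewrite !mulmxA QQ mul1mx.
  by rewrite EX !mulmxA -[_ *m Q' *m Qi']mulmxA QQ' mulmx1.
have E2 : Xi *m Qi *m l = l *m Qi' *m Xi.
  have -> : l *m Qi' *m Xi = Xi *m (X *m l *m Qi') *m Xi by rewrite !mulmxA XX' mul1mx.
  by rewrite E1 !mulmxA -[_ *m X *m Xi]mulmxA XX mulmx1.
have E3 : Y *m l *m Qi' = Pi *m l *m Y.
  have -> : Y *m l = Pi *m (P *m Y *m l) by rewrite !mulmxA PP mul1mx.
  by rewrite EY !mulmxA -[_ *m Q' *m Qi']mulmxA QQ' mulmx1.
by rewrite -[Y *m Xi *m Qi]mulmxA -mulmxA E2 !mulmxA E3.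
Qed.

End ExchangeAlgebra.

(** * Centrality of t(z) *)

Section Centre.
Variable R : realType.
Local Notation C := R[i].
Variables (N : nat) (zeta tau : C) (A : algType C) (L K : C -> 'M[A]_N).
Hypothesis hN : (1 < N)%N.
Hypothesis zeta1 : `|epi zeta| < 1.
Hypothesis tau1 : `|epi (2 * tau)| < 1.
Local Notation Nc := (N%:R : C).
Local Notation c := (- Nc).
Let taus := tau_star c zeta tau.
Hypothesis zeta_reg : q_regular zeta tau.
Hypothesis zeta_regs : q_regular zeta taus.
Hypothesis hL : Aqp_gl c zeta tau L.
Hypothesis hK : forall xi : C, is_inverse (Lminus tau L xi) (K xi).

Let N0 : Nc != 0. Proof. by rewrite pnatr_eq0 -lt0n ltnW. Qed.

Lemma taus1 : `|epi (2 * taus)| < 1.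
Proof.
have -> : 2 * taus = 2 * tau + 2 * (Nc * zeta) by rewrite /taus /tau_star; ring.
rewrite epiD normrM; have h : `|epi (2 * (Nc * zeta))| < 1.
  by rewrite normE -(rmorph1 (real_complex R)) ltcR; exact: P_lt1.
by rewrite (le_lt_trans _ h) // ler_piMl // ltW.
Qed.

Lemma sig_zeta : sigma tau zeta != 0.
Proof. exact: sigma_neq0. Qed.

Lemma sigs_zeta : sigma taus zeta != 0.
Proof. by apply: sigma_neq0 => //; exact: taus1. Qed.

(** Since p* = p q^(2N), a power of p* and q^2 is one of p and q^2. *)
Lemma gens x : gen zeta tau x -> gen zeta taus x.
Proof.
move=> H a b; have := H a (b + a * N%:Z); rewrite !(rmorphD, rmorphM) /= -pmulrn.
by congr (epi _ != 1); rewrite /taus /tau_star; ring.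
Qed.

Lemma gen_generic t x : gen zeta t x -> generic zeta t x.
Proof.
move=> H a b; have := H (- a) (- b); apply: contraNN => /eqP E.
have -> : 2 * (x + ((- a)%:~R * t + (- b)%:~R * zeta)) =
  2 * x - (2 * (a%:~R * t) + 2 * (b%:~R * zeta)) by rewrite !mulrNz; ring.
by rewrite epiB E -epiD divff // epi_neq0.
Qed.

Local Notation Rm := (fun x => Rmx N x zeta tau).
Local Notation Rs := (fun x => Rmx N x zeta taus).
Local Notation R21m := (fun x => R21 N x zeta tau).
Local Notation R21s := (fun x => R21 N x zeta taus).
Local Notation sc := (@scal R A (N * N)).
Local Notation f := (ftau N zeta).

(** At c = - N both sides of the exchange relation carry the same factor tau_N. *)
Lemma cancel_scal (a : C) (M M' : 'M[C]_(N * N)) (X X' Y : 'M[A]_(N * N)) : a != 0 ->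
  sc (a *: M) *m X *m X' = Y *m sc (a *: M') -> sc M *m X *m X' = Y *m sc M'.
Proof.
move=> a0; rewrite !scalZ => E.
have aV : sc a^-1%:M *m sc a%:M = 1%:M by rewrite -scalM -scalar_mxM mulVf // scal1.
have -> : sc M *m X *m X' = sc a^-1%:M *m (sc a%:M *m sc M *m X *m X').
  by rewrite !mulmxA aV mul1mx.
rewrite E; have -> : Y *m (sc a%:M *m sc M') = sc a%:M *m (Y *m sc M').
  by rewrite !mulmxA scal_central.
by rewrite mulmxA aV mul1mx.
Qed.

Lemma exch z w : gen zeta tau (z - w) ->
  sc (Rm (z - w)) *m leg1 (L z) *m leg2 (L w) = leg2 (L w) *m leg1 (L z) *m sc (Rs (z - w)).
Proof.
move=> H; have g1 := gen_generic H; have g2 := gen_generic (gens H).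
have f0 : f (- (z - w)) != 0 := ftau_neq0 hN zeta1 tau1 (genN H).
by apply: (cancel_scal f0); exact: hL g1 g2.
Qed.

Lemma twist_unit : twist R N \in unitmx.
Proof.
have gu : gmx_half R N \in unitmx by have [] := mulmx1_unit (gmx_halfK R N).
have hu : hmx R N \in unitmx.
  by rewrite hmx_Iz //; have [] := mulmx1_unit (Iz_inv R hN 1 0).
by rewrite /twist !unitmx_mul gu hu.
Qed.

Local Notation G1 := (twist R N *t (1%:M : 'M[C]_N)).
Local Notation G1' := (invmx (twist R N) *t (1%:M : 'M[C]_N)).

Lemma G1K : G1 *m G1' = 1%:M.
Proof. by rewrite tensmx_mul mulmxV ?twist_unit // mulmx1 tens11. Qed.

Lemma G1KV : G1' *m G1 = 1%:M.
Proof. exact: mulmx1C G1K. Qed.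

Lemma leg1_Lminus z : leg1 (Lminus tau L z) = sc G1 *m leg1 (L (z + tau + 1)) *m sc G1'.
Proof. by rewrite /Lminus !scal_leg1 !leg1M. Qed.

(** Quasi-periodicity is applied on both sides of the exchange relation at the
    points - p^(1/2) z and w: with nome p at z / w on the left, and on the right with
    nome p*, at the point q^(- N) z / w because p^(1/2) = q^(- N) p*^(1/2).  The factors
    tau_N that appear agree by periodicity. *)
Lemma exch_minus z w : gen zeta tau (z - w) ->
  sc (Rm (z - w)) *m leg1 (Lminus tau L z) *m leg2 (L w) =
  leg2 (L w) *m leg1 (Lminus tau L z) *m sc (Rs (z - w - Nc * zeta)).
Proof.
move=> H; set y := z - w; set l1 := leg1 (L (z + tau + 1)); set l2 := leg2 (L w).
have gt : gen zeta tau (y + tau + 1).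
  by apply: gen_int; have := gen_shift 1 0 H; rewrite -/y; congr gen; ring.
have yE : z + tau + 1 - w = y + tau + 1 by rewrite /y; ring.
have gN : gen zeta tau (y - Nc * zeta).
  by apply: (gen_zeta (b := - N%:Z) H); rewrite mulrNz -pmulrn /y; ring.
have E : sc (Rhat N (y + tau + 1) zeta tau) *m l1 *m l2 =
    l2 *m l1 *m sc (Rhat N (y + tau + 1) zeta taus).
  have := hL (xi1 := z + tau + 1) (xi2 := w); rewrite yE; apply.
    exact: gen_generic.
  by apply: gen_generic; exact: gens.
have T1 := R_tau hN zeta1 tau1 H; rewrite -/y in T1.
have T2 := R_tau hN zeta1 taus1 (gens gN).
have yE2 : y - Nc * zeta + taus + 1 = y + tau + 1 by rewrite /taus /tau_star; ring.
rewrite yE2 in T2.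
have fE : f (y - Nc * zeta) = f y.
  have [n1 n2] := ftau_poles hN zeta1 tau1 gN.
  by rewrite -(ftau_periodic hN zeta1 n1 n2) subrK.
rewrite fE in T2.
have f3 : sc G1' *m l2 = l2 *m sc G1' by rewrite !scal_leg1 scal_leg12.
have f3' : sc G1 *m l2 = l2 *m sc G1 by rewrite !scal_leg1 scal_leg12.
have T3 : sc (Rs (y - Nc * zeta)) = sc G1 *m (sc (f y)%:M *m sc (Rhat N (y + tau + 1) zeta taus)) *m sc G1'.
  have -> : Rs (y - Nc * zeta) = G1 *m (f y *: Rhat N (y + tau + 1) zeta taus) *m G1'.
    by rewrite -scalemxAr T2 -mulmxA G1K mulmx1.
  by rewrite !scalM scalZ.
rewrite leg1_Lminus -/l1.
have T4 : sc (Rm y) *m sc G1 = sc (f y)%:M *m (sc G1 *m sc (Rhat N (y + tau + 1) zeta tau)).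
  by rewrite -[LHS]scalM -T1 scalZ scalM.
apply: (exchange_twist T4 T3 E _ f3 f3').
  by rewrite -scalM G1KV scal1.
by move=> M; exact: scal_central.
Qed.

Lemma R_unit_gen x : gen zeta tau x -> Rm x *m R21m (- x) = 1%:M.
Proof. by move=> H; exact: (R_unit hN tau1 sig_zeta (gen_reg hN zeta1 tau1 H)). Qed.

(** The relations of w with q^(- N) z and, for L^-, with z have the same right-hand
    matrix, which drops out of the quotient. *)
Lemma exch_calL z w : gen zeta tau (z - w) ->
  leg1 (calL c zeta L K z) *m sc (R21m (w - z)) *m leg2 (L w) =
  sc (R21m (w - z + Nc * zeta)) *m leg2 (L w) *m leg1 (calL c zeta L K z).
Proof.
move=> H; have [KX XK] := hK z.
have gN : gen zeta tau (z - w - Nc * zeta).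
  by apply: (gen_zeta (b := - N%:Z) H); rewrite mulrNz -pmulrn; ring.
have EY : sc (Rm (z - w - Nc * zeta)) *m leg1 (L (z - Nc * zeta)) *m leg2 (L w) =
  leg2 (L w) *m leg1 (L (z - Nc * zeta)) *m sc (Rs (z - w - Nc * zeta)).
  have E : z - Nc * zeta - w = z - w - Nc * zeta by ring.
  by rewrite -E; apply: exch; rewrite E.
have -> : calL c zeta L K z = L (z - Nc * zeta) *m K z.
  by rewrite /calL /Lplus; congr (L _ *m _); field.
rewrite -leg1M; apply: (exchange_quotient (exch_minus H) EY (Qi' := sc (R21s (- (z - w - Nc * zeta))))).
- rewrite -scalM -[RHS](scal1 A (N * N)); congr scal; apply: mulmx1C.
  by rewrite -(opprB z w); exact: R_unit_gen.
- rewrite -scalM -[RHS](scal1 A (N * N)); congr scal; apply: mulmx1C.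
  have -> : w - z + Nc * zeta = - (z - w - Nc * zeta) by ring.
  exact: R_unit_gen.
- rewrite -scalM -[RHS](scal1 A (N * N)); congr scal.
  exact: (R_unit hN taus1 sigs_zeta (gen_reg hN zeta1 taus1 (gens gN))).
- by rewrite leg1M KX leg1_1.
- by rewrite leg1M XK leg1_1.
Qed.

Lemma tgen_commute z w : gen zeta tau (w - z) ->
  forall i j, tgen c zeta L K z * L w i j = L w i j * tgen c zeta L K z.
Proof.
move=> H; have H' : gen zeta tau (z - w) by rewrite -opprB; exact: genN.
have gN : gen zeta tau (z - w - Nc * zeta).
  by apply: (gen_zeta (b := - N%:Z) H'); rewrite mulrNz -pmulrn; ring.
apply: (trace_commute (exch_calL H') (Q := tr2 (Rm (z - w - Nc * zeta)))).
  apply: mulmx1C; have E : w - z = - (z - w - Nc * zeta) - Nc * zeta by ring.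
  rewrite E; apply: (R_cross hN zeta1 tau1 sig_zeta); first exact: gen_reg.
  by rewrite subrK; exact: gen_reg.
have E : w - z + Nc * zeta = - (z - w - Nc * zeta) by ring.
by rewrite tr2K E; exact: R_unit_gen.
Qed.

Lemma tgen_commute_calL z w : gen zeta tau (w - z) ->
  forall i j, tgen c zeta L K z * calL c zeta L K w i j = calL c zeta L K w i j * tgen c zeta L K z.
Proof.
move=> H; set t := tgen c zeta L K z.
have H1 : forall i j, t * Lplus c zeta L (w + c / 2 * zeta) i j = Lplus c zeta L (w + c / 2 * zeta) i j * t.
  by apply: tgen_commute; apply: (gen_zeta (b := - N%:Z) H); rewrite mulrNz -pmulrn; field.
have H2 : forall i j, t * L (w + tau + 1) i j = L (w + tau + 1) i j * t.
  apply: tgen_commute; have -> : w + tau + 1 - z = w - z + tau + 1 by ring.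
  by apply: gen_int; have := gen_shift 1 0 H; congr gen; ring.
have Hm (X Y : 'M[A]_N) : (forall i j, t * X i j = X i j * t) -> (forall i j, t * Y i j = Y i j * t) ->
  forall i j, t * (X *m Y) i j = (X *m Y) i j * t.
  move=> hX hY i j; rewrite !mxE mulr_sumr mulr_suml; apply: eq_bigr => k _.
  by rewrite [LHS]mulrA hX -[LHS]mulrA hY [LHS]mulrA.
have Hs (B : 'M[C]_N) i j : t * map_mx (in_alg A) B i j = map_mx (in_alg A) B i j * t.
  by rewrite !mxE mulr_algl mulr_algr.
apply: (Hm) => //; apply: commute_inverse (hK w) _.
exact: (Hm _ _ (Hm _ _ (Hs _) H2) (Hs _)).
Qed.

Lemma tgen_commuteC z w : gen zeta tau (w - z) ->
  tgen c zeta L K z * tgen c zeta L K w = tgen c zeta L K w * tgen c zeta L K z.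
Proof.
move=> H; rewrite {2 4}/tgen /mxtrace mulr_sumr mulr_suml; apply: eq_bigr => i _.
exact: tgen_commute_calL.
Qed.

End Centre.

(** * Derivatives of matrices *)

Section MatrixDerivative.
Variable R : realType.
Local Notation C := R[i].

Definition mhasD m n (F : C -> 'M[C]_(m, n)) x (D : 'M[C]_(m, n)) :=
  forall i j, hasD (fun s => F s i j) x (D i j).

Definition mderive m n (F : C -> 'M[C]_(m, n)) x : 'M[C]_(m, n) :=
  \matrix_(i, j) cderive (fun s => F s i j) x.

Lemma dif_mhasD m n (F : C -> 'M[C]_(m, n)) x :
  (forall i j, dif (fun s => F s i j) x) -> mhasD F x (mderive F x).
Proof. by move=> H i j; rewrite mxE; exact: dif_hasD. Qed.

Lemma mhasD_cst m n (M : 'M[C]_(m, n)) x : mhasD (fun=> M) x 0.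
Proof. by move=> i j; rewrite mxE; exact: hasD_cst. Qed.

Lemma mhasD_mul m n k (F : C -> 'M[C]_(m, n)) (G : C -> 'M[C]_(n, k)) x D E :
  mhasD F x D -> mhasD G x E -> mhasD (fun s => F s *m G s) x (D *m G x + F x *m E).
Proof.
move=> HF HG i j.
have -> : (D *m G x + F x *m E) i j = \sum_l (D i l * G x l j + F x i l * E l j).
  by rewrite !mxE big_split.
apply: (eq_hasD (f := fun s => \sum_l F s i l * G s l j)); first by move=> s; rewrite mxE.
by apply: hasD_sum => l; exact: hasD_mul.
Qed.

Lemma mhasD_uniq m n (F : C -> 'M[C]_(m, n)) x D E : mhasD F x D -> mhasD F x E -> D = E.
Proof. by move=> H K; apply/matrixP => i j; exact: hasD_uniq (H i j) (K i j). Qed.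

Lemma mhasD_local m n (F G : C -> 'M[C]_(m, n)) x D :
  (exists2 d : R, 0 < d & forall h, nrm h < d -> G (x + h) = F (x + h)) ->
  mhasD F x D -> mhasD G x D.
Proof.
move=> [d d0 E] H i j; apply: hasD_local (H i j).
by exists d => // h /E ->.
Qed.

Lemma mhasD_tr2 N (F : C -> 'M[C]_(N * N)) x D :
  mhasD F x D -> mhasD (fun s => tr2 (F s)) x (tr2 D).
Proof.
move=> H i j; rewrite mxE; apply: eq_hasD (H _ _) => s.
by rewrite mxE.
Qed.

Lemma near_and (P Q : C -> Prop) :
  (exists2 d : R, 0 < d & forall h, nrm h < d -> P h) ->
  (exists2 d : R, 0 < d & forall h, nrm h < d -> Q h) ->
  exists2 d : R, 0 < d & forall h, nrm h < d -> P h /\ Q h.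
Proof.
move=> [d d0 H] [e e0 K]; exists (Num.min d e); first by rewrite lt_min d0 e0.
by move=> h; rewrite lt_min => /andP[/H ? /K ?].
Qed.

Lemma invmx_eq n (M M' : 'M[C]_n) : M *m M' = 1%:M -> invmx M = M'.
Proof. by move=> H; have [U _] := mulmx1_unit H; apply: (can_inj (mulKmx U)); rewrite mulmxV. Qed.

End MatrixDerivative.

(** Let B = A^-1, and let the partial transpose of D be inverse to that of Ar, where Ar
    stands for A reflected at s0.  The derivative of A0 B A0 at s0 is the opposite of that
    of A, while the one of the partially transposed D is X A' X, with X the inverse of
    the partially transposed A0 and A' the partially transposed derivative of A: the two
    contributions to the derivative of M cancel. *)
Lemma cancelling_derivative (R : realType) (N : nat) (A B D Ar : R[i] -> 'M[R[i]]_(N * N)) s0 DA DB DD A0 :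
  mhasD A s0 DA -> mhasD B s0 DB -> mhasD D s0 DD -> mhasD Ar s0 (- DA) ->
  A s0 = A0 -> Ar s0 = A0 ->
  (exists2 d : R, 0 < d & forall h, nrm h < d -> B (s0 + h) *m A (s0 + h) = 1%:M) ->
  (exists2 d : R, 0 < d & forall h, nrm h < d -> tr2 (D (s0 + h)) *m tr2 (Ar (s0 + h)) = 1%:M) ->
  let M s := tr2 (tr2 (A0 *m B s *m A0) *m tr2 (D s)) in
  M s0 = 1%:M /\ mhasD M s0 0.
Proof.
move=> HA HB HD HAr A0E A0Er BA DAr M.
have at0 (P : R[i] -> Prop) : (exists2 d : R, 0 < d & forall h, nrm h < d -> P (s0 + h)) -> P s0.
  by case=> d d0 /(_ 0); rewrite addr0 nrm0; exact.
have := at0 (fun s => B s *m A s = 1%:M) BA; rewrite A0E => BA0; have AB0 := mulmx1C BA0.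
have := at0 (fun s => tr2 (D s) *m tr2 (Ar s) = 1%:M) DAr; rewrite A0Er => X1; have X2 := mulmx1C X1.
have tr2N (Q : 'M[R[i]]_(N * N)) : tr2 (- Q) = - tr2 Q by rewrite -scaleN1r tr2Z scaleN1r.
have E1 : DB *m A0 + B s0 *m DA = 0.
  by rewrite -A0E; apply: mhasD_uniq (mhasD_mul HB HA) _; apply: mhasD_local (mhasD_cst 1%:M s0).
have E2 : tr2 DD *m tr2 A0 + tr2 (D s0) *m tr2 (- DA) = 0.
  rewrite -A0Er; apply: mhasD_uniq (mhasD_mul (mhasD_tr2 HD) (mhasD_tr2 HAr)) _.
  exact: mhasD_local (mhasD_cst 1%:M s0).
have ABA : A0 *m B s0 *m A0 = A0 by rewrite AB0 mul1mx.
have E3 : A0 *m DB *m A0 = - DA.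
  rewrite -mulmxA; have -> : DB *m A0 = - (B s0 *m DA) by apply/eqP; rewrite -addr_eq0 E1.
  by rewrite mulmxN mulmxA AB0 mul1mx.
have E4 : tr2 DD = tr2 (D s0) *m tr2 DA *m tr2 (D s0).
  have -> : tr2 DD = tr2 DD *m tr2 A0 *m tr2 (D s0) by rewrite -mulmxA X2 mulmx1.
  have -> : tr2 DD *m tr2 A0 = - (tr2 (D s0) *m tr2 (- DA)) by apply/eqP; rewrite -addr_eq0 E2.
  by rewrite tr2N mulmxN opprK.
split; first by rewrite /M ABA X2 tr2_1.
have HM := mhasD_tr2 (mhasD_mul (mhasD_tr2 (mhasD_mul (mhasD_mul (mhasD_cst A0 s0) HB) (mhasD_cst A0 s0)))
  (mhasD_tr2 HD)).
have E5 : tr2 (tr2 ((0 *m B s0 + A0 *m DB) *m A0 + A0 *m B s0 *m 0) *m tr2 (D s0) +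
  tr2 (A0 *m B s0 *m A0) *m tr2 DD) = 0.
  rewrite mul0mx add0r mulmx0 addr0 E3 ABA E4 !mulmxA X2 mul1mx.
  by rewrite tr2N mulNmx addNr tr20.
by rewrite E5 in HM.
Qed.

(** * The derivative of Y *)

Section Bracket.
Variable R : realType.
Local Notation C := R[i].
Variable N : nat.
Hypothesis hN : (1 < N)%N.
Variables zeta tau : C.
Hypothesis zeta1 : `|epi zeta| < 1.
Hypothesis tau1 : `|epi (2 * tau)| < 1.
Hypothesis zeta_reg : sigma tau zeta != 0.
Local Notation Nc := (N%:R : C).
Local Notation Rm y := (Rmx N y zeta tau).
Local Notation R21m y := (R21 N y zeta tau).
Local Notation f := (ftau N zeta).
Local Notation regf := (reg N zeta tau).
Variable x : C.
Hypothesis genx : gen zeta tau x.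

Let N0 : Nc != 0. Proof. by rewrite pnatr_eq0 -lt0n ltnW. Qed.
Let gm := genN genx.

Lemma dif_R21 y i j : regf y != 0 -> dif (fun s => R21m s i j) y.
Proof.
move=> r; case: (mxtens_indexP i) => a b; case: (mxtens_indexP j) => k l.
apply: (eq_dif (f := fun s => Rm s (mxtens_index (b, a)) (mxtens_index (l, k)))).
  by move=> s; rewrite /R21 flip_mulr flip_mull.
exact: dif_Rmx.
Qed.

Lemma aff_near a b : regf (a + b * - Nc) != 0 ->
  exists2 d : R, 0 < d & forall h, nrm h < d -> regf (a + b * (- Nc + h)) != 0.
Proof.
move=> r; apply: (near_neq0 (f := fun s => regf (a + b * s))) => //.
by apply: dif_comp_aff => ?; exact: dif_reg.
Qed.

Lemma mhasD_Rm a b : regf (a + b * - Nc) != 0 -> exists D, mhasD (fun s => Rm (a + b * s)) (- Nc) D.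
Proof.
move=> r; eexists; apply: dif_mhasD => i j.
by apply: (dif_comp (f := fun s => a + b * s)) (dif_Rmx _ _ _ _ _ _) => //; exact: dif_aff.
Qed.

Lemma mhasD_R21 a b : regf (a + b * - Nc) != 0 -> exists D, mhasD (fun s => R21m (a + b * s)) (- Nc) D.
Proof.
move=> r; eexists; apply: dif_mhasD => i j.
by apply: (dif_comp (f := fun s => a + b * s)) (dif_R21 _ _ _) => //; exact: dif_aff.
Qed.

(** By unitarity the three matrices of the first factor of M are of the form A0, A^-1 and
    A0 with A(c) = R_21(q^(c + N) x), and by crossing the second factor is, up to
    partial transposition, the inverse of A at the opposite value of c + N. *)
Lemma Mmx_derivative :
  Mmx N zeta tau x (- Nc) = 1%:M /\ mhasD (Mmx N zeta tau x) (- Nc) 0.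
Proof.
have rx : regf x != 0 by exact: gen_reg.
have rm : regf (- x) != 0 by exact: gen_reg.
have gN : gen zeta tau (- Nc * zeta - x).
  by apply: (gen_zeta (b := - N%:Z) gm); rewrite mulrNz -pmulrn; ring.
pose A0 := R21m x.
pose A s := R21m ((x + Nc * zeta) + zeta * s).
pose B s := Rm ((- x - Nc * zeta) + (- zeta) * s).
pose D s := Rm (- x + zeta * s).
pose A2 s := R21m ((x - Nc * zeta) + (- zeta) * s).
have eA : x + Nc * zeta + zeta * - Nc = x by ring.
have eB : - x - Nc * zeta + - zeta * - Nc = - x by ring.
have eD : - x + zeta * - Nc = - Nc * zeta - x by ring.
have eA2 : x - Nc * zeta + - zeta * - Nc = x by ring.
have [DA HA] := @mhasD_R21 (x + Nc * zeta) zeta ltac:(by rewrite eA).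
have [DB HB] := @mhasD_Rm (- x - Nc * zeta) (- zeta) ltac:(by rewrite eB).
have [DD HD] := @mhasD_Rm (- x) zeta ltac:(by rewrite eD; exact: gen_reg).
have [DA2 HA2] := @mhasD_R21 (x - Nc * zeta) (- zeta) ltac:(by rewrite eA2).
have A0E : A (- Nc) = A0 := congr1 (fun y => R21m y) eA.
have A20E : A2 (- Nc) = A0 := congr1 (fun y => R21m y) eA2.
(* A2 is A reflected at - N, so that its derivative there is the opposite one. *)
have DAE : DA2 = - DA.
  apply: mhasD_uniq HA2 _ => i j.
  have Hr : hasD (fun s : C => - 2 * Nc + (-1) * s) (- Nc) (-1).
    by have := hasD_add (hasD_cst (- 2 * Nc) (- Nc)) (hasD_scale (-1) (hasD_id (- Nc))); rewrite add0r mulr1.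
  have H1 : hasD (fun s => A s i j) (- 2 * Nc + (-1) * - Nc) (DA i j).
    have -> : - 2 * Nc + (-1) * - Nc = - Nc by ring.
    exact: (HA i j).
  have -> : (- DA) i j = DA i j * -1 by rewrite mxE mulrN1.
  apply: eq_hasD (hasD_comp Hr H1) => s.
  have e : x + Nc * zeta + zeta * (- 2 * Nc + (-1) * s) = x - Nc * zeta + - zeta * s by ring.
  exact: (congr1 (fun y => R21m y i j) e).
have nB := @aff_near (- x - Nc * zeta) (- zeta) ltac:(by rewrite eB).
have nD := @aff_near (- x) zeta ltac:(by rewrite eD; exact: gen_reg).
have eD2 : - x + Nc * zeta + zeta * - Nc = - x by ring.
have nD2 := @aff_near (- x + Nc * zeta) zeta ltac:(by rewrite eD2).
have BA s : regf ((- x - Nc * zeta) + (- zeta) * s) != 0 -> B s *m A s = 1%:M.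
  move=> r; have := R_unit hN tau1 zeta_reg r.
  have -> : - ((- x - Nc * zeta) + (- zeta) * s) = (x + Nc * zeta) + zeta * s by ring.
  exact.
have DA2s s : regf (- x + zeta * s) != 0 -> regf (- x + Nc * zeta + zeta * s) != 0 ->
   tr2 (D s) *m tr2 (A2 s) = 1%:M.
  move=> r1 r2; have r3 : regf (- x + zeta * s + Nc * zeta) != 0.
    have -> : - x + zeta * s + Nc * zeta = - x + Nc * zeta + zeta * s by ring.
    exact: r2.
  have := R_cross hN zeta1 tau1 zeta_reg r1 r3.
  have -> : - (- x + zeta * s) - Nc * zeta = (x - Nc * zeta) + (- zeta) * s by ring.
  exact.
have B0A0 : Rm (- x) *m A0 = 1%:M.
  by have := R_unit hN tau1 zeta_reg rm; rewrite opprK.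
have ME s : regf ((- x - Nc * zeta) + (- zeta) * s) != 0 ->
  Mmx N zeta tau x s = tr2 (tr2 (A0 *m B s *m A0) *m tr2 (D s)).
  move=> r; rewrite /Mmx (invmx_eq B0A0).
  have -> : (s + Nc) * zeta + x = (x + Nc * zeta) + zeta * s by ring.
  have -> : s * zeta - x = - x + zeta * s by ring.
  by rewrite (invmx_eq (mulmx1C (BA s r))).
rewrite DAE in HA2.
have [||M0 HM] := cancelling_derivative HA HB HD HA2 A0E A20E.
- case: nB => d d0 H; exists d; [exact: d0|move=> h hh; exact: (BA _ (H h hh))].
- case: (near_and nD nD2) => d d0 H; exists d; [exact: d0|move=> h hh].
  by have [r1 r2] := H h hh; exact: (DA2s _ r1 r2).
split; first by rewrite ME; [exact: M0|rewrite eB].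
apply: mhasD_local HM; case: nB => d d0 H; exists d; [exact: d0|move=> h hh; exact: (ME _ (H h hh))].
Qed.

(** T is built from four values of f, two of which depend on c, through x - c zeta and
    - x - c zeta; at c = - N they are values at x and - x, up to the period of f. *)
Lemma Tfactor_derivative :
  Tfactor N zeta x (- Nc) = 1 /\
  hasD (Tfactor N zeta x) (- Nc) (- (ipi R * zeta) * (dlog f x - dlog f (- x))).
Proof.
have per y : gen zeta tau y -> f (y + Nc * zeta) = f y.
  by move=> /(ftau_poles hN zeta1 tau1)[n1 n2]; exact: ftau_periodic.
have dper y : gen zeta tau y -> hasD f (y + Nc * zeta) (cderive f y).
  move=> H; have H1 := dif_hasD (dif_ftau hN zeta1 tau1 H).
  have [n1 n2] := ftau_poles hN zeta1 tau1 H.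
  have H2 : hasD (fun v => f (v + Nc * zeta)) y (cderive f y).
    apply: hasD_local H1.
    have [|//|d d0 Hd] := @near_neq0 R (fun v => poP N zeta (0 + (-1) * v)) y.
    - by apply: dif_comp_aff => ?; exact: dif_poP.
    - by rewrite add0r mulN1r.
    have [|//|e e0 He] := @near_neq0 R (fun v => poP N zeta (Nc * zeta + 1 * v)) y.
    - by apply: dif_comp_aff => ?; exact: dif_poP.
    - by rewrite mul1r.
    have [r r0 Hr] := near_and (ex_intro2 _ _ d d0 Hd) (ex_intro2 _ _ e e0 He).
    exists r => // h /Hr[]; rewrite add0r mulN1r mul1r => m1 m2.
    exact: ftau_periodic.
  have Hs : hasD (fun s : C => s + - (Nc * zeta)) (y + Nc * zeta) 1.
    by have := hasD_add (hasD_id (y + Nc * zeta)) (hasD_cst (- (Nc * zeta)) _); rewrite addr0.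
  have H3 : hasD (fun v => f (v + Nc * zeta)) (y + Nc * zeta + - (Nc * zeta)) (cderive f y) by rewrite addrK.
  have := hasD_comp Hs H3; rewrite mulr1; apply: eq_hasD => s.
  by rewrite subrK.
have f0 := ftau_neq0 hN zeta1 tau1 genx; have f1 := ftau_neq0 hN zeta1 tau1 gm.
have Hx y : gen zeta tau y -> hasD (fun c => f (y + (- zeta) * c)) (- Nc) (cderive f y * - zeta).
  move=> H; have Ha : hasD (fun c => y + (- zeta) * c) (- Nc) (- zeta).
    by have := hasD_add (hasD_cst y (- Nc)) (hasD_scale (- zeta) (hasD_id (- Nc))); rewrite add0r mulr1.
  apply: (hasD_comp Ha); have -> : y + - zeta * - Nc = y + Nc * zeta by ring.
  exact: dper.
have Vx y : gen zeta tau y -> f (y + (- zeta) * - Nc) = f y.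
  by move=> H; rewrite -(per _ H); congr f; ring.
have TE c : Tfactor N zeta x c = f (- x) * f (x + (- zeta) * c) * (f x * f (- x + (- zeta) * c))^-1.
  rewrite /Tfactor /ftau; congr (_ * tauN N _ zeta / (_ * tauN N _ zeta)); ring.
split.
  by rewrite TE !Vx // [f (- x) * _]mulrC divff // mulf_neq0.
apply: (eq_hasD (f := fun c => f (- x) * f (x + (- zeta) * c) * (f x * f (- x + (- zeta) * c))^-1)).
  by move=> c; rewrite TE.
have n0 : f x * f (- x + (- zeta) * - Nc) != 0 by rewrite Vx // mulf_neq0.
have HF := hasD_mul (hasD_scale (f (- x)) (Hx x genx))
  (@hasD_inv R (fun c => f x * f (- x + (- zeta) * c)) _ _ n0 (hasD_scale (f x) (Hx _ gm))).
move: HF; rewrite !Vx // => HF; congr (hasD _ _ _): HF.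
rewrite /dlog; move: f0 f1 (ipi_neq0 R); move: (f x) (f (- x)) (ipi R) (cderive f x) (cderive f (- x)).
by move=> a b i D0 D1 a0 b0 i0; field; rewrite a0 b0 i0.
Qed.

Lemma Ymx_derivative i j :
  hasD (fun c => Ymx N zeta tau x c i j) (- Nc)
    (- (ipi R * zeta) * (dlog f x - dlog f (- x)) *+ (i == j)).
Proof.
have [M0 HM] := Mmx_derivative; have [T0 HT] := Tfactor_derivative.
have := hasD_mul HT (HM i j); rewrite M0 T0 !mxE mulr0 addr0 mulr_natr.
by apply: eq_hasD => c; rewrite [RHS]mxE.
Qed.

End Bracket.

Theorem theorem3 (R : realType) (N : nat) (zeta tau : R[i])
    (A : algType R[i]) (L K : R[i] -> 'M[A]_N)
    (hN : (1 < N)%N)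
    (hq : `|epi zeta| < 1) (hp : `|epi (2 * tau)| < 1)
    (hR : q_regular zeta tau)
    (hRstar : q_regular zeta (tau_star (- N%:R) zeta tau))
    (hL : Aqp_sl (- N%:R) zeta tau L)
    (hK : forall xi : R[i], is_inverse (Lminus tau L xi) (K xi)) :
  let t := tgen (- N%:R) zeta L K in
  (forall xiz xiw : R[i], generic zeta tau (xiw - xiz) ->
     forall i j : 'I_N, t xiz * L xiw i j = L xiw i j * t xiz)
  /\
  (forall xiz xiw : R[i], generic zeta tau (xiw - xiz) ->
     let x := xiw - xiz in
     (forall i j : 'I_(N * N),
        cderivable (fun c => Ymx N zeta tau x c i j) (- N%:R))
     /\
     natural_bracket zeta tau L K xiz xiw
     = (- (ipi R * zeta)
          * (dlog (fun y => tauN N (zeta / 2 + y) zeta) x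
             - dlog (fun y => tauN N (zeta / 2 + y) zeta) (- x)))
       *: (t xiz * t xiw)).
Proof.
move=> t; case: hL => hgl _.
have zr : sigma tau zeta != 0 := sig_zeta hp hR.
have comm := tgen_commute hN hq hp hR hRstar hgl hK.
have commC := tgen_commuteC hN hq hp hR hRstar hgl hK.
split=> [z w /genericE H i j|z w /genericE H x]; first exact: comm.
have HY := Ymx_derivative hN hq hp zr H; split=> [i j|]; first exact: hasD_derivable (HY i j).
rewrite /t (commC _ _ H) /natural_bracket /tgen /mxtrace -/x.
set T := _ * (_ - _); set Lz := calL _ _ _ _ z; set Lw := calL _ _ _ _ w.
have D i1 i2 j1 j2 : cderive (fun c => Ymx N zeta tau x c (mxtens_index (i1, i2)) (mxtens_index (j1, j2))) (- N%:R)
    = T *+ ((i1 == j1) && (i2 == j2)).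
  by rewrite (hasD_cderive (HY _ _)) (inj_eq (can_inj (@mxtens_indexK N N))) xpair_eqE.
transitivity (\sum_(i1 < N) \sum_(i2 < N) T *: (Lw i2 i2 * Lz i1 i1)).
  apply: eq_bigr => i1 _; apply: eq_bigr => i2 _.
  rewrite (bigD1 i1) //= [X in _ + X]big1 => [|j1 j1n]; last first.
    by apply: big1 => j2 _; rewrite D eq_sym (negPf j1n) mulr0n scale0r.
  rewrite addr0 (bigD1 i2) //= [X in _ + X]big1 => [|j2 j2n]; last first.
    by rewrite D [i2 == _]eq_sym (negPf j2n) andbF mulr0n scale0r.
  by rewrite addr0 D !eqxx mulr1n.
rewrite mulr_sumr scaler_sumr; apply: eq_bigr => i1 _.
by rewrite mulr_suml scaler_sumr.
Qed.
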